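(* For all twist knots $K$ (that is, $K=K_p$ with $p\in\mathbb Z$), the rational map $\phi$ given by the formulas $$\phi(E)=\frac{L(M^2-1)^2}{M(L+M)(1+LM)},\qquad \phi(Q)=\frac{1+LM}{L+M}$$ induces a Zariski dense map of degree $2$ $$\phi:\{(L,M)\in\mathbb C^2\mid A_K(L,M^{1/2})=0\}\longrightarrow\{(E,Q)\in\mathbb C^2\mid C_K^{\mathrm{op}}(E,Q)=0\},$$ where $A_K$ is the $A$-polynomial and $C_K$ is the $C$-polynomial of $K$.
   Context: **The map.** $\phi:\mathbb Q(E,Q)\to\mathbb Q(L,M)$ is the map of function fields defined by the formulas in the claim; geometrically it is the rational map $\mathbb C^2\to\mathbb C^2$ sending $(L,M)$ to $(E,Q)=(\phi(E),\phi(Q))$, and the claim concerns its restriction to the indicated curves. **Operators.** A discrete function is a map $f:\mathbb N=\{0,1,2,\dots\}\to\mathbb Q(q)$. Operators act by $(Ef)(n)=f(n+1)$, $(Qf)(n)=q^nf(n)$, so $EQ=qQE$. Let $\mathcal A=\mathbb Q(q)\langle Q,E\rangle/(EQ-qQE)$ and $\mathcal A_{\mathrm{loc}}=\mathbb Q(q,Q)\langle E\rangle/(E\alpha(Q,q)-\alpha(qQ,q)E\mid\alpha\in\mathbb Q(Q,q))$, a (left) principal ideal domain. For a discrete function $f$ let $I_f=\{P\in\mathcal A\mid Pf=0\}$. The characteristic polynomial of $f$ is a generator $P_f(E,Q,q)$ of the left ideal of $\mathcal A_{\mathrm{loc}}$ generated by $I_f$ (unique up to left multiplication by a nonzero element of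 $\mathbb Q(q,Q)$). **$C$-polynomial.** For a knot $K$, $J_K(n)\in\mathbb Z[q^{\pm1}]$ ($n\ge1$) is the colored Jones function (color: the $n$-dimensional irreducible representation of $\mathfrak{sl}_2$; value $1$ on the unknot). The cyclotomic function $\hat J_K:\mathbb N\to\mathbb Z[q^{\pm1}]$ is determined by $J_K(n)=\sum_{k\ge0}C(n,k)\hat J_K(k)$ for $n\ge1$, with $C(n,k)=\{n-k\}\cdots\{n-1\}\{n+1\}\cdots\{n+k\}$, $\{a\}=q^{a/2}-q^{-a/2}$. The non-commutative $C$-polynomial $C_K(E,Q,q)$ is the characteristic polynomial of $\hat J_K$, and the $C$-polynomial is $C_K(E,Q)=C_K(E,Q,1)$. For twist knots the non-commutative $C$-polynomial is normalized to be monic in $E$; it then has coefficients in $\mathbb Z[Q^{\pm1},q^{\pm1}]$. For $P(E,Q)$ polynomial in $E$, $P^{\mathrm{op}}(E,Q)=E^{\deg_EP}P(E^{-1},Q)$. (For $p<0$ negative powers of $Q$ can occur, and the zero set is then taken where $Q\ne0$.) **Twist knots.** $K_p$ ($p\in\mathbb Z$) is the twist knot with $p$ full twists and a negative clasp; $K_0$ is the unknot, $K_1=3_1$, $K_2=5_2$, $K_{-1}=4_1$, $K_{-2}=6_1$. Its cyclotomic function is known (Masbaum) to be $$\hat J_p(n)=\sum_{k=0}^{n}q^{n(n+3)/2+pk(k+1)+k(k-1)/2}(-1)^{n+k+1}\frac{(q^{2k+1}-1)(q;q)_n}{(q;q)_{n+k+1}(q;q)_{n-k}},$$ with $(q;q)_m=(1-q)\cdots(1-q^m)$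 and $(q;q)_0=1$. **$A$-polynomial.** The $A$-polynomial $A_K(L,M)\in\mathbb Z[L,M]$ (Cooper–Culler–Gillet–Long–Shalen) is the primitive polynomial without repeated factors whose zero set is the closure of the one-dimensional part of the set of eigenvalue pairs $(L,M)$ (longitude, meridian, common eigenvector) of $\mathrm{SL}_2(\mathbb C)$ representations of the knot group, with the factor $L-1$ coming from abelian representations removed. It contains only even powers of $M$, so $A_K(L,M^{1/2})$ is a polynomial in $L,M$. For $A_p=A_{K_p}$ the conventions are those of Hoste–Shanahan: $A_0=1$, $A_1=L+M^6$, $A_{-1}=-L+LM^2+M^4+2LM^4+L^2M^4+LM^6-LM^8$, $A_2=-L^2+L^3+2L^2M^2+LM^4+2L^2M^4-LM^6-L^2M^8+2LM^{10}+L^2M^{10}+2LM^{12}+M^{14}-LM^{14}$, and for $p\ge3$ or $p\le-2$ $$A_p=x\,A_{p-\mathrm{sgn}(p)}-y\,A_{p-2\,\mathrm{sgn}(p)},$$ $$x=-L+L^2+2LM^2+M^4+2LM^4+L^2M^4+2LM^6+M^8-LM^8,\qquad y=M^4(L+M^2)^4 .$$ **Trivial case.** For $p=0$ one has $A_{K_0}=1$ and $C_{K_0}=1$, so both zero sets are empty and the statement is vacuous. *)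

(* Defs.v *)
From HB Require Import structures.
From mathcomp Require Import all_boot all_order all_algebra.
From mathcomp Require Import boolp classical_sets functions cardinality.
From mathcomp Require Import complex reals.

Set Implicit Arguments.
Unset Strict Implicit.
Unset Printing Implicit Defensive.

Import Order.TTheory GRing.Theory Num.Theory.
Local Open Scope ring_scope.
Local Open Scope classical_set_scope.

(* A bivariate polynomial is a {poly {poly _}}: its outer variable 'X is the  *)
(* first one (E or L) and its inner variable 'Y is the second one (Q or M).   *)

Definition Qq : fieldType := {fraction {poly rat}}.
Definition QqQ : fieldType := {fraction {poly Qq}}.

Definition q_ : Qq := FracField.tofrac ('X : {poly rat}).

Definition discrete_fun := nat -> Qq.

Definition opE (f : discrete_fun) : discrete_fun := fun n => f n.+1.
Definition opQ (f : discrete_fun) : discrete_fun := fun n => q_ ^+ n * f n.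

(* By the relation EQ = qQE, an element of the algebra A is uniquely a sum of *)
(* terms c Q^i E^j; such a sum is represented by the bivariate polynomial     *)
(* with the same coefficients, whose ring product is not that of A.           *)
Definition act (P : {poly {poly Qq}}) (f : discrete_fun) : discrete_fun :=
  fun n => \sum_(j < size P) \sum_(i < size P`_j)
             P`_j`_i * iter i opQ (iter j opE f) n.

Definition annihilator (f : discrete_fun) : set {poly {poly Qq}} :=
  [set P | forall n, act P f n = 0].

Section ScaleVariable.

Variables (k : fieldType) (a : k).

(* c(X) |-> c(a X); see frac_scale_div for the independence of the            *)
(* representative. *)
Definition frac_scale (c : {fraction {poly k}}) : {fraction {poly k}} :=
  FracField.tofrac ((frac (repr c)).1 \Po (a *: 'X)) /
  FracField.tofrac ((frac (repr c)).2 \Po (a *: 'X)).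

Lemma scale_neq0 (v : {poly k}) : a != 0 -> v != 0 -> v \Po (a *: 'X) != 0.
Proof.
move=> a0; apply: contra_neq => va0.
have aK : (a *: 'X) \Po (a^-1 *: 'X) = 'X :> {poly k}.
  by rewrite comp_polyZ comp_polyX scalerA mulfV // scale1r.
by rewrite -[v]comp_polyXr -aK comp_polyA va0 comp_poly0.
Qed.

Lemma frac_repr (c : {fraction {poly k}}) :
  c = FracField.tofrac (frac (repr c)).1 / FracField.tofrac (frac (repr c)).2.
Proof.
have d0 : (frac (repr c)).2 != 0 by exact: denom_ratioP.
apply: (canRL (mulfK _)); first by rewrite tofrac_eq0.
rewrite -{1}[c]reprK; unlock FracField.tofrac; rewrite -[LHS]FracField.pi_mul.
apply/eqmodP; rewrite /= FracField.equivfE /FracField.mulf.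
by rewrite !numden_Ratio ?mulf_neq0 ?oner_eq0 // !mulr1 mulrC.
Qed.

Lemma frac_scale_div (u v : {poly k}) : a != 0 -> v != 0 ->
  frac_scale (FracField.tofrac u / FracField.tofrac v) =
  FracField.tofrac (u \Po (a *: 'X)) / FracField.tofrac (v \Po (a *: 'X)).
Proof.
move=> a0 v0; rewrite /frac_scale; set c := (X in repr X).
have d0 : (frac (repr c)).2 != 0 by exact: denom_ratioP.
have /eqP := frac_repr c.
rewrite {1}/c eqr_div ?tofrac_eq0 // -!tofracM tofrac_eq => /eqP uvE.
apply/eqP; rewrite eqr_div ?tofrac_eq0 ?scale_neq0 // -!tofracM tofrac_eq.
by rewrite -!comp_polyM uvE.
Qed.

End ScaleVariable.

(* alpha(Q, q) |-> alpha(q Q, q) *)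
Definition qshift : QqQ -> QqQ := @frac_scale Qq q_.

(* The product of A_loc, on operators written with their coefficients to the  *)
(* left of the powers of E: (a E^i) (b E^j) = a (qshift^i b) E^(i+j).         *)
Definition skew_mul (P S : {poly QqQ}) : {poly QqQ} :=
  \sum_(i < size P) \sum_(j < size S)
     (P`_i * iter i qshift S`_j) *: 'X^(i + j).

Definition to_loc (P : {poly {poly Qq}}) : {poly QqQ} :=
  map_poly (@FracField.tofrac {poly Qq}) P.

Definition left_ideal (S : set {poly QqQ}) : set {poly QqQ} :=
  [set P | exists s : seq ({poly QqQ} * {poly QqQ}),
     (forall x, x \in s -> S x.2) /\ P = \sum_(x <- s) skew_mul x.1 x.2].

Definition is_char_poly (f : discrete_fun) (P : {poly QqQ}) : Prop :=
  left_ideal (to_loc @` annihilator f) = left_ideal [set P].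

Definition qpoch (m : nat) : Qq := \prod_(1 <= i < m.+1) (1 - q_ ^+ i).

(* The cyclotomic function of the twist knot K_p, by Masbaum's formula. *)
Definition Jhat (p : int) : discrete_fun := fun n =>
  \sum_(0 <= k < n.+1)
     q_ ^ (Posz (n * (n + 3))./2 + p * Posz (k * k.+1) + Posz (k * k.-1)./2)
     * (-1) ^+ (n + k + 1)
     * ((q_ ^+ (2 * k + 1) - 1) * qpoch n)
     / (qpoch (n + k + 1) * qpoch (n - k)).

(* Here and below a default value 0 is harmless: with C_p = 0 the zero set of *)
(* C_p would be the whole plane, in which no curve has a dense image.         *)
Definition ncCpoly (p : int) : {poly QqQ} :=
  xget 0 [set P | is_char_poly (Jhat p) P /\ P \is monic].

Definition QQ : fieldType := {fraction {poly int}}.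

Definition Zq_Q_embed (N : {poly {poly int}}) : QqQ :=
  FracField.tofrac
    (map_poly (@FracField.tofrac {poly rat} \o map_poly intr) N : {poly Qq}).

(* c(Q, q) = q^-a Q^-b N(Q, q) is a Laurent polynomial over the integers and  *)
(* r(Q) = c(Q, 1); the inner variable of N is q. *)
Definition specialize_q1 (c : QqQ) (r : QQ) : Prop :=
  exists (a b : nat) (N : {poly {poly int}}),
    FracField.tofrac ((q_ ^+ a)%:P * 'X^b : {poly Qq}) * c = Zq_Q_embed N /\
    FracField.tofrac ('X^b : {poly int}) * r
      = FracField.tofrac (map_poly (horner_eval (1 : int)) N).

Definition Cpoly (p : int) : {poly QQ} :=
  xget 0 [set P : {poly QQ} | forall j, specialize_q1 (ncCpoly p)`_j P`_j].

(* P^op(E, Q) = E^(deg_E P) P(E^-1, Q) *)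
Definition poly_op (F : fieldType) (P : {poly F}) : {poly F} :=
  \poly_(i < size P) P`_((size P).-1 - i).

Section HosteShanahan.

Let L : {poly {poly int}} := 'X.
Let M : {poly {poly int}} := 'X%:P.

Definition HSx : {poly {poly int}} :=
  - L + L ^+ 2 + 2 * L * M ^+ 2 + M ^+ 4 + 2 * L * M ^+ 4 + L ^+ 2 * M ^+ 4
  + 2 * L * M ^+ 6 + M ^+ 8 - L * M ^+ 8.

Definition HSy : {poly {poly int}} := M ^+ 4 * (L + M ^+ 2) ^+ 4.

Definition A_1 : {poly {poly int}} := L + M ^+ 6.

Definition A_m1 : {poly {poly int}} :=
  - L + L * M ^+ 2 + M ^+ 4 + 2 * L * M ^+ 4 + L ^+ 2 * M ^+ 4 + L * M ^+ 6
  - L * M ^+ 8.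

Definition A_2 : {poly {poly int}} :=
  - L ^+ 2 + L ^+ 3 + 2 * L ^+ 2 * M ^+ 2 + L * M ^+ 4 + 2 * L ^+ 2 * M ^+ 4
  - L * M ^+ 6 - L ^+ 2 * M ^+ 8 + 2 * L * M ^+ 10 + L ^+ 2 * M ^+ 10
  + 2 * L * M ^+ 12 + M ^+ 14 - L * M ^+ 14.

End HosteShanahan.

Fixpoint Apoly_pos (n : nat) : {poly {poly int}} :=
  match n with
  | 0 => 1
  | 1 => A_1
  | 2 => A_2
  | (k.+1 as m).+1 => HSx * Apoly_pos m - HSy * Apoly_pos k
  end.

Fixpoint Apoly_neg (n : nat) : {poly {poly int}} :=
  match n with
  | 0 => 1
  | 1 => A_m1
  | (k.+1 as m).+1 => HSx * Apoly_neg m - HSy * Apoly_neg k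
  end.

Definition Apoly (p : int) : {poly {poly int}} :=
  match p with
  | Posz n => Apoly_pos n
  | Negz n => Apoly_neg n.+1
  end.

Definition eval2 (F : fieldType) (N : {poly {poly int}}) (z : F * F) : F :=
  (map_poly (map_poly intr) N).[z.1, z.2].

(* A_p contains only even powers of M, so that the choice of a square root    *)
(* does not matter. *)
Definition A_curve (C : numClosedFieldType) (p : int) : set (C * C) :=
  [set z | eval2 (Apoly p) (z.1, sqrtC z.2) = 0].

(* Zero set of a polynomial in E with Laurent polynomials in Q as             *)
(* coefficients: points with Q = 0 are included exactly when no negative      *)
(* power of Q occurs (m = 0). *)
Definition laurent_zeros (F : fieldType) (P : {poly QQ}) : set (F * F) :=
  [set z | exists (m : nat) (N : {poly {poly int}}),
     [/\ map_poly (@FracField.tofrac {poly int}) N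
           = FracField.tofrac ('X^m : {poly int}) *: P,
         (0 < m)%N -> z.2 != 0
       & eval2 N z = 0]].

Definition Cop_curve (F : fieldType) (p : int) : set (F * F) :=
  @laurent_zeros F (poly_op (Cpoly p)).

Definition phi_dom (F : fieldType) : set (F * F) :=
  [set z | z.2 * (z.1 + z.2) * (1 + z.1 * z.2) != 0].

Definition phi (F : fieldType) (z : F * F) : F * F :=
  let: (L, M) := z in
  (L * (M ^+ 2 - 1) ^+ 2 / (M * (L + M) * (1 + L * M)),
   (1 + L * M) / (L + M)).

Arguments A_curve : clear implicits.
Arguments Cop_curve : clear implicits.
Arguments phi_dom : clear implicits.

Section Zariski.

Variable F : fieldType.
Implicit Types (A B U V W : set (F * F)) (f : F * F -> F * F).

Definition zariski_closed A : Prop :=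
  exists I : set {poly {poly F}},
    A = [set z | forall P, I P -> P.[z.1, z.2] = 0].

Definition zariski_dense A B : Prop :=
  A `<=` B /\ forall Z, zariski_closed Z -> A `<=` Z -> B `<=` Z.

Definition zariski_open_in U W : Prop :=
  exists2 Z, zariski_closed Z & U = W `\` Z.

(* f, defined on D, induces a rational map from V to W with dense image, all  *)
(* of whose fibres over a dense open subset of W have exactly d points. No    *)
(* irreducibility of V or W is assumed. *)
Definition dense_map_of_degree (d : nat) f (D V W : set (F * F)) : Prop :=
  [/\ zariski_dense (V `&` D) V,
      f @` (V `&` D) `<=` W,
      zariski_dense (f @` (V `&` D)) W
    & exists U, [/\ zariski_open_in U W, zariski_dense U W
        & forall w, U w -> (V `&` D `&` f @^-1` [set w] #= `I_d)%card]].

End Zariski.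

(* Main.v *)
(* Let y = q^N. The terms of Masbaum's sum at N, multiplied by                *)
(* V_(p+1) - (1 + q y) V_p + q y V_(p-1), where V_p is the Chebyshev-like     *)
(* polynomial in X = q^-k + q^(k+1), telescope in k. Multiplication by the    *)
(* j-th polynomial of a suitable Newton basis turns the term at N into the    *)
(* term at N - j, so expanding the combination, of degree |p| in X, gives a   *)
(* recursion of order |p| for Jhat p.                                         *)
(*                                                                            *)
(* At q = 1 the reversed recursion is Q^p Gam_p(E, Q), where                  *)
(* (1 - Q) Gam_p = (V_(p+1) - V_p) - Q (V_p - V_(p-1)) for the Chebyshev      *)
(* polynomials V in x = Q + Q^-1 + (1 - Q) E. The two differences are coprime *)
(* in x, so the curve is rational with parameter x, and a polynomial of       *)
(* E-degree < |p| cannot vanish on it. A shorter annihilator of Jhat p would, *)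
(* by skew division and after removal of the powers of q - 1, factor the      *)
(* recursion at q = 1; hence the recursion is minimal and its coefficients    *)
(* are those of C_p.                                                          *)
(*                                                                            *)
(* Since Gam_p satisfies Gam_(p+1) = x Gam_p - Gam_(p-1) and phi carries x to *)
(* the quotient of the Hoste-Shanahan x by the square root of y, A_p is a     *)
(* unit times the pullback of Gam_p. The fibre of phi over (E, Q) is given by *)
(* M + M^-1 = E + Q + Q^-1 and L = (Q M - 1) / (M - Q), which has two points  *)
(* unless E + Q + Q^-1 is 2 or -2. The points to be removed from either curve *)
(* have finitely many second coordinates, and a point of a plane curve is a   *)
(* limit of points whose second coordinate avoids a finite set.               *)

(* Both curves come from one sequence. Put x = Q + Q^-1 + (1 - Q) E and let [Gam p] satisfy Gam_0 =
   1, Gam_1 = E + Q^-1 and Gam_(p+1) = x Gam_p - Gam_(p-1). Away from Q = 0 the zero set of C_p^op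
   is Gam_p = 0 ([Cop_curve_Gam]). On the domain of phi the A-curve is its pullback ([half_A_phi]),
   because phi turns the Hoste-Shanahan recursion, divided by powers of the square root of y, into
   the recursion of [Gam].

   The geometric half is then elementary. A fibre of phi is governed by the quadratic equation M +
   M^-1 = E + Q + Q^-1, with L determined by M and Q ([phi_fibre]), which gives degree 2. Every
   density claim reduces to discarding finitely many values of the second coordinate, and the
   discarded points are recovered as limits by continuity of roots ([root_near], [curve_closure]).
   [dense_map_of_Gam_curve] assembles this.

   The arithmetic half determines C_p. Masbaum's sum satisfies an explicit monic recursion of order
   |p| by telescoping ([newton_tele_step], [cyclotomic_rec]). By [char_poly_criterion] it is the
   characteristic polynomial once no nonzero annihilator of smaller order exists.
   [annihilator_order] proves this by a Gauss-lemma argument at the prime q - 1: a shorter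
   annihilator would split the recursion at q = 1 into two factors of E-degree below |p|.
   [no_factorization] forbids this, since the curve Gam_p = 0 has a generic point with x free and Q
   = a(x)/b(x), where a and b are coprime and the larger of their degrees is |p|. Finally [cJ_Gam]
   evaluates the recursion at q = 1. *)
From HB Require Import structures.
Require Import Defs.
From mathcomp Require Import all_boot all_order all_algebra.
From mathcomp Require Import boolp classical_sets functions cardinality.
From mathcomp Require Import complex reals.
From mathcomp Require Import ring zify.

Set Implicit Arguments.
Unset Strict Implicit.
Unset Printing Implicit Defensive.

Import Order.TTheory GRing.Theory Num.Theory.
Local Open Scope ring_scope.

(** * Density by continuity of the roots *)

Section RootContinuity.

Variable C : numClosedFieldType.
Implicit Types (p h : {poly C}) (f P : {poly {poly C}}).

(** Multiplying by X - t with |t| >= r multiplies the constant coefficient by |t| in modulus and the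
    bound on the r-weighted coefficients by at most 2 |t|. *)
Lemma coef_le_of_far_roots (c r : C) (s : seq C) (k : nat) :
    0 < r -> (forall t, t \in s -> r <= `|t|) ->
  let p := c *: \prod_(t <- s) ('X - t%:P) in
  `|p`_k| * r ^+ k <= 2 ^+ size s * `|p`_0|.
Proof.
move=> r0; elim: s k => [|t s IH] k far /=.
  rewrite big_nil alg_polyC !coefC /= mul1r; case: k => [|k]; first by rewrite mulr1.
  by rewrite normr0 mul0r normr_ge0.
have {}IH j := IH j (fun u us => far u (mem_behead (s := t :: s) us)).
have rt : r <= `|t| by apply: far; rewrite mem_head.
rewrite big_cons scalerAr; set p := c *: _ in IH *.
have pE i : (('X - t%:P) * p)`_i = (if i == 0%N then 0 else p`_i.-1) - t * p`_i.
  by rewrite mulrBl mul_polyC mulrC coefB coefMX coefZ.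
rewrite !{}pE eqxx sub0r normrN normrM exprS -mulrA mulrCA; move: p IH => p IH.
have tb : `|t * p`_k| * r ^+ k <= `|t| * (2 ^+ size s * `|p`_0|).
  by rewrite normrM -mulrA ler_wpM2l.
rewrite [leRHS](_ : _ = `|t| * (2 ^+ size s * `|p`_0|)
    + `|t| * (2 ^+ size s * `|p`_0|)); last by ring.
apply: le_trans (_ : (`|if k == 0%N then 0 else p`_k.-1| + `|t * p`_k|) * r ^+ k <= _).
  by rewrite ler_wpM2r ?ler_normB // exprn_ge0 // ltW.
rewrite mulrDl lerD //.
case: k {tb} => [|k] /=; first by rewrite normr0 mul0r !mulr_ge0 ?exprn_ge0 // ler0n.
rewrite exprS mulrCA; apply: ler_pM => //; first exact: ltW.
by rewrite mulr_ge0 ?exprn_ge0 // ltW.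
Qed.

Lemma exists_small_root h (r : C) (k : nat) :
    0 < r -> 2 ^+ size h * `|h`_0| < `|h`_k| * r ^+ k ->
  exists2 t, root h t & `|t| < r.
Proof.
move=> r0; have [s hE] := closed_field_poly_normal h => small.
have h0 : h != 0.
  by apply: contraTneq small => ->; rewrite !coef0 normr0 mul0r mulr0 ltxx.
have lc0 : lead_coef h != 0 by rewrite lead_coef_eq0.
have [[t ts tr]|far] := pselect (exists2 t, t \in s & `|t| < r).
  by exists t => //; rewrite hE rootZ // root_prod_XsubC.
have {}far t : t \in s -> r <= `|t|.
  move=> ts; rewrite real_leNgt ?normr_real ?gtr0_real //.
  by apply/negP => tr; apply: far; exists t.
have := coef_le_of_far_roots (lead_coef h) k r0 far.
rewrite -hE /= => /le_lt_trans.
have sz : (size s <= size h)%N.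
  by rewrite [in leqRHS]hE size_scale // size_prod_XsubC.
have : 2 ^+ size s * `|h`_0| <= 2 ^+ size h * `|h`_0|.
  by rewrite ler_wpM2r // ler_weXn2l // ler1n.
by move=> /le_lt_trans /(_ small) lt1 /(_ _ lt1); rewrite ltxx.
Qed.

Lemma horner_lipschitz p (a : C) :
  exists2 K, 0 <= K & forall e s, e <= 1 -> `|s| <= e ->
    `|p.[a + s] - p.[a]| <= K * e.
Proof.
elim/poly_ind: p => [|p c [K K0 IH]].
  by exists 0 => // e s _ _; rewrite !horner0 subr0 normr0 mul0r.
exists (K * (`|a| + 1) + `|p.[a]|) => [|e s e1 se].
  by rewrite addr_ge0 ?mulr_ge0 ?addr_ge0.
rewrite !hornerMXaddC.
have -> : p.[a + s] * (a + s) + c - (p.[a] * a + c)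
   = (p.[a + s] - p.[a]) * (a + s) + p.[a] * s by ring.
rewrite (le_trans (ler_normD _ _)) // [leRHS]mulrDl lerD // normrM; last first.
  by rewrite ler_wpM2l.
rewrite mulrAC ler_pM // ?IH // (le_trans (ler_normD _ _)) // lerD2l.
exact: le_trans se e1.
Qed.

Lemma horner2_lipschitz P (a b : C) :
  exists2 K, 0 <= K & forall e s t, e <= 1 -> `|s| <= e -> `|t| <= e ->
    `|P.[a + s, b + t] - P.[a, b]| <= K * e.
Proof.
elim/poly_ind: P => [|P c [K K0 IH]].
  by exists 0 => // e s t _ _ _; rewrite !horner0 subr0 normr0 mul0r.
have [K' K'0 IH'] := horner_lipschitz c b.
exists (K * (`|a| + 1) + `|P.[a, b]| + K') => [|e s t e1 se te].
  by rewrite !addr_ge0 ?mulr_ge0 ?addr_ge0.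
rewrite !hornerMXaddC !(hornerD, hornerM, hornerC).
have -> : P.[a + s, b + t] * (a + s) + c.[b + t] - (P.[a, b] * a + c.[b])
   = (P.[a + s, b + t] - P.[a, b]) * (a + s) + P.[a, b] * s + (c.[b + t] - c.[b]).
  by ring.
rewrite [leRHS]mulrDl (le_trans (ler_normD _ _)) // lerD ?IH' //.
rewrite (le_trans (ler_normD _ _)) // [leRHS]mulrDl lerD // normrM; last first.
  by rewrite ler_wpM2l.
rewrite mulrAC ler_pM // ?IH // (le_trans (ler_normD _ _)) // lerD2l.
exact: le_trans se e1.
Qed.

Lemma exists_small_nonroot h (a e : C) : h != 0 -> 0 < e ->
  exists2 t, h.[a + t] != 0 & `|t| <= e.
Proof.
move=> h0 e0; pose s := [seq a + e / i.+1%:R | i <- iota 0 (size h)].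
have us : uniq s.
  rewrite map_inj_uniq ?iota_uniq // => i j /addrI.
  by move/(mulfI (lt0r_neq0 e0))/invr_inj/eqP; rewrite eqr_nat eqSS => /eqP.
have [ars|] := boolP (all (root h) s).
  by have := max_poly_roots h0 ars us; rewrite size_map size_iota ltnn.
case/allPn => _ /mapP[i _ ->] hi; exists (e / i.+1%:R) => //.
rewrite normrM normfV normr_nat gtr0_norm // ler_pdivrMr ?ltr0Sn //.
by rewrite ler_pMr // ler1n.
Qed.

(** The usual limit argument, made with one explicit e and without an archimedean axiom. *)
Lemma eq0_of_le_linear (x K : C) :
  0 <= x -> 0 <= K -> (forall e, 0 < e -> e <= 1 -> x <= K * e) -> x = 0.
Proof.
move=> x0 K0 xK; apply/eqP; apply: contraT => x_neq0.
have xp : 0 < x by rewrite lt0r x_neq0.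
have d0 : 0 < (K + 1 + x) by rewrite ltr_wpDl // addr_ge0.
have := xK (x / (K + 1 + x)).
rewrite divr_gt0 // ler_pdivrMr // mul1r lerDr addr_ge0 // => /(_ isT isT).
rewrite mulrA ler_pdivlMr // mulrC ler_pM2r //.
by rewrite -addrA gerDl => /(lt_le_trans (ltr_wpDl ler01 xp)); rewrite ltxx.
Qed.

(** After moving a to 0, the constant coefficient vanishes at b while some coefficient does not.
    Near b the former stays small and the latter stays large, which is the situation of
    [exists_small_root]. *)
Lemma root_near f (a b r : C) :
    map_poly (horner_eval b) f != 0 -> f.[a, b] = 0 -> 0 < r ->
  exists2 d, 0 < d & forall t, `|t| <= d ->
    exists2 s, f.[a + s, b + t] = 0 & `|s| < r.
Proof.
move=> fb0 fab r0; pose g := f \Po ('X + a%:P%:P).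
have gE s t : g.[s, b + t] = f.[a + s, b + t].
  by rewrite /g horner_comp !hornerE -polyCD addrC.
have gE' s t : g.[s, t] = (map_poly (horner_eval t) g).[s].
  by rewrite -{2}(hornerC s t) horner_map.
have c0 : (map_poly (horner_eval b) g)`_0 = 0.
  by rewrite -horner_coef0 -gE' -[b]addr0 gE !addr0.
have [k ck] : exists k, (g`_k).[b] != 0.
  apply/not_existsP => ck; case/eqP: fb0.
  have gb0 : map_poly (horner_eval b) g = 0.
    by apply/polyP => k; rewrite coef_map coef0; apply/eqP/negPn/negP/ck.
  have -> : f = g \Po ('X - a%:P%:P).
    by rewrite -comp_polyA comp_polyD comp_polyX comp_polyC subrK comp_polyXr.
  by rewrite map_comp_poly gb0 comp_poly0.
have [K K0 lipK] := horner_lipschitz g`_k b.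
have [K' K'0 lipK'] := horner_lipschitz g`_0 b.
set u := `|(g`_k).[b]|; have u0 : 0 < u by rewrite normr_gt0.
pose S : C := 2 ^+ size g; have S0 : 0 < S by rewrite exprn_gt0 ?ltr0n.
have rk0 : 0 < r ^+ k by rewrite exprn_gt0.
pose Z := S * K' + K * r ^+ k; pose w := u * r ^+ k.
have Z0 : 0 <= Z by rewrite addr_ge0 ?mulr_ge0 // ltW.
have w0 : 0 < w by rewrite mulr_gt0.
have den0 : 0 < w + Z + 1 by rewrite ltr_wpDl // addr_ge0 // ltW.
(* The radius d must satisfy d <= 1 and S K' d < (u - K d) r^k; the latter says d Z < w. *)
exists (w / (w + Z + 1)) => [|t]; first by rewrite divr_gt0.
set d := w / _ => td.
have d1 : d <= 1 by rewrite ler_pdivrMr // mul1r -addrA lerDl addr_ge0.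
have dZ : d * Z < w.
  rewrite mulrAC ltr_pdivrMr // ltr_pM2l // addrAC ltrDr ltr_wpDl // ltW //.
set h := map_poly (horner_eval (b + t)) g.
have szh : (size h <= size g)%N by rewrite size_poly.
have [//|s hs sr] := @exists_small_root h r k r0 _; last first.
  by exists s => //; rewrite -gE gE'; apply/eqP.
have g0 : `|h`_0| <= K' * d.
  have := lipK' d t d1 td; rewrite coef_map /horner_eval /=.
  by move: c0; rewrite coef_map /= horner_evalE => ->; rewrite subr0.
have gk : u - K * d <= `|h`_k|.
  rewrite lerBlDr -lerBlDl coef_map /horner_eval /=.
  apply: le_trans (lipK d t d1 td); rewrite distrC.
  exact: lerB_dist.
apply: (@le_lt_trans _ _ (S * (K' * d))).
  rewrite ler_pM ?exprn_ge0 ?ler0n // ler_weXn2l // ler1n //.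
apply: (@lt_le_trans _ _ ((u - K * d) * r ^+ k)); last by rewrite ler_pM2r.
have -> : (u - K * d) * r ^+ k = w - d * Z + S * (K' * d).
  by rewrite /w /Z; ring.
by rewrite ltrDr subr_gt0.
Qed.

(** Moving b slightly off the roots of h moves a slightly along the curve, to a point where P
    vanishes; the Lipschitz bound makes |P(a, b)| arbitrarily small. *)
Lemma curve_closure f P h (a b : C) :
    map_poly (horner_eval b) f != 0 -> h != 0 -> f.[a, b] = 0 ->
    (forall x y, f.[x, y] = 0 -> h.[y] != 0 -> P.[x, y] = 0) ->
  P.[a, b] = 0.
Proof.
move=> fb0 h0 fab Pf; have [K K0 lipP] := horner2_lipschitz P a b.
apply/eqP; rewrite -normr_eq0; apply/eqP/(@eq0_of_le_linear _ K) => // e e0 e1.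
have [d d0 rootf] := root_near fb0 fab e0.
(* A positive number that is at most d and at most e. *)
have [|t ht tde] := exists_small_nonroot b h0 (_ : 0 < d * e / (d + e)).
  by rewrite divr_gt0 ?mulr_gt0 ?addr_gt0.
have de0 : 0 < d + e by rewrite addr_gt0.
have td : `|t| <= d.
  by rewrite (le_trans tde) // ler_pdivrMr // ler_pM2l // lerDr ltW.
have te : `|t| <= e.
  by rewrite (le_trans tde) // ler_pdivrMr // mulrC ler_pM2l // lerDl ltW.
have [s fst sr] := rootf t td.
by have := lipP e s t e1 (ltW sr) te; rewrite (Pf _ _ fst ht) sub0r normrN.
Qed.

End RootContinuity.

(** * The Hoste-Shanahan recursion and the fibres of phi *)

Section Lucas.

Variable R : comPzRingType.
Implicit Types (x y a b c s : R).

Fixpoint lucas x y a b n : R :=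
  if n is n'.+1 then lucas x y b (x * b - y * a) n' else a.

Lemma lucasSS x y a b n :
  lucas x y a b n.+2 = x * lucas x y a b n.+1 - y * lucas x y a b n.
Proof. by elim: n a b => [|n IH] a b //; exact: IH. Qed.

Lemma lucas_unique x y (f : nat -> R) n :
    (forall k, f k.+2 = x * f k.+1 - y * f k) ->
  f n = lucas x y (f 0) (f 1) n.
Proof.
move=> fP; suff [] : f n = lucas x y (f 0) (f 1) n /\
  f n.+1 = lucas x y (f 0) (f 1) n.+1 by [].
elim: n => [//|n [IH0 IH1]]; split=> //.
by rewrite fP lucasSS -IH0 -IH1.
Qed.

Lemma lucas_scale s x y a b n :
  lucas (s * x) (s ^+ 2 * y) a (s * b) n = s ^+ n * lucas x y a b n.
Proof.
apply/esym; rewrite [LHS](lucas_unique (x := s * x) (y := s ^+ 2 * y)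
  (f := fun k => s ^+ k * lucas x y a b k)) ?expr0 ?mul1r ?expr1 // => k.
rewrite lucasSS !exprS expr0; move: (lucas _ _ _ _ k.+1) (lucas _ _ _ _ k) => u v.
by move: (s ^+ k) => w; ring.
Qed.

Lemma mulr_lucas c x y a b n :
  c * lucas x y a b n = lucas x y (c * a) (c * b) n.
Proof.
rewrite [LHS](lucas_unique (x := x) (y := y)
  (f := fun k => c * lucas x y a b k)) //.
by move=> k; rewrite lucasSS; ring.
Qed.

Lemma lucas_geometric x y a b n :
  b ^+ 2 = x * b - y -> lucas x y a (a * b) n = a * b ^+ n.
Proof.
move=> bE; apply/esym.
rewrite [LHS](lucas_unique (x := x) (y := y) (f := fun k => a * b ^+ k));
  first by rewrite expr0 expr1 mulr1.
by move=> k; rewrite -addn2 exprD bE exprS; ring.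
Qed.

(** The two-sided solution of u_(p+1) = x u_p - u_(p-1) with u_0 = 1 and u_1 = g; hence u_(-1) = x -
    g. *)
Definition gam x g (p : int) : R :=
  match p with Posz n => lucas x 1 1 g n | Negz n => lucas x 1 1 (x - g) n.+1 end.

Lemma gamN x g n : gam x g (- Posz n) = lucas x 1 1 (x - g) n.
Proof. by case: n. Qed.

Lemma gam_rec x g p : gam x g (p + 1) = x * gam x g p - gam x g (p - 1).
Proof.
case: p => [[|n]|n].
- by rewrite add0r sub0r !(gamN _ _ 1) /=; ring.
- have -> : Posz n.+1 + 1 = Posz n.+2 by lia.
  have -> : Posz n.+1 - 1 = Posz n by lia.
  by rewrite /gam lucasSS mul1r.
- have -> : Negz n - 1 = - Posz n.+2 by lia.
  have -> : Negz n + 1 = - Posz n by lia.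
  by rewrite NegzE !gamN lucasSS; ring.
Qed.

Lemma gam_unique x (f : int -> R) p :
    (forall k, f (k + 1) = x * f k - f (k - 1)) -> f 0 = 1 ->
  f p = gam x (f 1) p.
Proof.
move=> fP f0; case: p => n.
  rewrite [LHS](lucas_unique (x := x) (y := 1) (f := f \o Posz)) /= ?f0 // => k.
  have := fP (Posz k.+1); have -> : Posz k.+1 + 1 = Posz k.+2 by lia.
  have -> : Posz k.+1 - 1 = Posz k by lia.
  by rewrite mul1r.
rewrite NegzE gamN; have -> : x - f 1 = f (- Posz 1).
  have /= := fP 0; rewrite add0r sub0r => ->.
  by rewrite f0 mulr1 opprB addrC subrK.
rewrite [LHS](lucas_unique (x := x) (y := 1) (f := fun k => f (- Posz k))) ?oppr0 ?f0 // => k.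
have := fP (- Posz k.+1).
have -> : - Posz k.+1 + 1 = - Posz k by lia.
have -> : - Posz k.+1 - 1 = - Posz k.+2 by lia.
by move=> ->; ring.
Qed.

End Lucas.

Section HalfApoly.

Variable R : comPzRingType.
Implicit Types (L M : R).

(* [HSx], the square root of [HSy], [A_1] and [A_m1] with [M] in place of     *)
(* [M ^+ 2]. *)
Definition half_x L M : R :=
  - L + L ^+ 2 + 2 * L * M + M ^+ 2 + 2 * L * M ^+ 2 + L ^+ 2 * M ^+ 2
  + 2 * L * M ^+ 3 + M ^+ 4 - L * M ^+ 4.
Definition half_sqrty L M : R := M * (L + M) ^+ 2.
Definition half_A1 L M : R := L + M ^+ 3.
Definition half_Am1 L M : R :=
  - L + L * M + M ^+ 2 + 2 * L * M ^+ 2 + L ^+ 2 * M ^+ 2 + L * M ^+ 3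
  - L * M ^+ 4.

(** This is A_p(L, M^(1/2)). The positive branch starts at p = 1 because A_0 = 1 does not fit the
    recursion there; the second initial value is A_2. *)
Definition half_A (p : int) L M : R :=
  match p with
  | Posz 0 => 1
  | Posz n.+1 => lucas (half_x L M) (half_sqrty L M ^+ 2) (half_A1 L M)
                   (half_x L M * half_A1 L M - M ^+ 2 * (L + M) ^+ 3) n
  | Negz n => lucas (half_x L M) (half_sqrty L M ^+ 2) 1 (half_Am1 L M) n.+1
  end.

(** The positive branch extends down to p = 0 with the value 1 / (L + M); the factor L + M clears
    this denominator. *)
Lemma half_A_pos n L M : (L + M) * half_A (Posz n.+1) L M =
  lucas (half_x L M) (half_sqrty L M ^+ 2) 1 ((L + M) * half_A1 L M) n.+1.
Proof.
rewrite /half_A mulr_lucas /=; congr (lucas _ _ _ _ _).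
by rewrite /half_sqrty; ring.
Qed.

(** At L = 0 the initial ratio is a root of the characteristic equation, so the sequence is
    geometric. For M != 0 it follows that the A-curve contains no line with M constant. *)
Lemma half_A_L0 p M : exists n, half_A p 0 M = M ^+ n.
Proof.
case: p => [[|n]|n]; first by exists 0; rewrite expr0.
  exists (3 + 4 * n)%N.
  rewrite exprD exprM -(lucas_geometric (x := half_x 0 M) (y := half_sqrty 0 M ^+ 2)).
    by rewrite /half_A; congr (lucas _ _ _ _ _); rewrite /half_x /half_A1; ring.
  by rewrite /half_x /half_sqrty; ring.
exists (2 * n.+1)%N; rewrite exprM -[RHS]mul1r.
rewrite -(lucas_geometric (x := half_x 0 M) (y := half_sqrty 0 M ^+ 2)).
  by rewrite /half_A; congr (lucas _ _ _ _ _); rewrite /half_Am1; ring.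
by rewrite /half_x /half_sqrty; ring.
Qed.

Lemma lucas0 (x a b : R) n : lucas x 0 a b n.+1 = x ^+ n * b.
Proof.
elim: n a b => [|n IH] a b; first by rewrite expr0 mul1r.
by rewrite [LHS]IH mul0r subr0 exprSr mulrA.
Qed.


End HalfApoly.

Section Morphisms.
Variables (R S : comPzRingType) (f : {rmorphism R -> S}).

Lemma rmorph_lucas x y a b n :
  f (lucas x y a b n) = lucas (f x) (f y) (f a) (f b) n.
Proof. by elim: n a b => [//|n IH] a b /=; rewrite IH rmorphB !rmorphM. Qed.

Lemma rmorph_gam x g p : f (gam x g p) = gam (f x) (f g) p.
Proof. by case: p => n; rewrite /gam rmorph_lucas ?rmorphB rmorph1. Qed.

Lemma rmorph_half_A p L M : f (half_A p L M) = half_A p (f L) (f M).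
Proof.
have fx : f (half_x L M) = half_x (f L) (f M) by rewrite /half_x; ring.
have fs : f (half_sqrty L M ^+ 2) = half_sqrty (f L) (f M) ^+ 2 by rewrite /half_sqrty; ring.
have f1 : f (half_A1 L M) = half_A1 (f L) (f M) by rewrite /half_A1; ring.
have fm1 : f (half_Am1 L M) = half_Am1 (f L) (f M) by rewrite /half_Am1; ring.
case: p => [[|n]|n]; rewrite /half_A; first by rewrite rmorph1.
  have f2 : f (half_x L M * half_A1 L M - M ^+ 2 * (L + M) ^+ 3) =
      f (half_x L M) * f (half_A1 L M) - f M ^+ 2 * (f L + f M) ^+ 3 by ring.
  by rewrite rmorph_lucas f2 fx fs f1.
by rewrite rmorph_lucas fx fs fm1 rmorph1.
Qed.

End Morphisms.

Section Evaluation.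
Variables (F : fieldType).

Lemma eval2_Apoly p (L m : F) : eval2 (Apoly p) (L, m) = half_A p L (m ^+ 2).
Proof.
rewrite /eval2 /=.
pose ev := fun P : {poly {poly int}} => (map_poly (map_poly intr) P).[L, m] : F.
have evD P Q : ev (P + Q) = ev P + ev Q by rewrite /ev rmorphD !hornerD.
have evN P : ev (- P) = - ev P by rewrite /ev rmorphN !hornerN.
have evM P Q : ev (P * Q) = ev P * ev Q by rewrite /ev rmorphM !hornerM.
have ev1 : ev 1 = 1 by rewrite /ev rmorph1 !hornerC.
have evX P n : ev (P ^+ n) = ev P ^+ n.
  by elim: n => [|n IH]; rewrite ?expr0 // !exprS evM IH.
have evL : ev 'X = L by rewrite /ev map_polyX hornerX hornerC.
have evm : ev 'X%:P = m by rewrite /ev map_polyC /= map_polyX hornerC hornerX.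
have evx : ev HSx = half_x L (m ^+ 2).
  by rewrite /HSx /half_x !(evD, evN, evM, evX, evL, evm, ev1); ring.
have evy : ev HSy = half_sqrty L (m ^+ 2) ^+ 2.
  by rewrite /HSy /half_sqrty !(evD, evN, evM, evX, evL, evm, ev1); ring.
have evA1 : ev A_1 = half_A1 L (m ^+ 2).
  by rewrite /A_1 /half_A1 !(evD, evN, evM, evX, evL, evm, ev1); ring.
have evAm1 : ev A_m1 = half_Am1 L (m ^+ 2).
  by rewrite /A_m1 /half_Am1 !(evD, evN, evM, evX, evL, evm, ev1); ring.
have evA2 : ev A_2 = half_A (Posz 2) L (m ^+ 2).
  by rewrite /A_2 /= /half_A1 /half_x !(evD, evN, evM, evX, evL, evm, ev1); ring.
case: p => [[//|n]|n]; rewrite /half_A -evx -evy -/(ev _).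
  rewrite [LHS](lucas_unique (x := ev HSx) (y := ev HSy) (f := fun k => ev (Apoly k.+1))) /=.
    by rewrite evA1 evA2 /= evx.
  by move=> k; rewrite -!evM -evN -evD.
rewrite [LHS](lucas_unique (x := ev HSx) (y := ev HSy) (f := fun k => ev (Apoly_neg k))) /=.
  by rewrite ev1 evAm1.
by move=> k; rewrite -!evM -evN -evD.
Qed.

End Evaluation.

(** * Pullback along phi, and the A-curve outside its domain *)

Section Phi.
Variable F : fieldType.
Implicit Types (E Q L M : F).

Definition chebX E Q : F := Q + Q^-1 + (1 - Q) * E.

(* Q^(-p) C_p^op(E, Q): a sequence of Chebyshev type in p *)
Definition Gam (p : int) E Q : F := gam (chebX E Q) (E + Q^-1) p.

(** Under phi one has x = s [chebX] with s^2 = y, so the two sequences differ by powers of s, which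
    is nonzero on the domain of phi, and by L + M when p > 0. *)
Lemma half_A_phi p L M : phi_dom F (L, M) ->
  (half_A p L M == 0) = (Gam p (phi (L, M)).1 (phi (L, M)).2 == 0).
Proof.
rewrite /phi_dom /= !mulf_eq0 !negb_or -andbA => /and3P[M0 LM0 LM1].
set E := L * _ / _; set Q := _ / _.
have s0 : half_sqrty L M != 0 by rewrite mulf_neq0 // expf_neq0.
have xE : half_x L M = half_sqrty L M * chebX E Q.
  by rewrite /half_x /half_sqrty /chebX /E /Q; field; rewrite M0 LM0 LM1.
have yE : half_sqrty L M ^+ 2 = half_sqrty L M ^+ 2 * 1 by rewrite mulr1.
case: p => [[|n]|n]; first by rewrite /Gam /= oner_eq0.
  transitivity ((L + M) * half_A (Posz n.+1) L M == 0).
    by rewrite mulf_eq0 (negPf LM0).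
  rewrite half_A_pos; have -> : (L + M) * half_A1 L M = half_sqrty L M * (E + Q^-1).
    by rewrite /half_A1 /half_sqrty /E /Q; field; rewrite M0 LM0 LM1.
  by rewrite xE yE lucas_scale mulf_eq0 expf_eq0 (negPf s0) andbF.
rewrite /half_A; have -> : half_Am1 L M = half_sqrty L M * (chebX E Q - (E + Q^-1)).
  by rewrite /half_Am1 /half_sqrty /E /Q /chebX; field; rewrite M0 LM0 LM1.
by rewrite xE yE lucas_scale mulf_eq0 expf_eq0 (negPf s0) andbF.
Qed.

(** Both b and b^-1 are roots of the characteristic equation, so the value at p is b^p. *)
Lemma gam_geometric_neq0 p (b : F) : b != 0 -> gam (b + b^-1) b p != 0.
Proof.
move=> b0; have geo c n : c != 0 -> c + c^-1 = b + b^-1 -> lucas (b + b^-1) 1 1 c n != 0.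
  move=> c0 cb; rewrite -[c]mul1r lucas_geometric ?mul1r ?expf_neq0 //.
  by rewrite -cb mulrDl mulVf // addrK expr2.
case: p => n; rewrite /gam; first exact: geo.
have -> : b + b^-1 - b = b^-1 by rewrite addrAC subrr add0r.
by apply: geo; rewrite ?invr_eq0 // invrK addrC.
Qed.

Lemma Gam_E0 p (Q : F) : Q != 0 -> Gam p 0 Q != 0.
Proof.
move=> Q0; rewrite /Gam /chebX mulr0 addr0 add0r addrC -{2}[Q]invrK.
by rewrite gam_geometric_neq0 // invr_eq0.
Qed.

(* On L M = -1 the quotient x / sqrt y of the Hoste-Shanahan recursion is     *)
(* (M^2 + M + 1) / M. *)
Definition pole_poly (p : int) : {poly F} :=
  if p is Posz n then lucas ('X^2 + 'X + 1) 'X^2 1 ('X^2 + 1) n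
  else lucas ('X^2 + 'X + 1) 'X^2 1 'X `|p|.

Lemma half_A_pole p L M : L * M = - 1 -> M ^+ 2 != 1 ->
  half_A p L M = 0 -> (pole_poly p).[M] = 0.
Proof.
move=> LM M21.
have M0 : M != 0 by apply: contra_eq_neq LM => ->; rewrite mulr0 eq_sym oppr_eq0 oner_neq0.
have -> : L = - M^-1 by apply: (mulIf M0); rewrite LM mulNr mulVf.
have M1 : M ^+ 2 - 1 != 0 by rewrite subr_eq0.
set s := (M ^+ 2 - 1) ^+ 2 / M ^+ 2.
have s0 : s != 0 by rewrite mulf_neq0 ?invr_eq0 ?expf_neq0.
have xE : half_x (- M^-1) M = s * (M ^+ 2 + M + 1).
  by rewrite /half_x /s; field; rewrite M0.
have yE : half_sqrty (- M^-1) M ^+ 2 = s ^+ 2 * M ^+ 2.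
  by rewrite /half_sqrty /s; field; rewrite M0.
have LM0 : - M^-1 + M != 0.
  by rewrite -[_ + _](mulfK M0) mulf_neq0 ?invr_eq0 // mulrDl mulNr mulVf // addrC.
have ev x y a b n : (lucas x y a b n).[M] = lucas x.[M] y.[M] a.[M] b.[M] n.
  exact: (rmorph_lucas (horner_eval M)).
case: p => [[|n]|n].
- by rewrite /= => /eqP; rewrite oner_eq0.
- move=> a0; apply/eqP; have : (- M^-1 + M) * half_A (Posz n.+1) (- M^-1) M == 0.
    by rewrite a0 mulr0.
  rewrite half_A_pos; have -> : (- M^-1 + M) * half_A1 (- M^-1) M = s * (M ^+ 2 + 1).
    by rewrite /half_A1 /s; field; rewrite M0.
  rewrite xE yE lucas_scale mulf_eq0 expf_eq0 (negPf s0) andbF /pole_poly ev.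
  by rewrite !(hornerD, hornerXn, hornerX, hornerC).
- move/eqP; rewrite /half_A; have -> : half_Am1 (- M^-1) M = s * M.
    by rewrite /half_Am1 /s; field; rewrite M0.
  rewrite xE yE lucas_scale mulf_eq0 expf_eq0 (negPf s0) andbF /pole_poly ev.
  by rewrite !(hornerD, hornerXn, hornerX, hornerC) => /eqP.
Qed.

(** On L = -M the coefficient y vanishes, which leaves a power of x times an initial value. *)
Lemma half_A_antidiag p M : M != 0 -> M ^+ 2 != 1 -> half_A p (- M) M != 0.
Proof.
move=> M0 M21; have M1 : M ^+ 2 - 1 != 0 by rewrite subr_eq0.
have x1 : half_x (- M) M = M * (M ^+ 2 - 1) ^+ 2 by rewrite /half_x; ring.
have s0 : half_sqrty (- M) M ^+ 2 = 0 by rewrite /half_sqrty; ring.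
have x0 : half_x (- M) M != 0 by rewrite x1 mulf_neq0 ?expf_neq0.
have a1 : half_A1 (- M) M = M * (M ^+ 2 - 1) by rewrite /half_A1; ring.
have am1 : half_Am1 (- M) M = M * (M ^+ 2 - 1) ^+ 2 by rewrite /half_Am1; ring.
case: p => [[|[|n]]|n]; rewrite /half_A; first exact: oner_neq0.
- by rewrite /= a1 mulf_neq0.
- rewrite s0 lucas0 addNr expr0n mulr0 subr0 a1.
  by rewrite mulf_neq0 ?expf_neq0 ?mulf_neq0.
- by rewrite s0 lucas0 am1 mulf_neq0 ?expf_neq0 ?mulf_neq0.
Qed.

End Phi.

(** * Fibres of phi over an algebraically closed field *)

Section ComplexFibres.
Variable C : numClosedFieldType.
Implicit Types (E Q L M : C).

Lemma pole_poly_neq0 p : pole_poly C p != 0.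
Proof.
(* A primitive sixth root of unity: since w^2 + 1 = w, both branches become the geometric sequence
   w^n. *)
pose w : C := (1 + sqrtC (- 3)) / 2.
have w2 : w ^+ 2 = w - 1.
  rewrite /w expr_div_n sqrrD sqrtCK expr1n mul1r.
  by field.
have w0 : w != 0.
  by apply: contra_eq_neq w2 => ->; rewrite expr0n sub0r eq_sym oppr_eq0 oner_neq0.
have ev x y a b n : (lucas x y a b n).[w] = lucas x.[w] y.[w] a.[w] b.[w] n.
  exact: (rmorph_lucas (horner_eval w)).
have lw n : lucas (w ^+ 2 + w + 1) (w ^+ 2) 1 w n = w ^+ n.
  rewrite -[RHS]mul1r -(lucas_geometric (x := w ^+ 2 + w + 1) (y := w ^+ 2)) ?mul1r //.
  have -> : w ^+ 2 + w + 1 = 2 * w by rewrite w2; ring.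
  by ring.
apply: contraTneq (expf_neq0 `|p| w0) => P0; rewrite negbK.
have := congr1 (horner^~ w) P0; rewrite horner0 => <-.
case: p {P0} => n; rewrite /pole_poly ev !(hornerD, hornerXn, hornerX, hornerC) ?lw //.
by have -> : w ^+ 2 + 1 = w; [rewrite w2 subrK|rewrite lw].
Qed.

(** Complements [half_A_L0] on the line M = 0, where y vanishes again. *)
Lemma half_A_M0 p : half_A p (- 1) (0 : C) != 0.
Proof.
have x1 : half_x (- 1) 0 = 2 :> C by rewrite /half_x; ring.
have s0 : half_sqrty (- 1) 0 ^+ 2 = 0 :> C by rewrite /half_sqrty; ring.
have a1 : half_A1 (- 1) 0 = - 1 :> C by rewrite /half_A1; ring.
have am1 : half_Am1 (- 1) 0 = 1 :> C by rewrite /half_Am1; ring.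
have n1 : - 1 != 0 :> C by rewrite oppr_eq0 oner_neq0.
case: p => [[|[|n]]|n]; rewrite /half_A; first exact: oner_neq0.
- by rewrite /= a1.
- rewrite s0 lucas0 expr0n mul0r subr0 x1 a1.
  by rewrite !mulf_neq0 ?expf_neq0 ?pnatr_eq0.
- by rewrite s0 lucas0 am1 x1 mulr1 expf_neq0 ?pnatr_eq0.
Qed.

(** The formula for Q is a Moebius transformation in L and is solved for L; substitution in the
    formula for E leaves a quadratic equation for M. The condition E != 0 excludes M^2 = 1, and then
    M = Q would give Q M = 1, hence M^2 = 1. *)
Lemma phi_eqP E Q L M : E != 0 -> Q != 0 ->
  (phi_dom C (L, M) /\ phi (L, M) = (E, Q)) <->
  [/\ M != 0, M ^+ 2 != 1, M - Q != 0, L = (Q * M - 1) / (M - Q)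
    & M + M^-1 = E + Q + Q^-1].
Proof.
move=> E0 Q0; split=> [[]|[M0 M1 MQ -> ME]].
  rewrite /phi_dom /= !mulf_eq0 !negb_or -andbA => /and3P[M0 LM0 LM1] [EE QE].
  have M1 : M ^+ 2 != 1.
    by apply: contra_neq E0 => M1; rewrite -EE M1 subrr expr0n mulr0 mul0r.
  have QLM : Q * (L + M) = 1 + L * M by rewrite -QE mulfVK.
  have LMQ : L * (M - Q) = Q * M - 1.
    by rewrite mulrBr -[L * M](addKr 1) -QLM; ring.
  have MQ : M - Q != 0.
    apply: contra_neq M1 => MQ; move: LMQ; rewrite MQ mulr0.
    move/esym/eqP; rewrite subr_eq0 => /eqP; move/eqP: MQ; rewrite subr_eq0 => /eqP <-.
    by rewrite expr2.
  have LE : L = (Q * M - 1) / (M - Q) by rewrite -LMQ mulfK.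
  split=> //; apply/eqP; rewrite -subr_eq0 -EE -QE LE.
  have M1' : M ^+ 2 - 1 != 0 by rewrite subr_eq0.
  have e1 : (Q * M - 1) / (M - Q) + M = (M ^+ 2 - 1) / (M - Q) by field.
  have e2 : 1 + (Q * M - 1) / (M - Q) * M = Q * (M ^+ 2 - 1) / (M - Q) by field.
  rewrite e1 e2; apply/eqP; field.
  by rewrite M0 MQ Q0 M1'.
have M1' : M ^+ 2 - 1 != 0 by rewrite subr_eq0.
have e1 : (Q * M - 1) / (M - Q) + M = (M ^+ 2 - 1) / (M - Q) by field.
have e2 : 1 + (Q * M - 1) / (M - Q) * M = Q * (M ^+ 2 - 1) / (M - Q) by field.
have EE : E = M + M^-1 - Q - Q^-1 by rewrite ME; ring.
split; first by rewrite /phi_dom /= e1 e2 !mulf_neq0 ?invr_eq0.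
rewrite /phi e1 e2 EE; congr pair; field; rewrite ?M0 ?MQ ?Q0 ?M1' //.
Qed.

Lemma phi_fibre E Q : E != 0 -> Q != 0 -> (E + Q + Q^-1) ^+ 2 != 4 ->
  exists z z' : C * C, [/\ z != z', phi_dom C z /\ phi z = (E, Q),
    phi_dom C z' /\ phi z' = (E, Q)
  & forall u, phi_dom C u -> phi u = (E, Q) -> u = z \/ u = z'].
Proof.
move=> E0 Q0; set T := E + Q + Q^-1 => T4.
pose d := sqrtC (T ^+ 2 - 4); have d2 : d ^+ 2 = T ^+ 2 - 4 by rewrite sqrtCK.
have d0 : d != 0.
  by apply: contra_neq T4 => d0; apply/eqP; rewrite -subr_eq0 -d2 d0 expr0n.
pose M := (T + d) / 2; pose M' := (T - d) / 2.
have two0 : 2 != 0 :> C by rewrite pnatr_eq0.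
have MM : M * M' = 1.
  have -> : M * M' = (T ^+ 2 - d ^+ 2) / 4 by rewrite /M /M'; field.
  by rewrite d2 opprB addrC subrK divff // pnatr_eq0.
have MD : M + M' = T by rewrite /M /M'; field.
have MB : M - M' = d by rewrite /M /M'; field.
have good m m' : m * m' = 1 -> m + m' = T -> m - m' != 0 ->
    [/\ m != 0, m ^+ 2 != 1, m - Q != 0 & m + m^-1 = E + Q + Q^-1].
  move=> mm md mb.
  have m0 : m != 0 by apply: contra_eq_neq mm => ->; rewrite mul0r eq_sym oner_neq0.
  have m'E : m' = m^-1 by apply: (mulfI m0); rewrite mm divff.
  rewrite -m'E; split=> //.
    apply: contra_neq mb => m2; apply/eqP; rewrite subr_eq0; apply/eqP.
    by apply: (mulfI m0); rewrite mm -m2.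
  apply: contra_neq E0 => /eqP; rewrite subr_eq0 => /eqP mQ.
  have : E + Q + Q^-1 = Q + Q^-1 by rewrite -[LHS]/T -md m'E mQ.
  by rewrite -addrA -[RHS]add0r => /addIr.
have MMd : M - M' != 0 by rewrite MB.
have [M0 M1 MQ ME] := good M M' MM MD MMd.
have [M0' M1' MQ' ME'] : [/\ M' != 0, M' ^+ 2 != 1, M' - Q != 0 & M' + M'^-1 = E + Q + Q^-1].
  by apply: (good M' M); rewrite ?[M' * M]mulrC ?[M' + M]addrC // -opprB MB oppr_eq0.
exists ((Q * M - 1) / (M - Q), M), ((Q * M' - 1) / (M' - Q), M'); split.
- by apply: contra_neq d0 => -[_ MM']; rewrite -MB MM' subrr.
- exact/phi_eqP.
- exact/phi_eqP.
case=> [L m] D pE; have [] // := (phi_eqP L m E0 Q0).1 => m0 _ _ -> mE.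
have : (m - M) * (m - M') == 0.
  have -> : (m - M) * (m - M') = m ^+ 2 - (M + M') * m + M * M' by ring.
  by rewrite MD MM -[T]mE mulrDl mulVf // expr2; apply/eqP; ring.
by rewrite mulf_eq0 !subr_eq0 => /orP[]/eqP ->; [left|right].
Qed.

End ComplexFibres.

(** * Zariski density and the degree of phi *)

Section Geometry.
Local Open Scope classical_set_scope.
Variables (C : numClosedFieldType) (p : int).
Implicit Types (z w : C * C).

Lemma A_curveE z : A_curve C p z <-> half_A p z.1 z.2 = 0.
Proof. by rewrite /A_curve /= eval2_Apoly sqrtCK. Qed.

Lemma horner_map_eval (f : {poly {poly C}}) x y :
  (map_poly (horner_eval y) f).[x] = f.[x, y].
Proof. by rewrite -{1}(hornerC x y) horner_map. Qed.

Lemma curve_subset_closed (f : {poly {poly C}}) (h : {poly C}) (A Z : set (C * C)) w :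
    map_poly (horner_eval w.2) f != 0 -> h != 0 -> f.[w.1, w.2] = 0 ->
    (forall x y, f.[x, y] = 0 -> h.[y] != 0 -> A (x, y)) ->
    zariski_closed Z -> A `<=` Z -> Z w.
Proof.
move=> fw h0 fw0 fA [I ->] AZ P IP.
apply: (curve_closure fw h0 fw0) => x y fxy hy.
exact: (AZ (x, y) (fA _ _ fxy hy)).
Qed.

Lemma A_curve_dense : zariski_dense (A_curve C p `&` phi_dom C) (A_curve C p).
Proof.
split=> [z []//|Z clZ VZ w /A_curveE w0].
pose f : {poly {poly C}} := half_A p 'X 'X%:P.
have fE x y : f.[x, y] = half_A p x y.
  have -> : f.[x%:P] = half_A p x%:P 'X.
    by rewrite -[LHS]/(horner_eval _ _) rmorph_half_A /= /horner_eval hornerX hornerC.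
  by rewrite -[LHS]/(horner_eval _ _) rmorph_half_A /= /horner_eval hornerX hornerC.
(* The values of M to avoid: outside them [half_A_antidiag] excludes L + M = 0 and [half_A_pole]
   excludes 1 + L M = 0. *)
pose h : {poly C} := 'X * ('X^2 - 1) * pole_poly C p.
have h0 : h != 0.
  by rewrite !mulf_neq0 ?pole_poly_neq0 ?polyX_eq0 // -size_poly_eq0 size_XnsubC.
apply: (curve_subset_closed (f := f) (h := h)) clZ VZ => //; last first.
- move=> x y; rewrite fE => xy0.
  rewrite /h !hornerM !mulf_eq0 !negb_or hornerX hornerD hornerN hornerXn hornerC.
  rewrite subr_eq0 => /andP[/andP[y0 y1] yp]; split; first exact/A_curveE.
  rewrite /phi_dom /= !mulf_neq0 //.
    apply: contraTneq (half_A_antidiag p y0 y1) => xy; rewrite negbK.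
    by have <- : x = - y; [apply/eqP; rewrite -addr_eq0 xy|rewrite xy0].
  apply: contraNneq yp => xy; apply/eqP/(@half_A_pole _ p x) => //.
  by apply/eqP; rewrite -addr_eq0 addrC xy.
- by rewrite fE.
- apply/eqP => f0; have {f0}fw a : half_A p a w.2 = 0.
    by rewrite -fE -horner_map_eval f0 horner0.
  have [w20|w20] := eqVneq w.2 0.
    by have := half_A_M0 C p; move: (fw (- 1)); rewrite w20 => ->; rewrite eqxx.
  have [n an] := half_A_L0 p w.2.
  by have := expf_neq0 n w20; rewrite -an fw eqxx.
Qed.

Lemma dense_map_of_Gam_curve (W : set (C * C)) :
    (forall z, z.2 != 0 -> W z <-> Gam p z.1 z.2 = 0) ->
    (forall w, W w -> exists f : {poly {poly C}},
      [/\ map_poly (horner_eval w.2) f != 0, f.[w.1, w.2] = 0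
        & forall x y, f.[x, y] = 0 -> y != 0 -> W (x, y)]) ->
  dense_map_of_degree 2 (@phi C) (phi_dom C) (A_curve C p) W.
Proof.
move=> WP Wf.
(* The zeros of [zp] are Q = 0 and the branch curves E + Q + Q^-1 = 2 and = -2, cleared of
   denominators. *)
pose zp : {poly {poly C}} := 'X%:P * ('X%:P * 'X + ('X^2 - 2 * 'X + 1)%:P)
                                   * ('X%:P * 'X + ('X^2 + 2 * 'X + 1)%:P).
have zpE x y : zp.[x, y] = y * (y * x + (y ^+ 2 - 2 * y + 1)) * (y * x + (y ^+ 2 + 2 * y + 1)).
  rewrite /zp !(hornerD, hornerM, hornerC, hornerX, hornerN, hornerXn).
  by ring.
pose Z := [set z : C * C | zp.[z.1, z.2] = 0]; pose U := W `\` Z.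
have clZ : zariski_closed Z.
  by exists [set zp]; apply/seteqP; split=> z; [move=> z0 _ ->|apply].
have phiQ0 z : phi_dom C z -> (phi z).2 != 0.
  case: z => L M; rewrite /phi_dom /= !mulf_eq0 !negb_or => /andP[/andP[_ LM0] LM1].
  by rewrite invr_eq0 LM0 LM1.
have phiW z : A_curve C p z -> phi_dom C z -> W (phi z).
  move=> /A_curveE Az Dz; apply/WP; first exact: phiQ0.
  by apply/eqP; rewrite -[phi z](_ : phi (z.1, z.2) = _) -?half_A_phi ?Az //; case: z {Az} Dz.
have Ufib w : U w -> exists z z' : C * C, [/\ z != z', phi_dom C z /\ phi z = w,
    phi_dom C z' /\ phi z' = w & forall u, phi_dom C u -> phi u = w -> u = z \/ u = z'].
  case: w => E Q [WEQ /eqP]; rewrite zpE /= !mulf_eq0 !negb_or => /andP[/andP[Q0 T1] T2].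
  apply: phi_fibre => //.
    apply/negP => /eqP E0; have := (WP (E, Q) Q0).1 WEQ.
    by rewrite /= E0; apply/eqP/Gam_E0.
  rewrite -subr_eq0; have -> : (E + Q + Q^-1) ^+ 2 - 4 =
    (Q * E + (Q ^+ 2 - 2 * Q + 1)) * (Q * E + (Q ^+ 2 + 2 * Q + 1)) / Q ^+ 2 by field.
  by rewrite !mulf_neq0 // invr_eq0 expf_neq0.
have phiA z : W (phi z) -> phi_dom C z -> A_curve C p z.
  move=> Wz Dz; apply/A_curveE/eqP; case: z Wz Dz => L M Wz Dz.
  by rewrite half_A_phi //; apply/eqP/(WP (phi (L, M))) => //; apply: phiQ0.
have UW : zariski_dense U W.
  split=> [w []//|Z' clZ' UZ' w Ww]; have [f [fw fw0 fW]] := Wf w Ww.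
  (* Gam p on the two branch curves E + Q + Q^-1 = 2 and = -2, where the      *)
  (* roots M of the fibre equation M + M^-1 = E + Q + Q^-1 coincide *)
  pose h1 : {poly C} := gam ('X^2 - 2 * 'X + 3) (2 - 'X) p.
  pose h2 : {poly C} := gam ('X^2 + 2 * 'X - 1) (- 'X - 2) p.
  have h1E y : h1.[y] = gam (y ^+ 2 - 2 * y + 3) (2 - y) p.
    rewrite -[LHS]/(horner_eval _ _) rmorph_gam /= /horner_eval.
    by rewrite !(hornerD, hornerM, hornerC, hornerX, hornerN, hornerXn).
  have h2E y : h2.[y] = gam (y ^+ 2 + 2 * y - 1) (- y - 2) p.
    rewrite -[LHS]/(horner_eval _ _) rmorph_gam /= /horner_eval.
    by rewrite !(hornerD, hornerM, hornerC, hornerX, hornerN, hornerXn).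
  have h10 : h1 != 0.
    (* At y = 1 the parameters of [gam] are 2 and 1, the geometric case b = 1; similarly y = -1
       gives b = -1 for [h2]. *)
    have : h1.[1] != 0.
      have := gam_geometric_neq0 p (oner_neq0 C); rewrite h1E invr1.
      by congr (gam _ _ p != 0); ring.
    by apply: contraNneq => ->; rewrite horner0.
  have h20 : h2 != 0.
    have : h2.[- 1] != 0.
      have := @gam_geometric_neq0 C p (- 1); rewrite oppr_eq0 oner_neq0 => /(_ isT).
      by rewrite h2E invrN invr1; congr (gam _ _ p != 0); ring.
    by apply: contraNneq => ->; rewrite horner0.
  apply: (curve_subset_closed (f := f) (h := 'X * h1 * h2)) clZ' UZ' => //.
    by rewrite !mulf_neq0 // polyX_eq0.
  move=> x y fxy; rewrite !hornerM hornerX !mulf_eq0 !negb_or => /andP[/andP[y0 hy1] hy2].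
  have Wxy := fW x y fxy y0; have /(WP (x, y) y0) G0 := Wxy; split=> //.
  rewrite /Z /= zpE => /eqP; rewrite !mulf_eq0 (negPf y0) /= => /orP[] /eqP yx.
    move: hy1; rewrite h1E; apply/negP; rewrite negbK -G0; apply/eqP.
    have -> : x = - (y ^+ 2 - 2 * y + 1) / y.
      by apply: (mulfI y0); rewrite mulrCA divff // mulr1; apply/eqP; rewrite -addr_eq0 yx.
    by rewrite /Gam /chebX /=; congr (gam _ _ p); field.
  move: hy2; rewrite h2E; apply/negP; rewrite negbK -G0; apply/eqP.
  have -> : x = - (y ^+ 2 + 2 * y + 1) / y.
    by apply: (mulfI y0); rewrite mulrCA divff // mulr1; apply/eqP; rewrite -addr_eq0 yx.
  by rewrite /Gam /chebX /=; congr (gam _ _ p); field.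
split.
- exact: A_curve_dense.
- by move=> _ [z [Az Dz] <-]; exact: phiW.
- split; first by move=> _ [z [Az Dz] <-]; exact: phiW.
  move=> Z' clZ' VZ'; apply: (UW.2 Z' clZ') => w Uw; apply: VZ'.
  have [z [_ [_ [Dz zw] _ _]]] := Ufib w Uw; exists z => //; split=> //.
  by apply: phiA; rewrite ?zw //; case: Uw.
- exists U; split; [by exists Z|exact: UW|] => w Uw.
  have [z [z' [zz' [Dz zw] [Dz' zw'] uniq_z]]] := Ufib w Uw.
  have Az : A_curve C p z by apply: phiA; rewrite ?zw //; case: Uw.
  have Az' : A_curve C p z' by apply: phiA; rewrite ?zw' //; case: Uw.
  have -> : A_curve C p `&` phi_dom C `&` @phi C @^-1` [set w] = [set z; z'].
    apply/seteqP; split=> [u [[_ Du] /= uw]|u [] -> /=]; first exact: uniq_z.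
      by split.
    by split.
  have -> : [set z; z'] = (fun n : nat => if n is 0 then z else z') @` `I_2.
    apply/seteqP; split=> [u [] -> /=|_ [[|n] /= _ <-]].
    - by exists 0.
    - by exists 1.
    - by left.
    - by right.
  apply: inj_card_eq => [[|[|n]] [|[|k]]] //; rewrite !inE //= => _ _ zE.
    by rewrite zE eqxx in zz'.
  by rewrite zE eqxx in zz'.
Qed.

End Geometry.

(** * Skew polynomials and minimality by specialization at q = 1 *)

Section SkewPolynomials.

Variables (B : comNzRingType) (sigma : {rmorphism B -> B}).
Implicit Types (P S U : {poly B}) (c : B).

(* Left multiplication by E: P |-> E P = P^sigma E *)
Definition skewX P : {poly B} := 'X * map_poly sigma P.

Definition smul P S : {poly B} := \sum_(i < size P) P`_i *: iter i skewX S.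

Lemma skewXD P S : skewX (P + S) = skewX P + skewX S.
Proof. by rewrite /skewX rmorphD mulrDr. Qed.

Lemma skewX0 : skewX 0 = 0.
Proof. by rewrite /skewX rmorph0 mulr0. Qed.

Lemma skewXZ c P : skewX (c *: P) = sigma c *: skewX P.
Proof. by rewrite /skewX map_polyZ -scalerAr. Qed.

Lemma iter_skewX0 i : iter i skewX 0 = 0.
Proof. by elim: i => //= i ->; rewrite skewX0. Qed.

Lemma skewX_sum (I : Type) (r : seq I) (E : I -> {poly B}) :
  skewX (\sum_(i <- r) E i) = \sum_(i <- r) skewX (E i).
Proof. exact: (big_morph skewX skewXD skewX0). Qed.

Lemma coef_skewX P i : (skewX P)`_i = if i == 0%N then 0 else sigma P`_i.-1.
Proof. by rewrite /skewX coefXM; case: eqP => //; rewrite coef_map. Qed.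

Lemma coef_iter_skewX P i j :
    (iter i skewX P)`_j = if (j < i)%N then 0 else iter i sigma P`_(j - i).
Proof.
elim: i j => [|i IH] j /=; first by rewrite subn0.
rewrite coef_skewX; case: j => [//|j] /=; rewrite IH subSS ltnS.
by case: ifP => _; rewrite ?rmorph0.
Qed.

Lemma smul_widen n P S : (size P <= n)%N ->
  smul P S = \sum_(i < n) P`_i *: iter i skewX S.
Proof.
move=> Pn; rewrite /smul (big_ord_widen n (fun i => P`_i *: iter i skewX S)) //.
rewrite big_mkcond; apply: eq_bigr => i _; case: ifPn => //.
by rewrite -leqNgt => /(nth_default 0) ->; rewrite scale0r.
Qed.

Lemma smulDl P S U : smul (P + S) U = smul P U + smul S U.
Proof.
set n := maxn (size P) (size S).
rewrite (@smul_widen n P) ?leq_maxl // (@smul_widen n S) ?leq_maxr //.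
rewrite (@smul_widen n (P + S)) ?size_polyD // -big_split /=.
by apply: eq_bigr => i _; rewrite coefD scalerDl.
Qed.

Lemma smulZl c P S : smul (c *: P) S = c *: smul P S.
Proof.
rewrite (@smul_widen (size P)) ?size_scale_leq // scaler_sumr.
by apply: eq_bigr => i _; rewrite coefZ scalerA.
Qed.

Lemma smul0l S : smul 0 S = 0.
Proof. by rewrite /smul size_poly0 big_ord0. Qed.

Lemma smul_suml (I : Type) (r : seq I) (E : I -> {poly B}) S :
  smul (\sum_(i <- r) E i) S = \sum_(i <- r) smul (E i) S.
Proof. exact: (big_morph (smul^~ S) (fun P P' => smulDl P P' S) (smul0l S)). Qed.

Lemma smul_skewX P S : smul (skewX P) S = skewX (smul P S).
Proof.
rewrite (@smul_widen (size P).+1).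
  rewrite big_ord_recl coef_skewX scale0r add0r skewX_sum.
  by apply: eq_bigr => i _; rewrite coef_skewX skewXZ.
rewrite /skewX mulrC (leq_trans (size_polyMleq _ _)) // size_polyX addn2 /=.
by rewrite ltnS size_poly.
Qed.

Lemma smul_iter i P S : smul (iter i skewX P) S = iter i skewX (smul P S).
Proof. by elim: i => //= i IH; rewrite smul_skewX IH. Qed.

Lemma smulA P S U : smul P (smul S U) = smul (smul P S) U.
Proof.
rewrite {2}/smul smul_suml; apply: eq_bigr => i _.
by rewrite smulZl smul_iter.
Qed.

Lemma smulCl c S : smul c%:P S = c *: S.
Proof.
by rewrite (@smul_widen 1) ?size_polyC_leq1 // big_ord1 coefC.
Qed.

Lemma smul_Xn i S : smul 'X^i S = iter i skewX S.
Proof.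
rewrite (@smul_widen i.+1) ?size_polyXn // big_ord_recr /= coefXn eqxx scale1r.
by rewrite big1 ?add0r // => j _; rewrite coefXn ltn_eqF // scale0r.
Qed.

Lemma smulE P S : smul P S =
  \sum_(i < size P) \sum_(j < size S) (P`_i * iter i sigma S`_j) *: 'X^(i + j).
Proof.
apply: eq_bigr => i _;
    rewrite [iter i skewX S](_ : _ = \sum_(j < size S) iter i sigma S`_j *: 'X^(i + j)).
  by rewrite scaler_sumr; apply: eq_bigr => j _; rewrite scalerA.
rewrite -[S in LHS]coefK poly_def; elim: (nat_of_ord i) => [|k IH] /=.
  by apply: eq_bigr.
rewrite IH skewX_sum; apply: eq_bigr => j _; rewrite skewXZ /skewX map_polyXn.
by rewrite -exprS addSn.
Qed.

End SkewPolynomials.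

Section SkewMorphism.
Variables (B B' : comNzRingType) (sigma : {rmorphism B -> B}).
Variables (sigma' : {rmorphism B' -> B'}) (f : {rmorphism B -> B'}).
Hypothesis f_sigma : forall c, f (sigma c) = sigma' (f c).

Lemma map_skewX P : map_poly f (skewX sigma P) = skewX sigma' (map_poly f P).
Proof.
rewrite /skewX rmorphM /= map_polyX; congr (_ * _); apply/polyP => i.
by rewrite !coef_map /= f_sigma.
Qed.

Lemma map_smul P S : map_poly f (smul sigma P S) =
  smul sigma' (map_poly f P) (map_poly f S).
Proof.
rewrite (@smul_widen _ _ (size P) (map_poly f P)) ?size_poly // rmorph_sum.
apply: eq_bigr => i _; rewrite /= map_polyZ coef_map; congr (_ *: _).
by elim: (nat_of_ord i) => //= k IH; rewrite map_skewX IH.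
Qed.

End SkewMorphism.

(** At q = 1 the shift is trivial, so skew factorizations specialize to factorizations of ordinary
    polynomials. *)
Lemma smul_id (B : comNzRingType) (P S : {poly B}) : smul idfun P S = P * S.
Proof.
rewrite -[in RHS](coefK P) poly_def mulr_suml; apply: eq_bigr => i _.
rewrite -scalerAl; congr (_ *: _); elim: (nat_of_ord i) => [|k IH] /=; first by rewrite mul1r.
by rewrite IH /skewX map_poly_id // exprS mulrA.
Qed.

Section SkewDivision.
Variables (B : idomainType) (sigma : {rmorphism B -> B}).
Hypothesis sigma_inj : injective sigma.
Implicit Types (P S C A : {poly B}).

Lemma iter_sigma_neq0 i c : c != 0 -> iter i sigma c != 0.
Proof.
by move=> c0; elim: i => //= i; rewrite -{2}(rmorph0 sigma) (inj_eq sigma_inj).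
Qed.

Lemma size_iter_skewX i P : P != 0 -> size (iter i (skewX sigma) P) = (size P + i)%N.
Proof.
move=> P0; elim: i => [|i IH] /=; first by rewrite addn0.
rewrite /skewX mulrC size_mulX ?size_map_inj_poly ?rmorph0 ?IH ?addnS //.
by rewrite -size_poly_gt0 size_map_inj_poly ?rmorph0 // IH addn_gt0 size_poly_gt0 P0.
Qed.

Lemma lead_iter_skewX i P :
  lead_coef (iter i (skewX sigma) P) = iter i sigma (lead_coef P).
Proof.
have [->|P0] := eqVneq P 0.
  by rewrite iter_skewX0 lead_coef0; elim: i => //= i <-; rewrite rmorph0.
rewrite lead_coefE size_iter_skewX // coef_iter_skewX ifF.
  by rewrite lead_coefE; congr (iter i sigma P`_ _); have := P0; rewrite -size_poly_gt0; lia.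
by apply/negbTE; have := P0; rewrite -size_poly_gt0; lia.
Qed.

Lemma size_smul P S : P != 0 -> S != 0 ->
  size (smul sigma P S) = (size P + size S).-1.
Proof.
move=> P0 S0; have := P0; rewrite -size_poly_gt0 /smul.
have := P0; rewrite -lead_coef_eq0 lead_coefE; case: (size P) => // d /= lP _.
rewrite big_ord_recr /= addrC size_polyDl ?size_scale ?size_iter_skewX // 1?addnC //.
rewrite (leq_ltn_trans (size_sum _ _ _)) // -ltnS.
rewrite ltnS; case: d {lP} => [|d]; first by rewrite big_ord0 size_poly_gt0.
apply: (@leq_ltn_trans (size S + d)); last by lia.
apply/bigmax_leqP => i _; rewrite (leq_trans (size_scale_leq _ _)) //.
by rewrite size_iter_skewX // leq_add2l -ltnS.
Qed.

(** Degrees add under the skew product, so the mutual quotients are constants, and monicity makes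
    them 1. *)
Lemma monic_associates P S C C' : C \is monic -> C' \is monic ->
  C = smul sigma P C' -> C' = smul sigma S C -> C = C'.
Proof.
move=> mC mC' CE C'E; have C0 := monic_neq0 mC; have C'0 := monic_neq0 mC'.
have P0 : P != 0 by apply: contraNneq C0 => P0; rewrite CE P0 smul0l.
have S0 : S != 0 by apply: contraNneq C'0 => S0; rewrite C'E S0 smul0l.
have szP : size P = 1%N.
  have := size_smul S0 C0; have := size_smul P0 C'0; rewrite -CE -C'E.
  have := C0; have := P0; have := S0; rewrite -!size_poly_gt0.
  by move: (size C) (size C') (size P) (size S) => x y z t; lia.
have Pc : P = (P`_0)%:P by apply: size1_polyC; rewrite szP.
move: (mC); rewrite CE Pc smulCl monicE lead_coefZ (monicP mC') mulr1 => /eqP ->.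
by rewrite scale1r.
Qed.

(** Division by C over a domain: t collects shifts of the leading coefficient of C, which stay
    nonzero because sigma is injective. *)
Lemma skew_pseudo_division C A : C != 0 -> exists t S R,
  [/\ t != 0, t *: A = smul sigma S C + R & (size R < size C)%N].
Proof.
move=> C0; have [n] := ubnP (size A); elim: n A => // n IH A; rewrite ltnS => An.
have [AC|CA] := ltnP (size A) (size C).
  by exists 1, 0, A; split; rewrite ?oner_neq0 // smul0l add0r scale1r.
pose k := (size A - size C)%N; pose t1 := iter k sigma (lead_coef C).
have t10 : t1 != 0 by rewrite iter_sigma_neq0 // lead_coef_eq0.
pose A' := t1 *: A - lead_coef A *: iter k (skewX sigma) C.
have A0 : A != 0 by rewrite -size_poly_gt0 (leq_trans _ CA) // size_poly_gt0.
have A'n : (size A' < size A)%N.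
  have szA : (0 < size A)%N by rewrite size_poly_gt0.
  rewrite -[X in (_ < X)%N](prednK szA) ltnS; apply/leq_sizeP => j jA.
  rewrite coefB !coefZ; move: jA; rewrite leq_eqVlt => /predU1P[<-|jA].
    rewrite -lead_coefE; have -> : (iter k (skewX sigma) C)`_(size A).-1 = t1.
      rewrite /t1 -lead_iter_skewX [RHS]lead_coefE size_iter_skewX //.
      by congr (_`_ _); rewrite /k; lia.
    by rewrite mulrC subrr.
  rewrite !nth_default ?mulr0 ?subr0 //; first by rewrite size_iter_skewX // /k; lia.
  by rewrite -[X in (X <= _)%N](prednK szA).
have [t' [S' [R [t'0 tE RC]]]] := IH A' (leq_trans A'n An).
exists (t' * t1), (S' + (t' * lead_coef A) *: 'X^k), R; split; rewrite ?mulf_neq0 //.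
rewrite smulDl smulZl smul_Xn addrAC -tE /A' scalerBr !scalerA subrK //.
Qed.

End SkewDivision.

(** * The action of q-difference operators on sequences *)

Section QDifferenceAction.

Variables (F : fieldType) (q : F).
Implicit Types (P S : {poly {poly F}}) (c : {poly F}) (f : nat -> F).

Definition qact P f (n : nat) : F := \sum_(j < size P) (P`_j).[q ^+ n] * f (n + j)%N.

Lemma qact_widen m P f n : (size P <= m)%N ->
  qact P f n = \sum_(j < m) (P`_j).[q ^+ n] * f (n + j)%N.
Proof.
move=> Pm; rewrite /qact (big_ord_widen m (fun j => (P`_j).[q ^+ n] * f (n + j)%N)) //.
rewrite big_mkcond; apply: eq_bigr => i _; case: ifPn => //.
by rewrite -leqNgt => /(nth_default 0) ->; rewrite horner0 mul0r.
Qed.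

Lemma qactD P S f n : qact (P + S) f n = qact P f n + qact S f n.
Proof.
set m := maxn (size P) (size S).
rewrite (@qact_widen m P) ?leq_maxl // (@qact_widen m S) ?leq_maxr //.
rewrite (@qact_widen m (P + S)) ?size_polyD // -big_split /=.
by apply: eq_bigr => i _; rewrite coefD hornerD mulrDl.
Qed.

Lemma qact0 f n : qact 0 f n = 0.
Proof. by rewrite /qact size_poly0 big_ord0. Qed.

Lemma qactZ c P f n : qact (c *: P) f n = c.[q ^+ n] * qact P f n.
Proof.
rewrite (@qact_widen (size P)) ?size_scale_leq // mulr_sumr.
by apply: eq_bigr => i _; rewrite coefZ hornerM mulrA.
Qed.

Lemma qact_sum (I : Type) (r : seq I) (E : I -> {poly {poly F}}) f n :
  qact (\sum_(i <- r) E i) f n = \sum_(i <- r) qact (E i) f n.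
Proof. exact: (big_morph (fun P => qact P f n) (fun P S => qactD P S f n) (qact0 f n)). Qed.

Lemma qact_skewX P f n : qact (skewX (comp_poly (q *: 'X)) P) f n = qact P f n.+1.
Proof.
rewrite (@qact_widen (size P).+1).
  rewrite big_ord_recl coef_skewX horner0 mul0r add0r.
  apply: eq_bigr => i _; rewrite coef_skewX /= horner_comp hornerZ hornerX -exprS.
  by rewrite addnS addSn.
rewrite /skewX mulrC (leq_trans (size_polyMleq _ _)) // size_polyX addn2 /=.
by rewrite ltnS size_poly.
Qed.

Lemma qact_smul P S f n : qact (smul (comp_poly (q *: 'X)) P S) f n =
  \sum_(i < size P) (P`_i).[q ^+ n] * qact S f (n + i)%N.
Proof.
rewrite qact_sum; apply: eq_bigr => i _; rewrite qactZ; congr (_ * _).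
elim: (nat_of_ord i) n => [|k IH] n /=; first by rewrite addn0.
by rewrite qact_skewX IH addSnnS.
Qed.

End QDifferenceAction.

Lemma comp_scaleX_inj (R : idomainType) (a : R) : a != 0 ->
  injective (comp_poly (a *: 'X)).
Proof.
move=> a0; apply: raddf_inj => c /eqP.
by rewrite comp_poly2_eq0 ?size_scale ?size_polyX // => /eqP.
Qed.

Section Content.
Variables (D D' : comNzRingType) (c : D) (psi : {rmorphism D -> D'}).
Hypothesis psi_ker : forall x, psi x = 0 -> exists y, x = c * y.

Lemma map_poly_ker (x : {poly D}) : map_poly psi x = 0 -> exists y, x = c *: y.
Proof.
elim/poly_ind: x => [|x d IH]; first by exists 0; rewrite scaler0.
move=> xd; have [|y ->] := IH.
  apply/polyP => i; rewrite coef0 coef_map.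
  by have := congr1 (fun u : {poly D'} => u`_i.+1) xd;
    rewrite coef_map coefD coefMX coefC /= addr0 coef0.
have [|e ->] := psi_ker (x := d).
  by have := congr1 (fun u : {poly D'} => u`_0) xd;
    rewrite coef_map coefD coefMX coefC /= add0r coef0.
by exists (y * 'X + e%:P); rewrite scalerDr -scalerAl polyCM mul_polyC.
Qed.

End Content.

(** * Minimality of a recursion from its specialization at q = 1 *)

Section Minimality.

Variables (k F : fieldType) (iota : {rmorphism {poly k} -> F}).
Hypothesis iota_inj : injective iota.

Local Notation B := {poly {poly k}}.
Local Notation q := (iota 'X).
Local Notation sigma := (comp_poly ('X *: 'X : B)).
Local Notation at1 := (map_poly (map_poly (horner_eval (1 : k)))).
Local Notation act P f n := (qact q (map_poly (map_poly iota) P) f n).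

Let q1 : B := ('X - 1)%:P.

Let sigma_inj : injective sigma.
Proof. by apply: comp_scaleX_inj; rewrite polyX_eq0. Qed.

Lemma at1_ker (P : {poly B}) : at1 P = 0 -> exists S, P = q1 *: S.
Proof.
apply: map_poly_ker => x /(map_poly_ker (c := 'X - 1)) [y /eqP yx|y ->].
  by have /factor_theorem[z ->] := yx; exists z; rewrite mulrC.
by exists y; rewrite mul_polyC.
Qed.

Lemma at1_q1 (P : {poly B}) : at1 (q1 *: P) = 0.
Proof.
rewrite map_polyZ /=; have -> : map_poly (horner_eval (1 : k)) q1 = 0.
  by rewrite /q1 map_polyC /= horner_evalE !hornerE subrr.
by rewrite scale0r.
Qed.

Lemma q1_neq0 : q1 != 0.
Proof. by rewrite polyC_eq0 -[1](polyC1) polyXsubC_eq0. Qed.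

(** Extracting a factor q - 1 lowers the q-degree of the leading coefficient, so the extraction
    terminates. *)
Lemma at1_normalize (P : {poly B}) : P != 0 ->
  exists n S, P = q1 ^+ n *: S /\ at1 S != 0.
Proof.
have [d] := ubnP (size (lead_coef (lead_coef P))); elim: d P => // d IH P.
rewrite ltnS => Pd P0; have [/at1_ker[S PS]|P1] := eqVneq (at1 P) 0; last first.
  by exists 0, P; rewrite scale1r.
have S0 : S != 0 by apply: contraNneq P0 => S0; rewrite PS S0 scaler0.
have [|//|n [U [SU U1]]] := IH S; last first.
  by exists n.+1, U; split=> //; rewrite PS SU scalerA exprS.
apply: leq_trans Pd; rewrite PS lead_coefZ lead_coefM lead_coefC mulrC.
by rewrite size_Mmonic ?lead_coef_eq0 -?[1]polyC1 ?monicXsubC // size_XsubC addn2.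
Qed.

Lemma act_iota_smul (P S : {poly B}) f n :
  act (smul sigma P S) f n = \sum_(i < size P)
    (map_poly iota P`_i).[q ^+ n] * act S f (n + i)%N.
Proof.
rewrite (map_smul (sigma' := comp_poly (q *: 'X))); last first.
  move=> c; rewrite /= map_comp_poly; congr (_ \Po _).
  by rewrite map_polyZ map_polyX.
rewrite qact_smul (big_ord_widen (size P) (fun i =>
   ((map_poly (map_poly iota) P)`_i).[q ^+ n] * act S f (n + i)%N)) ?size_poly //.
rewrite big_mkcond; apply: eq_bigr => i _; rewrite coef_map; case: ifPn => //=.
rewrite -leqNgt => /(nth_default 0); rewrite coef_map /= => ->.
by rewrite horner0 mul0r.
Qed.

Lemma at1_smul (S P : {poly B}) : at1 (smul sigma S P) = at1 S * at1 P.
Proof.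
rewrite (map_smul (sigma' := idfun)) ?smul_id // => c /=.
by rewrite map_comp_poly map_polyZ map_polyX /= horner_evalE hornerX scale1r comp_polyXr.
Qed.

Lemma scale_inj (c : B) : c != 0 -> injective (fun P : {poly B} => c *: P).
Proof.
by move=> c0 P S; rewrite -!mul_polyC; apply: mulfI; rewrite polyC_eq0.
Qed.

(** Gauss's lemma for the prime q - 1: at q = 1 the product S P vanishes in a commutative domain
    while P does not, so q - 1 divides S. *)
Lemma cancel_q1 (P C S : {poly B}) (u : B) a : at1 P != 0 ->
  (q1 ^+ a * u) *: C = smul sigma S P -> exists S', u *: C = smul sigma S' P.
Proof.
move=> P1; elim: a S => [|a IH] S; first by rewrite mul1r; exists S.
rewrite exprS -mulrA -scalerA => CS; have := at1_q1 ((q1 ^+ a * u) *: C).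
rewrite CS at1_smul => /eqP; rewrite mulf_eq0 (negPf P1) orbF => /eqP/at1_ker[S' SS'].
apply: (IH S'); apply: (scale_inj q1_neq0); rewrite /= CS SS'.
by rewrite smulZl.
Qed.

Variables (f : nat -> F) (C : {poly B}) (m : nat).
Hypothesis size_C : size C = m.+1.
Hypothesis C_act : forall n, act C f n = 0.
Hypothesis C_irr : forall (t : {poly k}) (S P : {poly {poly k}}), t != 0 ->
  t *: at1 C = S * P -> (size S <= m)%N -> (size P <= m)%N -> False.
Hypothesis f_not_torsion : forall r : B, r != 0 ->
  (forall n, (map_poly iota r).[q ^+ n] * f n = 0) -> False.

(** Divide C by an annihilator R of size at most m, freed of powers of q - 1. The remainder
    annihilates f too, so it is zero by induction on the size. Then R divides a multiple of C, and
    at q = 1 this is a factorization excluded by [C_irr]; order 0 is excluded by [f_not_torsion]. *)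
Lemma annihilator_order (R : {poly B}) : R != 0 -> (size R <= m)%N ->
  (forall n, act R f n = 0) -> False.
Proof.
move: {2}(size R) (leqnn (size R)) => d; elim/ltn_ind: d R => d IH R Rd R0 Rm Ract.
have [n [P [RP P1]]] := at1_normalize R0.
have P0 : P != 0 by apply: contraNneq P1 => ->; rewrite !rmorph0.
have szRP : size R = size P by rewrite RP size_scale // expf_neq0 // q1_neq0.
have Pact j : act P f j = 0.
  have := Ract j; rewrite RP map_polyZ qactZ /= -polyC_exp map_polyC hornerC => /eqP.
  rewrite mulf_eq0 (raddf_eq0 _ iota_inj) expf_eq0 -[1]polyC1 polyXsubC_eq0 andbF.
  by move/eqP.
have [t [S [U [t0 tC UP]]]] := skew_pseudo_division sigma_inj C P0.
have U0 : U = 0.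
  apply/eqP; apply: contraT => U_neq0; exfalso.
  apply: (IH (size U)) (leqnn _) U_neq0 _ _; first by rewrite (leq_trans UP) // -szRP.
    by rewrite (leq_trans (ltnW UP)) // -szRP.
  move=> j; have := C_act j => Cj; have : act (t *: C) f j = 0.
    by rewrite map_polyZ qactZ Cj mulr0.
  rewrite tC rmorphD qactD act_iota_smul big1 ?add0r // => i _.
  by rewrite Pact mulr0.
have [P2|P2] := leqP (size P) 1%N.
  have rP := size1_polyC P2; apply: (f_not_torsion (r := P`_0)).
    by apply: contraNneq P0 => r0; rewrite rP r0.
  move=> j; rewrite -[RHS](Pact j) rP map_polyC /= (@qact_widen _ _ 1) ?size_polyC_leq1 //.
  by rewrite big_ord1 coefC /= addn0 coefC.
rewrite U0 addr0 in tC.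
have tP0 : t%:P != 0 by rewrite polyC_eq0.
(* The multiplier t of the division may vanish at q = 1; its powers of q - 1 are split off and
   cancelled against the quotient. *)
have [a [V [tV V1]]] := at1_normalize tP0.
have Vt : V = (V`_0)%:P.
  apply: size1_polyC; rewrite -(size_scale V (expf_neq0 a q1_neq0)) -tV.
  exact: size_polyC_leq1.
have tE : t = q1 ^+ a * V`_0.
  by apply/polyC_inj; rewrite tV {1}Vt -mul_polyC polyCM.
rewrite tE in tC; have [S' uC] := cancel_q1 P1 tC.
have u0 : map_poly (horner_eval (1 : k)) V`_0 != 0.
  by apply: contraNneq V1 => u0; rewrite Vt map_polyC /= u0.
have V0 : V`_0 != 0 by apply: contraNneq u0 => ->; rewrite rmorph0.
have S'0 : S' != 0.
  apply/eqP => S'0; have := size_C; rewrite -(size_scale C V0) uC S'0 smul0l.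
  by rewrite size_poly0.
have szS' : (size S' <= m)%N.
  have := size_smul sigma_inj S'0 P0; rewrite -uC size_scale // size_C.
  by move: P2; move: (size P) (size S') => x y; lia.
apply: (C_irr u0 (S := at1 S') (P := at1 P)).
- by rewrite -at1_smul -uC map_polyZ.
- exact: leq_trans (size_poly _ _) szS'.
- by rewrite (leq_trans (size_poly _ _)) // -szRP.
Qed.

End Minimality.

Lemma scale_polyC_mulX (R : comNzRingType) (x y : R) (P : {poly R}) :
  y *: (x%:P * P) * 'X = x%:P * y%:P * (P * 'X).
Proof. by rewrite -mul_polyC; ring. Qed.

Lemma polyC_mul_divK (K : fieldType) (x y u : K) : y != 0 ->
  x%:P * u%:P = x%:P * y%:P * (u / y)%:P :> {poly K}.
Proof. by move=> y0; rewrite -!polyCM; congr (_%:P); field. Qed.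

Section ClearDenominators.

Variable k : fieldType.
Local Notation fr := (@FracField.tofrac {poly k}).

Lemma clear_denominators (P : {poly {fraction {poly k}}}) :
  exists d (P' : {poly {poly k}}), d != 0 /\ map_poly fr P' = (fr d)%:P * P.
Proof.
elim/poly_ind: P => [|P c [d [P' [d0 PE]]]].
  by exists 1, 0; rewrite oner_neq0 rmorph0 mulr0.
have v0 : (frac (repr c)).2 != 0 by exact: denom_ratioP.
have := frac_repr c; move: v0; move: (_.2) (_.1) => v u v0 cE.
exists (d * v), (v *: P' * 'X + (d * u)%:P); split; first by rewrite mulf_neq0.
rewrite rmorphD !rmorphM /= map_polyC map_polyX map_polyZ PE /= mulrDr; congr (_ + _).
  exact: scale_polyC_mulX.
rewrite map_polyC cE; apply: polyC_mul_divK.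
by rewrite tofrac_eq0.
Qed.

Lemma clear_denominators_poly (P : {poly {poly {fraction {poly k}}}}) :
  exists d (P' : {poly {poly {poly k}}}),
    d != 0 /\ map_poly (map_poly fr) P' = (fr d)%:P%:P * P.
Proof.
elim/poly_ind: P => [|P c [d [P' [d0 PE]]]].
  by exists 1, 0; rewrite oner_neq0 rmorph0 mulr0.
have [v [u [v0 uE]]] := clear_denominators c.
exists (d * v), (v%:P *: P' * 'X + (d%:P * u)%:P); split; first by rewrite mulf_neq0.
rewrite rmorphD !rmorphM /= map_polyC map_polyX map_polyZ PE /= map_polyC mulrDr.
congr (_ + _).
  exact: scale_polyC_mulX.
by rewrite !map_polyC /= uE polyCM mulrA.
Qed.

End ClearDenominators.

Lemma int_rec_unique (F : fieldType) (x c : F) (f g : int -> F) :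
    c != 0 -> (forall p, f (p + 1) = x * f p - c * f (p - 1)) ->
    (forall p, g (p + 1) = x * g p - c * g (p - 1)) ->
  f 0 = g 0 -> f 1 = g 1 -> f =1 g.
Proof.
move=> c0 fP gP fg0 fg1.
have pos n : f (Posz n) = g (Posz n) /\ f (Posz n.+1) = g (Posz n.+1).
  elim: n => [//|n [IH IH1]]; split=> //.
  have := fP (Posz n.+1); have := gP (Posz n.+1).
  have -> : Posz n.+1 + 1 = Posz n.+2 by lia.
  have -> : Posz n.+1 - 1 = Posz n by lia.
  by move=> -> ->; rewrite IH IH1.
have neg n : f (- Posz n) = g (- Posz n) /\ f (- Posz n + 1) = g (- Posz n + 1).
  elim: n => [|n [IH IH1]]; first by rewrite oppr0 add0r.
  have e1 : - Posz n.+1 + 1 = - Posz n by lia.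
  rewrite e1; split=> //; have -> : - Posz n.+1 = - Posz n - 1 by lia.
  have := fP (- Posz n); rewrite IH1 gP IH => /addrI/oppr_inj/(mulfI c0).
  exact: esym.
case=> n; first by have [] := pos n.
by have [] := neg n.+1.
Qed.

(** * The recursion for the cyclotomic function *)

Section NewtonCoefficients.

Variables (F : fieldType) (q y : F).

Definition node (s : nat) : F := y / q ^+ s.

(* multiplication by X in the basis newton_basis below *)
Definition mulX_newton_co (c : nat -> F) (j : nat) : F :=
  ((node j)^-1 + q * node j) * c j
  - (if j is j'.+1 then (node j')^-1 * c j' else 0).

(* cheb p j is the coefficient, in that basis, of                             *)
(* V_p = (z^-p - q^p z^p) / (z^-1 - q z) as a polynomial in X = z^-1 + q z. *)
Fixpoint cheb_nat (n : nat) : nat -> F :=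
  match n with
  | 0 => fun=> 0
  | 1 => fun j => (j == 0%N)%:R
  | (k.+1 as m).+1 => fun j => mulX_newton_co (cheb_nat m) j - q * cheb_nat k j
  end.

Definition cheb (p : int) (j : nat) : F :=
  match p with
  | Posz n => cheb_nat n j
  | Negz n => - (q ^+ n.+1)^-1 * cheb_nat n.+1 j
  end.

(* V_(p+1) - (1 + q y) V_p + q y V_(p-1); for y = q^N and z = q^k this        *)
(* combination makes the k-sum of masbaum_rec telescope. *)
Definition newton_co (p : int) (j : nat) : F :=
  cheb (p + 1) j - (1 + q * y) * cheb p j + q * y * cheb (p - 1) j.

Lemma cheb_natSS n j :
  cheb_nat n.+2 j = mulX_newton_co (cheb_nat n.+1) j - q * cheb_nat n j.
Proof. by []. Qed.

Lemma cheb_nat_small n j : (n <= j)%N -> cheb_nat n j = 0.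
Proof.
have [] // : (forall j, (n <= j)%N -> cheb_nat n j = 0) /\
          (forall j, (n < j)%N -> cheb_nat n.+1 j = 0).
  elim: n => [|n [IH0 IH1]]; first by split=> // -[].
  split=> // -[//|i] ni; rewrite cheb_natSS /mulX_newton_co !IH1 ?IH0 ?mulr0 ?subr0 //; lia.
by move=> H _ nj; exact: H.
Qed.

Lemma cheb_lead n : cheb_nat n.+1 n = \prod_(s < n) (- (node s)^-1).
Proof.
elim: n => [|n IH]; first by rewrite big_ord0.
rewrite big_ord_recr /= -IH -/(cheb_nat n.+2 n.+1) cheb_natSS /mulX_newton_co.
rewrite (@cheb_nat_small n.+1 n.+1) //.
by rewrite (@cheb_nat_small n n.+1) //; ring.
Qed.

Lemma newton_co_small p j : (`|p| < j)%N -> newton_co p j = 0.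
Proof.
have small k : (`|k| <= j)%N -> cheb k j = 0.
  by case: k => n kj; rewrite /cheb cheb_nat_small ?mulr0.
by move=> pj; rewrite /newton_co !small ?mulr0 ?subr0 ?addr0 //; lia.
Qed.

Hypotheses (q0 : q != 0) (y0 : y != 0).

Lemma node_neq0 s : node s != 0.
Proof. by rewrite mulf_neq0 ?invr_eq0 ?expf_neq0. Qed.

Lemma chebN n j : cheb (- Posz n) j = - (q ^+ n)^-1 * cheb_nat n j.
Proof. by case: n => [|n] //=; rewrite mulr0. Qed.

Lemma mulX_newton_coZ a c j : mulX_newton_co (fun i => a * c i) j = a * mulX_newton_co c j.
Proof. by rewrite /mulX_newton_co; case: j => [|j]; ring. Qed.

Lemma cheb_rec p j : cheb (p + 1) j = mulX_newton_co (cheb p) j - q * cheb (p - 1) j.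
Proof.
case: p => [[|n]|n].
- rewrite add0r sub0r (chebN 1) /= /mulX_newton_co.
  have c0 i : cheb (Posz 0) i = 0 by [].
  by rewrite !c0; case: j => [|j] /=; rewrite ?c0 ?mulr0; field.
- have -> : Posz n.+1 + 1 = Posz n.+2 by lia.
  by have -> : Posz n.+1 - 1 = Posz n by lia.
- have -> : Negz n - 1 = - Posz n.+2 by lia.
  have -> : Negz n + 1 = - Posz n by lia.
  rewrite !chebN /cheb -/(cheb_nat) mulX_newton_coZ cheb_natSS !exprS.
  by move: (mulX_newton_co _ _) (cheb_nat n j) => u v; field; rewrite q0 expf_neq0.
Qed.

Lemma mulX_newton_coD c d j :
  mulX_newton_co (fun i => c i + d i) j = mulX_newton_co c j + mulX_newton_co d j.
Proof. by rewrite /mulX_newton_co; case: j => [|j]; ring. Qed.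

Lemma newton_co_rec p j :
  newton_co (p + 1) j = mulX_newton_co (newton_co p) j - q * newton_co (p - 1) j.
Proof.
have -> : newton_co p =
    (fun i => cheb (p + 1) i + (- (1 + q * y)) * cheb p i + (q * y) * cheb (p - 1) i).
  by apply/funext => i; rewrite mulNr.
rewrite !mulX_newton_coD !mulX_newton_coZ /newton_co (cheb_rec (p + 1)) subrK addrK (cheb_rec p).
have := cheb_rec (p - 1) j; rewrite subrK => ->.
by ring.
Qed.

(** Only V_(p+1) for p > 0, or V_(p-1) for p < 0, reaches degree |p|. This coefficient enters the
    lowest term of the recursion. *)
Lemma newton_co_lead_neq0 p : p != 0 -> newton_co p `|p| != 0.
Proof.
have lead n : cheb_nat n.+1 n != 0.
  rewrite cheb_lead; apply/prodf_neq0 => s _.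
  by rewrite oppr_eq0 invr_eq0 node_neq0.
have small (k : int) (j : nat) : (`|k| <= j)%N -> cheb k j = 0.
  by case: k => n kj; rewrite /cheb cheb_nat_small ?mulr0.
case: p => n n0.
  rewrite /newton_co (small (Posz n)) // (small (Posz n - 1)); last by lia.
  have -> : Posz n + 1 = Posz n.+1 by lia.
  by rewrite !mulr0 subr0 addr0 lead.
rewrite /newton_co (small (Negz n)) // (small (Negz n + 1)); last by lia.
have -> : Negz n - 1 = Negz n.+1 by lia.
rewrite mulr0 subr0 add0r /cheb !mulf_neq0 ?lead //.
by rewrite oppr_eq0 invr_eq0 expf_neq0.
Qed.

(** This coefficient is the value at X = y^-1 + q y, where the other basis elements vanish. It
    belongs to the top term of the recursion and accounts for the normalization by 1 - y. *)
Lemma newton_co0 p : newton_co p 0 = y ^ (- p) * (1 - y).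
Proof.
apply: (@int_rec_unique _ (y^-1 + q * y) q (newton_co ^~ 0)
  (fun p => y ^ (- p) * (1 - y))) => //.
- by move=> k; rewrite newton_co_rec /mulX_newton_co /node expr0 divr1 subr0.
- move=> k; have -> : - (k - 1) = - k + 1 by lia.
  rewrite opprD !expfzDr // expr1z exprN1.
  by move: (y ^ (- k)) => u; field.
- by rewrite /newton_co add0r sub0r /= oppr0 expr0z /=; field.
- rewrite /newton_co subrr /= /mulX_newton_co /node expr0 divr1 /= exprN1.
  by field.
Qed.

End NewtonCoefficients.

Section NewtonBasis.

Variables (F : fieldType) (q y : F).
Hypotheses (q0 : q != 0) (y0 : y != 0).

(** For X = z^-1 + q z and t = y / q^s the factor is (1 - t / z)(1 - q t z); for y = q^N and z = q^k
    it is a product of two q-Pochhammer factors. *)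
Definition newton_basis (X : F) (j : nat) : F :=
  \prod_(s < j) (1 + q * node q y s ^+ 2 - node q y s * X).

(** Multiplication by X raises the degree by one; c n = 0 keeps the result within the range of
    summation. *)
Lemma mulX_newton X n (c : nat -> F) : c n = 0 ->
  \sum_(j < n.+1) mulX_newton_co q y c j * newton_basis X j
    = X * \sum_(j < n.+1) c j * newton_basis X j.
Proof.
move=> cn; have nX j : (node q y j)^-1 * newton_basis X j.+1
    = ((node q y j)^-1 + q * node q y j - X) * newton_basis X j.
  rewrite /newton_basis big_ord_recr /=; move: (\prod_(_ < j) _) => u.
  by field; rewrite node_neq0.
have -> : \sum_(j < n.+1) mulX_newton_co q y c j * newton_basis X j =
  \sum_(j < n.+1) ((node q y j)^-1 + q * node q y j) * c j * newton_basis X j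
  - \sum_(j < n.+1) (if nat_of_ord j is j'.+1 then (node q y j')^-1 * c j' else 0)
       * newton_basis X j.
  by rewrite -sumrB; apply: eq_bigr => j _; rewrite /mulX_newton_co mulrBl.
rewrite [X in _ - X]big_ord_recl mul0r add0r big_ord_recr /= cn mulr0 mul0r addr0.
rewrite [in RHS]big_ord_recr /= cn mul0r addr0 mulr_sumr -sumrB.
apply: eq_bigr => j _; rewrite /bump /= add1n add0n.
have -> : (node q y j)^-1 * c j * newton_basis X j.+1
  = c j * ((node q y j)^-1 * newton_basis X j.+1) by ring.
rewrite nX.
by ring.
Qed.

Lemma cheb_nat_newton z n m : z != 0 -> (m <= n)%N ->
  (z^-1 - q * z) * \sum_(j < n.+1) cheb_nat q y m j * newton_basis (z^-1 + q * z) j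
    = z ^- m - q ^+ m * z ^+ m.
Proof.
move=> z0; suff H : forall m,
    ((m <= n)%N -> (z^-1 - q * z)
      * \sum_(j < n.+1) cheb_nat q y m j * newton_basis (z^-1 + q * z) j
    = z ^- m - q ^+ m * z ^+ m) /\
    ((m.+1 <= n)%N -> (z^-1 - q * z)
      * \sum_(j < n.+1) cheb_nat q y m.+1 j * newton_basis (z^-1 + q * z) j
    = z ^- m.+1 - q ^+ m.+1 * z ^+ m.+1) by have [] := H m.
elim=> [|k [IH0 IH1]].
  split=> _; first by rewrite big1 => [|j _]; rewrite /= ?mul0r // mulr0 !expr0 invr1 mulr1 subrr.
  rewrite big_ord_recl big1 => [|j _]; last by rewrite /= mul0r.
  by rewrite /newton_basis big_ord0 /= !expr1; ring.
split=> // kn; have := IH1 (ltnW kn); have := IH0 (ltnW (ltnW kn)).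
set S0 := \sum_(_ < _) _; set S1 := \sum_(_ < _) _ => e0 e1.
have -> : \sum_(j < n.+1) cheb_nat q y k.+2 j * newton_basis (z^-1 + q * z) j
   = (z^-1 + q * z) * S1 - q * S0.
  rewrite /S1 -mulX_newton ?cheb_nat_small ?(ltnW kn) // mulr_sumr -sumrB.
  by apply: eq_bigr => j _; rewrite cheb_natSS; ring.
rewrite mulrBr mulrCA e1 [_ * (q * S0)]mulrCA e0 !exprS.
have := expf_neq0 k z0; move: (z ^+ k) (q ^+ k) => u v u0.
by field; rewrite z0 u0.
Qed.

Lemma cheb_newton z n p : z != 0 -> (`|p| <= n)%N ->
  (z^-1 - q * z) * \sum_(j < n.+1) cheb q y p j * newton_basis (z^-1 + q * z) j
    = z ^ (- p) - q ^ p * z ^ p.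
Proof.
move=> z0; case: p => m mn; first by rewrite (cheb_nat_newton z0 mn) exprnN.
rewrite /cheb; under eq_bigr do rewrite -mulrA.
rewrite -mulr_sumr mulrCA (cheb_nat_newton z0 mn) NegzE opprK -!exprnN -exprnP.
have := expf_neq0 m.+1 q0; have := expf_neq0 m.+1 z0.
by move: (z ^+ _) (q ^+ _) => u v u0 v0; field; rewrite u0.
Qed.

Lemma newton_co_expansion z n p : z != 0 -> (`|p| < n)%N ->
  (z^-1 - q * z) * \sum_(j < n.+1) newton_co q y p j * newton_basis (z^-1 + q * z) j
    = (z ^ (- (p + 1)) - q ^ (p + 1) * z ^ (p + 1))
      - (1 + q * y) * (z ^ (- p) - q ^ p * z ^ p)
      + q * y * (z ^ (- (p - 1)) - q ^ (p - 1) * z ^ (p - 1)).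
Proof.
move=> z0 pn; rewrite -!(@cheb_newton z n) //; try lia.
set S := \sum_(_ < _) _; set S1 := \sum_(_ < _) _.
set S0 := \sum_(_ < _) _; set S2 := \sum_(_ < _) _.
have -> : S = S1 - (1 + q * y) * S0 + q * y * S2.
  rewrite /S /S1 /S0 /S2 !mulr_sumr -sumrB -big_split; apply: eq_bigr => j _ /=.
  by rewrite /newton_co; ring.
by ring.
Qed.

End NewtonBasis.

(* The coefficient of E^i of the monic non-commutative C-polynomial of K_p:   *)
(* here n + i = N - j with N = n + |p| and j = |p| - i, so that y = q^N is    *)
(* q^|p| Q, and the products are the ratio of the prefactors of Masbaum's sum *)
(* at N and at n + i. *)
Definition cJ (K : fieldType) (p : int) (q Q : K) (i : nat) : K :=
  if (i < `|p|)%N then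
    (q ^+ `|p| * Q) ^ p * newton_co q (q ^+ `|p| * Q) p (`|p| - i)
    * \prod_(i.+1 <= s < `|p|) (1 - q ^+ s * Q)
    * \prod_(i <= s < `|p|) (- (q ^+ s.+2 * Q))
  else (i == `|p|%N)%:R.

(** * Telescoping of Masbaum's sum *)

Section CyclotomicRecursion.

Variables (F : fieldType) (q : F).
Hypotheses (q_neq0 : q != 0) (q_pow_neq1 : forall n, (0 < n)%N -> 1 - q ^+ n != 0).

Definition qpoch_gen (m : nat) : F := \prod_(1 <= i < m.+1) (1 - q ^+ i).

Definition cyclotomic (p : int) (n : nat) : F :=
  \sum_(0 <= k < n.+1)
     q ^ (Posz (n * (n + 3))./2 + p * Posz (k * k.+1) + Posz (k * k.-1)./2)
     * (-1) ^+ (n + k + 1)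
     * ((q ^+ (2 * k + 1) - 1) * qpoch_gen n)
     / (qpoch_gen (n + k + 1) * qpoch_gen (n - k)).

Lemma qpoch_genS n : qpoch_gen n.+1 = qpoch_gen n * (1 - q ^+ n.+1).
Proof. by rewrite /qpoch_gen big_nat_recr. Qed.

Lemma qpoch_gen0 : qpoch_gen 0 = 1.
Proof. by rewrite /qpoch_gen big_geq. Qed.

Lemma qpoch_gen_neq0 n : qpoch_gen n != 0.
Proof.
by elim: n => [|n IH]; [rewrite qpoch_gen0 oner_neq0 | rewrite qpoch_genS mulf_neq0 ?q_pow_neq1].
Qed.

Variable p : int.

Definition masbaum_weight (k : nat) : F :=
  (- 1) ^+ k * q ^ (p * Posz (k * k.+1)) * q ^+ (k * k.-1)./2.

Definition masbaum (n : nat) : F :=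
  \sum_(k < n.+1) masbaum_weight k * (1 - q ^+ (2 * k + 1))
                  / (qpoch_gen (n + k + 1) * qpoch_gen (n - k)).

Definition framing (n : nat) : F := (- 1) ^+ n * q ^+ (n * (n + 3))./2.

Lemma cyclotomic_masbaum n : cyclotomic p n = framing n * qpoch_gen n * masbaum n.
Proof.
rewrite /cyclotomic big_mkord mulr_sumr; apply: eq_bigr => k _.
rewrite !expfzDr ?q_neq0 // -!exprnP addn1 exprS exprD /framing /masbaum_weight.
move: (q ^+ (n * _)./2) (q ^+ (k * _)./2) (q ^ _) ((- 1) ^+ n) ((- 1) ^+ k) => a b c d e.
by rewrite !mulrA; congr (_ / _); ring.
Qed.

Lemma framingS n : framing n.+1 = framing n * - q ^+ n.+2.
Proof.
rewrite /framing exprS; have -> : (n.+1 * (n.+1 + 3))./2 = ((n * (n + 3))./2 + n.+2)%N.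
  have -> : (n.+1 * (n.+1 + 3) = (n.+2).*2 + n * (n + 3))%N by lia.
  by move: (n * (n + 3))%N => c; lia.
by rewrite exprD; ring.
Qed.

Lemma framing_prod n i m : (i <= m)%N ->
  framing (n + m) = framing (n + i) * \prod_(i <= s < m) - (q ^+ s.+2 * q ^+ n).
Proof.
elim: m => [|m IH]; first by rewrite leqn0 => /eqP ->; rewrite big_geq // mulr1.
rewrite leq_eqVlt => /predU1P[->|im]; first by rewrite big_geq // mulr1.
rewrite big_nat_recr //= mulrA -IH // addnS framingS -exprD.
by congr (_ * - _ ^+ _); lia.
Qed.

Lemma qpoch_gen_prod n i m : (i <= m)%N ->
  qpoch_gen (n + m) = qpoch_gen (n + i) * \prod_(i.+1 <= s < m.+1) (1 - q ^+ s * q ^+ n).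
Proof.
elim: m => [|m IH]; first by rewrite leqn0 => /eqP ->; rewrite big_geq // mulr1.
rewrite leq_eqVlt => /predU1P[->|im]; first by rewrite big_geq // mulr1.
by rewrite big_nat_recr //= mulrA -IH // addnS qpoch_genS -exprD addSn [(m + n)%N]addnC.
Qed.

(** The basis element cancels the top j factors of both q-Pochhammer symbols, turning the
    denominator at N into the one at N - j. *)
Lemma newton_basis_q N k j : (k + j <= N)%N ->
  newton_basis q (q ^+ N) ((q ^+ k)^-1 + q * q ^+ k) j
    / (qpoch_gen (N + k + 1) * qpoch_gen (N - k))
  = (qpoch_gen (N - j + k + 1) * qpoch_gen (N - j - k))^-1.
Proof.
rewrite /newton_basis; elim: j => [|j IH] kj; first by rewrite big_ord0 subn0 mul1r.
rewrite big_ord_recr /= mulrAC IH; last by lia.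
have -> : (N - j + k + 1 = (N - j.+1 + k + 1).+1)%N by lia.
have -> : (N - j - k = (N - j.+1 - k).+1)%N by lia.
rewrite !qpoch_genS; have [kq0 jq0] := (expf_neq0 k q_neq0, expf_neq0 j q_neq0).
have e1 : q ^+ (N - j.+1 + k + 1).+1 = q * node q (q ^+ N) j * q ^+ k.
  rewrite /node -{2}(_ : N - j + j = N)%N ?exprD ?mulfK //; last by lia.
  by rewrite -exprS -exprD; congr (_ ^+ _); lia.
have e2 : q ^+ (N - j.+1 - k).+1 = node q (q ^+ N) j / q ^+ k.
  rewrite /node -{2}(_ : (N - j.+1 - k).+1 + k + j = N)%N ?exprD ?mulfK ?mulfK //.
  by lia.
have n1 := @q_pow_neq1 (N - j.+1 + k + 1).+1 isT.
have n2 := @q_pow_neq1 (N - j.+1 - k).+1 isT.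
move: n1 n2; rewrite e1 e2.
move: (node _ _ _) (qpoch_gen_neq0 (N - j.+1 + k + 1)) (qpoch_gen_neq0 (N - j.+1 - k)).
move: (qpoch_gen _) (qpoch_gen _) (q ^+ k) kq0 => a b z z0 t a0 b0 n1 n2.
have n2' : z - t != 0.
  by apply: contra_neq n2 => /eqP; rewrite subr_eq0 => /eqP <-; rewrite divff ?subrr.
by field; rewrite a0 b0 z0 n1 n2'.
Qed.

(** The factor with s = N - k vanishes. This matches the absence of the k-th term from the sum at N
    - j. *)
Lemma newton_basis_q0 N k j : (k <= N < k + j)%N ->
  newton_basis q (q ^+ N) ((q ^+ k)^-1 + q * q ^+ k) j = 0.
Proof.
move=> /andP[kN Nkj]; have sj : (N - k < j)%N by lia.
rewrite /newton_basis (bigD1 (Ordinal sj)) //= /node.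
have -> : q ^+ N / q ^+ (N - k) = q ^+ k.
  by rewrite -{1}(subnK kN) exprD mulrAC mulfV ?mul1r // expf_neq0 ?q_neq0.
have := expf_neq0 k q_neq0; move: (q ^+ k) => z z0.
by rewrite (_ : 1 + _ - _ = 0) ?mul0r //; field.
Qed.

(** The telescoping certificate. It vanishes at both ends, k = 0 and k = N + 1, through its two
    factors of the form 1 - q^i. *)
Definition newton_tele (N k : nat) : F :=
  (- 1) ^+ k * q ^ (p * Posz (k * k)) * q ^+ (k * k.-1)./2
  * (1 - q ^+ k) * (1 - q ^+ (N.+1 - k)) / (qpoch_gen (N + k) * qpoch_gen (N.+1 - k)).

Lemma newton_tele_step N k (n := `|p|.+1) : (k <= N)%N ->
  masbaum_weight k * (1 - q ^+ (2 * k + 1)) / (qpoch_gen (N + k + 1) * qpoch_gen (N - k))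
  * \sum_(j < n.+1) newton_co q (q ^+ N) p j
       * newton_basis q (q ^+ N) ((q ^+ k)^-1 + q * q ^+ k) j
  = newton_tele N k - newton_tele N k.+1.
Proof.
move=> kN; have kq0 := expf_neq0 k q_neq0.
have := @newton_co_expansion _ q (q ^+ N) q_neq0
  (expf_neq0 N q_neq0) (q ^+ k) n p kq0 (leqnn _).
set S := \sum_(_ < _) _ => SE.
have e0 : 1 - q ^+ (2 * k + 1) = q ^+ k * ((q ^+ k)^-1 - q * q ^+ k).
  by rewrite mulrBr divff // addn1 exprS mul2n -addnn exprD; ring.
have -> : masbaum_weight k * (1 - q ^+ (2 * k + 1))
      / (qpoch_gen (N + k + 1) * qpoch_gen (N - k)) * S
  = masbaum_weight k * q ^+ k * (((q ^+ k)^-1 - q * q ^+ k) * S)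
      / (qpoch_gen (N + k + 1) * qpoch_gen (N - k)).
  by rewrite e0; ring.
rewrite {}SE; set P := (q ^+ k) ^ p; set P' := q ^ p.
have P0 : P != 0 by rewrite expfz_neq0.
have P'0 : P' != 0 by rewrite expfz_neq0.
rewrite !opprD !opprK !expfzDr ?q_neq0 // -!invr_expz ?expr1z -/P -/P'.
have w1 : masbaum_weight k = (- 1) ^+ k * q ^ (p * Posz (k * k)) * q ^+ (k * k.-1)./2 * P.
  rewrite /masbaum_weight /P mulnS PoszD mulrDr expfzDr ?q_neq0 //.
  rewrite [p * Posz k]mulrC -[q ^ (Posz k * p)]exprz_exp -exprnP.
  by ring.
have t1 : newton_tele N k.+1 = - ((- 1) ^+ k * q ^ (p * Posz (k * k)) * q ^+ (k * k.-1)./2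
    * P ^+ 2 * P' * q ^+ k) * (1 - q * q ^+ k) * (1 - q ^+ (N - k))
    / (qpoch_gen (N + k + 1) * qpoch_gen (N - k)).
  rewrite /newton_tele subSS addn1 addnS; congr (_ / _); rewrite exprS.
  have -> : (k.+1 * k.+1.-1)./2 = ((k * k.-1)./2 + k)%N.
    have -> : (k.+1 * k.+1.-1 = k.*2 + k * k.-1)%N by case: k {kq0 e0 w1 P P0 kN S} => //= k; lia.
    by move: (k * k.-1)%N => u; lia.
  have -> : q ^ (p * Posz (k.+1 * k.+1)) = q ^ (p * Posz (k * k)) * P ^+ 2 * P'.
    have -> : p * Posz (k.+1 * k.+1) = p * Posz (k * k) + Posz k * p + Posz k * p + p by lia.
    have qkp : q ^ (Posz k * p) = P by rewrite -exprz_exp -exprnP.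
    by rewrite !expfzDr // !qkp expr2 !mulrA.
  rewrite exprD [q ^+ k.+1]exprS.
  generalize P P' (q ^ (p * Posz (k * k))) (q ^+ (k * k.-1)./2) (q ^+ k)
    (q ^+ (N - k)) ((- 1) ^+ k : F) => c d e f g h i.
  by ring.
have eN : q ^+ (N - k) = q ^+ N / q ^+ k.
  by rewrite -{2}(subnK kN) exprD mulfK.
have eN1 : q ^+ (N.+1 - k) = q * q ^+ N / q ^+ k by rewrite subSn // exprS eN mulrA.
rewrite t1 w1 /newton_tele subSn // addn1 !qpoch_genS -subSn // eN1 eN.
have -> : q ^+ (N + k).+1 = q * q ^+ N * q ^+ k by rewrite exprS exprD mulrA.
have n1 : 1 - q * q ^+ N * q ^+ k != 0.
  by rewrite -exprS -exprD q_pow_neq1.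
have n2 : q ^+ k - q * q ^+ N != 0.
  have := @q_pow_neq1 (N.+1 - k); rewrite subn_gt0 ltnS kN eN1 => /(_ isT).
  by apply: contra_neq => /eqP; rewrite subr_eq0 => /eqP <-; rewrite divff ?subrr.
have kq1 : q ^+ k != 0 by exact: kq0.
move: (qpoch_gen_neq0 (N + k)) (qpoch_gen_neq0 (N - k)) (q_neq0) n1 n2 kq1 P0 P'0.
move: (qpoch_gen _) (qpoch_gen _) ((- 1) ^+ k) (q ^ (_ * _)) (q ^+ (_ * _)./2) => a b c d e.
generalize (q ^+ k) (q ^+ N) P P' => z y u v a0 b0 r0 n1 n2 z0 u0 v0.
by field; rewrite ?a0 ?b0 ?r0 ?n1 ?n2 ?z0 ?u0 ?v0.
Qed.

Lemma masbaum_rec n (m := `|p|%N) :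
  \sum_(j < m.+1) newton_co q (q ^+ (n + m)) p j * masbaum (n + m - j) = 0.
Proof.
set N := (n + m)%N.
have -> : \sum_(j < m.+1) newton_co q (q ^+ N) p j * masbaum (N - j) =
  \sum_(j < m.+1) \sum_(k < N.+1) masbaum_weight k * (1 - q ^+ (2 * k + 1)) /
     (qpoch_gen (N + k + 1) * qpoch_gen (N - k)) *
     (newton_co q (q ^+ N) p j * newton_basis q (q ^+ N) ((q ^+ k)^-1 + q * q ^+ k) j).
  apply: eq_bigr => j _; rewrite /masbaum mulr_sumr.
  rewrite (big_ord_widen N.+1 (fun k => newton_co q (q ^+ N) p j
    * (masbaum_weight k * (1 - q ^+ (2 * k + 1)) /
     (qpoch_gen (N - j + k + 1) * qpoch_gen (N - j - k))))); last by lia.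
  rewrite big_mkcond; apply: eq_bigr => k _; have kN : (k <= N)%N by rewrite -ltnS.
  have jm : (j <= m)%N by rewrite -ltnS.
  case: ifPn => kj; last by rewrite newton_basis_q0 ?mulr0 //; lia.
  by rewrite -newton_basis_q; [ring|lia].
rewrite exchange_big /=.
have -> : \sum_(k < N.+1) \sum_(j < m.+1) masbaum_weight k * (1 - q ^+ (2 * k + 1)) /
     (qpoch_gen (N + k + 1) * qpoch_gen (N - k)) *
     (newton_co q (q ^+ N) p j * newton_basis q (q ^+ N) ((q ^+ k)^-1 + q * q ^+ k) j)
  = \sum_(k < N.+1) (newton_tele N k - newton_tele N k.+1).
  apply: eq_bigr => k _; rewrite -mulr_sumr -newton_tele_step; last by rewrite -ltnS.
  congr (_ * _); rewrite [RHS]big_ord_recr /=.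
  by rewrite (@newton_co_small _ q (q ^+ N) p m.+1) // mul0r addr0.
rewrite -(big_mkord xpredT (fun k => newton_tele N k - newton_tele N k.+1)).
rewrite (@telescope_sumr_eq _ 0 N.+1 (fun k => - newton_tele N k)) //; last first.
  by move=> k _; rewrite opprK addrC.
by rewrite /newton_tele subnn expr0 subrr !(mulr0, mul0r) oppr0 subrr.
Qed.

(** This is [masbaum_rec] with the prefactors restored. Dividing by 1 - q^(n+|p|) would make it
    monic; the factor is kept because it vanishes when n + |p| = 0. *)
Lemma cyclotomic_rec n : (1 - q ^+ (n + `|p|)) *
  \sum_(i < `|p|.+1) cJ p q (q ^+ n) i * cyclotomic p (n + i) = 0.
Proof.
set m := `|p|%N; set N := (n + m)%N.
have yE : q ^+ m * q ^+ n = q ^+ N by rewrite -exprD addnC.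
have y0 : q ^+ N != 0 by rewrite expf_neq0 ?q_neq0.
have step i : (i <= m)%N -> (1 - q ^+ N) * (cJ p q (q ^+ n) i * cyclotomic p (n + i)) =
    (q ^+ N) ^ p * framing N * qpoch_gen N
    * (newton_co q (q ^+ N) p (m - i) * masbaum (n + i)).
  move=> im; rewrite cyclotomic_masbaum /cJ -/m yE.
  have [lt_im|] := ltnP i m; last first.
    move=> mi; have -> : i = m by apply/eqP; rewrite eqn_leq im.
    rewrite eqxx mulr1n subnn newton_co0 ?q_neq0 // -/N.
    rewrite -invr_expz; have := expfz_neq0 p y0; move: (_ ^ p) => u u0.
    by field.
  rewrite /N (framing_prod _ im) (qpoch_gen_prod _ im) -/N.
  rewrite [\prod_(i.+1 <= s < m.+1) _]big_nat_recr //= yE.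
  by ring.
rewrite mulr_sumr (eq_bigr (fun i : 'I_m.+1 => (q ^+ N) ^ p * framing N * qpoch_gen N *
   (newton_co q (q ^+ N) p (m - i) * masbaum (n + i))));
  last by move=> i _; apply: step; rewrite -ltnS.
rewrite -mulr_sumr (reindex_inj rev_ord_inj) /= (eq_bigr (fun j : 'I_m.+1 =>
   newton_co q (q ^+ N) p j * masbaum (N - j))) ?masbaum_rec ?mulr0 //.
move=> j _; have jm : (j <= m)%N by rewrite -ltnS.
by congr (newton_co _ _ _ _ * masbaum _); lia.
Qed.

Lemma cyclotomic0 : cyclotomic p 0 = 1.
Proof.
rewrite cyclotomic_masbaum /masbaum big_ord1 /framing /masbaum_weight /= mulr0 expr0z !mul1r.
have -> : (0 + 0 + 1 = 1)%N by [].
rewrite subnn qpoch_genS qpoch_gen0 !mulr1 !mul1r.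
by rewrite divff // q_pow_neq1.
Qed.

End CyclotomicRecursion.

(** * Laurent polynomials *)

Section Eval2.

Variable F : fieldType.
Implicit Types (N : {poly {poly int}}) (z : F * F).

Lemma eval2D N N' z : eval2 (N + N') z = eval2 N z + eval2 N' z.
Proof. by rewrite /eval2 rmorphD !hornerD. Qed.
Lemma eval2N N z : eval2 (- N) z = - eval2 N z.
Proof. by rewrite /eval2 rmorphN !hornerN. Qed.
Lemma eval2M N N' z : eval2 (N * N') z = eval2 N z * eval2 N' z.
Proof. by rewrite /eval2 rmorphM !hornerM. Qed.
Lemma eval20 z : eval2 0 z = 0.
Proof. by rewrite /eval2 rmorph0 !horner0. Qed.
Lemma eval21 z : eval2 1 z = 1.
Proof. by rewrite /eval2 rmorph1 !hornerC. Qed.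
Lemma eval2X z : eval2 'X z = z.1.
Proof. by rewrite /eval2 map_polyX hornerX hornerC. Qed.
Lemma eval2C (c : {poly int}) z : eval2 c%:P z = (map_poly intr c).[z.2].
Proof. by rewrite /eval2 map_polyC hornerC. Qed.
Lemma eval2Xn N n z : eval2 (N ^+ n) z = eval2 N z ^+ n.
Proof. by elim: n => [|n IH]; rewrite ?expr0 ?eval21 // !exprS eval2M IH. Qed.

Lemma eval2_sum (I : Type) (r : seq I) (P : pred I) (E : I -> {poly {poly int}}) z :
  eval2 (\sum_(i <- r | P i) E i) z = \sum_(i <- r | P i) eval2 (E i) z.
Proof. exact: (big_morph (fun N => eval2 N z) (fun N N' => eval2D N N' z) (eval20 z)). Qed.

End Eval2.

Definition family := forall F : fieldType, F -> F -> F.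

(* A family given on every field by the same Laurent polynomial in (q, Q); in *)
(* the numerator the outer variable is Q. *)
Definition laurent (f : family) := exists (a b : nat) (N : {poly {poly int}}),
  forall (F : fieldType) (q Q : F), q != 0 -> Q != 0 ->
    q ^+ a * Q ^+ b * f F q Q = eval2 N (Q, q).

Section Laurent.

Lemma laurent_ext (f g : family) :
    (forall (F : fieldType) (q Q : F), q != 0 -> Q != 0 -> f F q Q = g F q Q) ->
  laurent f -> laurent g.
Proof.
move=> fg [a [b [N fN]]]; exists a, b, N => F q Q q0 Q0.
by rewrite -fg // fN.
Qed.

Lemma laurent0 : laurent (fun F q Q => 0).
Proof. by exists 0, 0, 0 => F q Q q0 Q0; rewrite mulr0 eval20. Qed.

Lemma laurent_monomial (a b : int) : laurent (fun F q Q => q ^ a * Q ^ b).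
Proof.
have cast (c : int) : exists k l : nat,
    forall (F : fieldType) (x : F), x != 0 -> x ^+ k * x ^ c = x ^+ l.
  case: c => n; first by exists 0, n => F x x0; rewrite mul1r.
  by exists n.+1, 0 => F x x0; rewrite /exprz mulfV ?expf_neq0.
have [k [l ak]] := cast a; have [k' [l' bk]] := cast b.
exists k, k', ('X%:P ^+ l * 'X ^+ l') => F q Q q0 Q0.
by rewrite mulrACA ak // bk // eval2M !eval2Xn eval2X eval2C map_polyX hornerX.
Qed.

Lemma laurentM f g : laurent f -> laurent g -> laurent (fun F q Q => f F q Q * g F q Q).
Proof.
move=> [a [b [N fN]]] [a' [b' [N' gN]]]; exists (a + a')%N, (b + b')%N, (N * N').
by move=> F q Q q0 Q0; rewrite eval2M -fN // -gN // !exprD; ring.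
Qed.

Lemma laurent1 : laurent (fun F q Q => 1).
Proof.
by apply: laurent_ext (laurent_monomial 0 0) => F q Q _ _; rewrite !expr0z mulr1.
Qed.

Lemma laurentN f : laurent f -> laurent (fun F q Q => - f F q Q).
Proof.
move=> [a [b [N fN]]]; exists a, b, (- N).
by move=> F q Q q0 Q0; rewrite eval2N -fN // mulrN.
Qed.

Lemma laurentD f g : laurent f -> laurent g -> laurent (fun F q Q => f F q Q + g F q Q).
Proof.
move=> [a [b [N fN]]] [a' [b' [N' gN]]].
exists (a + a')%N, (b + b')%N, ('X%:P ^+ a' * 'X ^+ b' * N + 'X%:P ^+ a * 'X ^+ b * N').
move=> F q Q q0 Q0; rewrite eval2D !eval2M !eval2Xn eval2X eval2C map_polyX hornerX.
by rewrite -fN // -gN // !exprD; ring.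
Qed.

Lemma laurentB f g : laurent f -> laurent g -> laurent (fun F q Q => f F q Q - g F q Q).
Proof. by move=> fL gL; apply: laurentD => //; apply: laurentN. Qed.

Lemma laurent_prod (r : seq nat) (f : nat -> family) : (forall i, laurent (f i)) ->
  laurent (fun F q Q => \prod_(i <- r) f i F q Q).
Proof.
move=> fL; elim: r => [|i r IH].
  by apply: laurent_ext laurent1 => F q Q _ _; rewrite big_nil.
by apply: laurent_ext (laurentM (fL i) IH) => F q Q _ _; rewrite big_cons.
Qed.

Lemma laurent_nat (n : nat) : laurent (fun F q Q => n%:R).
Proof.
elim: n => [|n IH]; first exact: laurent0.
by apply: laurent_ext (laurentD laurent1 IH) => F q Q _ _; rewrite mulrS.
Qed.

Variable m : nat.
Let y (F : fieldType) (q Q : F) := q ^+ m * Q.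

Lemma laurent_y (c d : int) : laurent (fun F q Q => q ^ c * y q Q ^ d).
Proof.
apply: laurent_ext (laurent_monomial (c + Posz m * d) d) => F q Q q0 Q0.
by rewrite /y expfzDr // -exprz_exp -exprnP exprzMl ?unitfE ?expf_neq0 // mulrA.
Qed.

Lemma laurent_node s : laurent (fun F q Q => node q (y q Q) s).
Proof.
apply: laurent_ext (laurent_y (- Posz s) 1) => F q Q q0 Q0.
by rewrite /node -invr_expz -exprnP expr1z mulrC.
Qed.

Lemma laurent_nodeV s : laurent (fun F q Q => (node q (y q Q) s)^-1).
Proof.
apply: laurent_ext (laurent_y (Posz s) (- 1)) => F q Q q0 Q0.
by rewrite /node -exprnP exprN1 invf_div.
Qed.

Lemma laurent_q (c : int) : laurent (fun F q Q => q ^ c).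
Proof.
by apply: laurent_ext (laurent_monomial c 0) => F q Q _ _; rewrite expr0z mulr1.
Qed.

Lemma laurent_qn (c : nat) : laurent (fun F q Q => q ^+ c).
Proof. exact: (laurent_q c). Qed.

Lemma laurent_cheb_nat n j : laurent (fun F q Q => cheb_nat q (y q Q) n j).
Proof.
suff H : forall n, (forall j, laurent (fun F q Q => cheb_nat q (y q Q) n j)) /\
     (forall j, laurent (fun F q Q => cheb_nat q (y q Q) n.+1 j)) by have [] := H n.
elim=> [|k [IH0 IH1]]; first by split=> i; [apply: laurent0 | apply: laurent_nat].
split=> // i; apply: laurentB; last exact: laurentM (laurent_q 1) (IH0 i).
apply: laurentB; last first.
  case: i => [|i]; first exact: laurent0.
  exact: laurentM (laurent_nodeV i) (IH1 i).
apply: laurentM (IH1 i); apply: laurentD (laurent_nodeV i) _.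
exact: laurentM (laurent_q 1) (laurent_node i).
Qed.

Lemma laurent_cheb p j : laurent (fun F q Q => cheb q (y q Q) p j).
Proof.
case: p => n; first exact: laurent_cheb_nat.
apply: laurentM (laurent_cheb_nat _ _); apply: laurentN.
by apply: laurent_ext (laurent_q (Negz n)) => F q Q _ _.
Qed.

Lemma laurent_newton_co p j : laurent (fun F q Q => newton_co q (y q Q) p j).
Proof.
have Ly : laurent (fun F q Q => q * y q Q).
  by apply: laurent_ext (laurent_y 1 1) => F q Q _ _; rewrite !expr1z.
apply: laurentD; last exact: laurentM Ly (laurent_cheb _ _).
apply: laurentB; first exact: laurent_cheb.
exact: laurentM (laurentD laurent1 Ly) (laurent_cheb _ _).
Qed.

End Laurent.

Lemma laurent_cJ p i : laurent (fun F q Q => cJ p q Q i).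
Proof.
rewrite /cJ; case: (i < `|p|)%N; last exact: laurent_nat.
have LQ : laurent (fun F q Q => Q).
  by apply: laurent_ext (laurent_monomial 0 1) => F q Q _ _; rewrite expr1z mul1r.
apply: laurentM; last first.
  apply: (laurent_prod _ (f := fun s F q Q => - (q ^+ s.+2 * Q))) => s.
  exact: laurentN (laurentM (laurent_qn _) LQ).
apply: laurentM; last first.
  apply: (laurent_prod _ (f := fun s F q Q => 1 - q ^+ s * Q)) => s.
  exact: laurentB laurent1 (laurentM (laurent_qn _) LQ).
apply: laurentM (laurent_newton_co _ _ _).
by apply: laurent_ext (laurent_y `|p| 0 p) => F q Q _ _; rewrite expr0z mul1r.
Qed.

(** One monomial denominator for all coefficients, with integer numerators independent of the field,
    so that the same data serve generic q and q = 1. *)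
Lemma cJ_numerators p : exists (a b : nat) (N : nat -> {poly {poly int}}),
  forall i (F : fieldType) (q Q : F), q != 0 -> Q != 0 ->
    q ^+ a * Q ^+ b * cJ p q Q i = eval2 (N i) (Q, q).
Proof.
suff H n : exists (a b : nat) (N : nat -> {poly {poly int}}),
    forall i (F : fieldType) (q Q : F), (i < n)%N -> q != 0 -> Q != 0 ->
    q ^+ a * Q ^+ b * cJ p q Q i = eval2 (N i) (Q, q).
  have [a [b [N numE]]] := H `|p|.+1; exists a, b, (fun i => if (i < `|p|.+1)%N then N i else 0).
  move=> i F q Q q0 Q0; case: ifPn => [ip|]; first exact: numE.
  rewrite -leqNgt => pi; rewrite /cJ ltnNge ltnW //= eqn_leq (leqNgt i) pi /=.
  by rewrite mulr0 eval20.
elim: n => [|n [a [b [N numE]]]]; first by exists 0, 0, (fun=> 0).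
have [a' [b' [N' NE']]] := laurent_cJ p n.
exists (a + a')%N, (b + b')%N, (fun i => if i == n then 'X%:P ^+ a * 'X ^+ b * N'
  else 'X%:P ^+ a' * 'X ^+ b' * N i) => i F q Q; rewrite ltnS => le_in q0 Q0.
have [->|i_n] := eqVneq i n.
  by rewrite !eval2M !eval2Xn eval2X eval2C map_polyX hornerX -NE' // !exprD; ring.
rewrite !eval2M !eval2Xn eval2X eval2C map_polyX hornerX -numE ?ltn_neqAle ?i_n //.
by rewrite !exprD; ring.
Qed.

(** * Irreducibility at q = 1 *)

Section Descent.

Variable k : fieldType.
Implicit Types (a b : {poly k}) (r : nat -> {poly k}).

(** All summands but the first are divisible by a, so a divides r_0, whose degree is smaller; then a
    is cancelled. *)
Lemma coprime_descent a b D r : coprimep a b -> a != 0 ->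
    (forall l, (size (r l) < size a)%N) ->
    \sum_(l < D) a ^+ l * b ^+ (D.-1 - l) * r l = 0 ->
  forall l, (l < D)%N -> r l = 0.
Proof.
move=> ab a0; elim: D r => [//|D IH] r rs; rewrite big_ord_recl expr0 mul1r subn0 /=.
have -> : \sum_(i < D) a ^+ (bump 0 i) * b ^+ (D - bump 0 i) * r (bump 0 i)
   = a * \sum_(i < D) a ^+ i * b ^+ (D.-1 - i) * r i.+1.
  rewrite mulr_sumr; apply: eq_bigr => i _; rewrite /bump add1n exprS.
  by rewrite -!mulrA; congr (_ * (_ * (b ^+ _ * _))); have := ltn_ord i; lia.
move=> e; have r0 : r 0%N = 0.
  apply/eqP; apply: contraT => r0; have : a %| b ^+ D * r 0%N.
    by move/eqP: e; rewrite addr_eq0 => /eqP ->; rewrite dvdpNr dvdp_mulr.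
  rewrite Gauss_dvdpr ?coprimep_expr //.
  by move/(dvdp_leq r0); rewrite leqNgt rs.
move: e; rewrite r0 mulr0 add0r => /eqP; rewrite mulf_eq0 (negPf a0) => /eqP e.
by case=> [//|l]; rewrite ltnS => lD; exact: (IH (fun i => r i.+1) (fun i => rs i.+1) e l lD).
Qed.

Lemma coprime_descent_rev a b D r : coprimep a b -> b != 0 ->
    (forall l, (size (r l) < size b)%N) ->
    \sum_(l < D) a ^+ l * b ^+ (D.-1 - l) * r l = 0 ->
  forall l, (l < D)%N -> r l = 0.
Proof.
move=> ab b0 rs e l lD.
have -> : r l = (fun i => r (D.-1 - i)%N) (D.-1 - l)%N by congr r; lia.
apply: (@coprime_descent b a D (fun i => r (D.-1 - i)%N)) => //; [by rewrite coprimep_sym| |lia].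
rewrite -[RHS]e (reindex_inj rev_ord_inj) /=; apply: eq_bigr => i _.
have := ltn_ord i => iD; rewrite [_ * b ^+ _]mulrC.
have -> : (D - i.+1 = D.-1 - i)%N by lia.
by have -> : (D.-1 - (D.-1 - i) = i)%N by lia.
Qed.

End Descent.

Section GenericPoint.

Variables (k : fieldType) (a b : {poly k}).
Hypotheses (ab : coprimep a b) (a0 : a != 0) (b0 : b != 0).

Variables (Fx : fieldType) (fr : {rmorphism {poly k} -> Fx}).
Hypothesis fr_inj : injective fr.

Let Qx : Fx := fr a / fr b.
Let psi (c : {poly k}) : Fx := (map_poly (fun u : k => fr u%:P) c).[Qx].

Let fr0 c : (fr c == 0) = (c == 0). Proof. exact: raddf_eq0. Qed.

Lemma psi_denominator D (c : {poly k}) : (size c <= D.+1)%N ->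
  fr b ^+ D * psi c = fr (\sum_(l < D.+1) c`_l *: (a ^+ l * b ^+ (D - l))).
Proof.
move=> cD; rewrite /psi (@horner_coef_wide _ D.+1); last first.
  by rewrite (leq_trans (size_poly _ _)).
rewrite rmorph_sum mulr_sumr; apply: eq_bigr => l _.
rewrite coef_map_id0 ?polyC0 ?rmorph0 //= -mul_polyC rmorphM mulrCA; congr (_ * _).
rewrite rmorphM !rmorphXn /Qx expr_div_n -{1}(subnK (_ : l <= D)%N) -1?ltnS // exprD.
have := b0; rewrite -fr0 => b0'; have := expf_neq0 l b0'.
by move: (_ ^+ l) (_ ^+ l) (_ ^+ (D - l)) => u v w u0; field.
Qed.

(** Clearing the powers of b turns the relation between Q = a/b and x into the homogeneous sum of
    [coprime_descent], whose coefficients have x-degree below that of a or of b. *)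
Lemma generic_point_free (H : {poly {poly k}}) (m : nat) :
    (m < size a)%N || (m < size b)%N -> (size H <= m)%N ->
    \sum_(j < size H) psi H`_j * fr 'X ^+ j = 0 -> H = 0.
Proof.
move=> mab Hm e; pose D := \max_(j < size H) size (H`_j)%R.
have HD j : (size (H`_j)%R <= D.+1)%N.
  have [jH|jH] := ltnP j (size H); last by rewrite nth_default ?size_poly0.
  by rewrite ltnW // ltnS (leq_bigmax (Ordinal jH)).
pose r l := \poly_(j < size H) H`_j`_l.
have rs l : (size (r l) <= m)%N by rewrite (leq_trans (size_poly _ _)).
have sum0 : \sum_(l < D.+1) a ^+ l * b ^+ (D.+1.-1 - l) * r l = 0.
  apply/eqP; rewrite -fr0; apply/eqP; rewrite -[RHS](mulr0 (fr b ^+ D)) -e mulr_sumr.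
  under [RHS]eq_bigr do rewrite mulrA psi_denominator //.
  under [RHS]eq_bigr do rewrite -rmorphXn -rmorphM.
  rewrite -rmorph_sum; congr (fr _).
  under [RHS]eq_bigr do rewrite mulr_suml.
  rewrite exchange_big /=; apply: eq_bigr => l _; rewrite /r poly_def mulr_sumr.
  by apply: eq_bigr => j _; rewrite -scalerAl -scalerAr.
have r0 l : (l < D.+1)%N -> r l = 0.
  case/orP: mab => mab.
    by apply: coprime_descent sum0 l => // i; rewrite (leq_ltn_trans (rs i)).
  by apply: coprime_descent_rev sum0 l => // i; rewrite (leq_ltn_trans (rs i)).
apply/polyP => j; rewrite coef0; apply/polyP => l; rewrite coef0.
have [lD|lD] := ltnP l D.+1; last by rewrite nth_default // (leq_trans (HD j)).
have [jH|jH] := ltnP j (size H); last by rewrite [H`_j]nth_default // coef0.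
by have := congr1 (fun u : {poly k} => u`_j) (r0 l lD); rewrite coef_poly jH coef0.
Qed.

End GenericPoint.

(** * The recursion at q = 1 *)

Section ClassicalLimit.

Variables (F : fieldType) (Q : F).
Hypothesis Q0 : Q != 0.

(* The coefficient of E^j in Gam p E Q; for j = 0 the factor 1 - Q of         *)
(* newton_co 1 Q p 0 is divided out. *)
Definition Gam_co (p : int) (j : nat) : F :=
  if j is j'.+1 then (1 - Q) ^+ j' * (- Q) ^+ j * newton_co 1 Q p j else Q ^ (- p).

(** At q = 1 the factors of each product coincide, giving powers of 1 - Q and of -Q. *)
Lemma cJ_at1 p j : (j <= `|p|)%N -> cJ p 1 Q (`|p| - j) = Q ^ p * Gam_co p j.
Proof.
rewrite /cJ !expr1n !mul1r; case: j => [|j] jp.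
  by rewrite subn0 ltnn eqxx /Gam_co -expfzDr // subrr.
rewrite ifT; last by lia.
have -> : (`|p| - (`|p| - j.+1) = j.+1)%N by lia.
under eq_bigr do rewrite expr1n mul1r.
rewrite prodr_const_nat; under eq_bigr do rewrite expr1n mul1r.
rewrite prodr_const_nat /Gam_co.
have -> : (`|p| - (`|p| - j.+1) = j.+1)%N by lia.
have -> : (`|p| - (`|p| - j.+1).+1 = j)%N by lia.
by ring.
Qed.

Lemma Gam_co_small p j : (`|p| < j)%N -> Gam_co p j = 0.
Proof. by case: j => [//|j] pj; rewrite /Gam_co newton_co_small // mulr0. Qed.

Lemma Gam_co_rec p j : Gam_co (p + 1) j = (Q + Q^-1) * Gam_co p j
  + (if j is j'.+1 then (1 - Q) * Gam_co p j' else 0) - Gam_co (p - 1) j.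
Proof.
have nodeE s : node 1 Q s = Q by rewrite /node expr1n divr1.
case: j => [|j].
  rewrite /Gam_co !opprD opprK !expfzDr // expr1z exprN1 addr0.
  by move: (Q ^ _) => u; field.
rewrite {1}/Gam_co newton_co_rec ?oner_neq0 // /mulX_newton_co !nodeE !mul1r.
case: j => [|j].
  rewrite newton_co0 ?oner_neq0 // /Gam_co !expr0 !mul1r !expr1.
  by move: (Q ^ _) => u; field.
rewrite /Gam_co [(1 - Q) ^+ j.+1]exprS [(- Q) ^+ j.+2]exprS.
by move: (_ ^+ j) (_ ^+ j.+1) => u v; field.
Qed.

(** At q = 1 all Newton nodes equal Q, so the coefficient recursion is multiplication by x; the
    values at p = 0 and p = 1 agree. *)
Lemma sum_Gam_co p E : \sum_(j < `|p|.+1) Gam_co p j * E ^+ j = Gam p E Q.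
Proof.
pose S k : F := \sum_(j < `|k|%N.+1) Gam_co k j * E ^+ j.
have SE k n : (`|k| < n)%N -> S k = \sum_(j < n) Gam_co k j * E ^+ j.
  move=> kn; rewrite /S (big_ord_widen n (fun j => Gam_co k j * E ^+ j)) //.
  rewrite big_mkcond; apply: eq_bigr => j _; case: ifPn => //.
  by rewrite -leqNgt => kj; rewrite Gam_co_small // mul0r.
rewrite -/(S p) /Gam.
have S0 : S 0 = 1 by rewrite /S big_ord1 /Gam_co oppr0 expr0z expr0 mulr1.
have S1 : S 1 = E + Q^-1.
  rewrite /S big_ord_recr big_ord1 /Gam_co /=.
  rewrite /newton_co subrr /= /mulX_newton_co /node !expr1n !expr0.
  have -> : (1%N == 0%N)%:R = 0 :> F by [].
  have -> : (0%N == 0%N)%:R = 1 :> F by [].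
  by rewrite exprN1 divr1; field.
rewrite -S1; apply: gam_unique => // k.
have [n kn] : exists n, (`|k|.+1 < n)%N by exists `|k|.+2.
rewrite (SE (k + 1) n.+1) 1?(SE k n) 1?(SE (k - 1) n.+1); try lia.
under eq_bigr do rewrite Gam_co_rec mulrBl mulrDl.
rewrite sumrB big_split /=; congr (_ - _).
rewrite big_ord_recr /= Gam_co_small; last by lia.
rewrite mulr0 mul0r addr0 [X in _ + X]big_ord_recl mul0r add0r.
rewrite mulr_sumr -big_split; apply: eq_bigr => j _ /=.
by rewrite /chebX exprS; ring.
Qed.

Lemma cJ_Gam p E :
  \sum_(j < `|p|.+1) cJ p 1 Q (`|p| - j) * E ^+ j = Q ^ p * Gam p E Q.
Proof.
rewrite -sum_Gam_co mulr_sumr; apply: eq_bigr => j _.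
by rewrite cJ_at1 ?mulrA // -ltnS.
Qed.

Lemma Gam_chebyshev (v : int -> F) p E :
    (forall k, v (k + 1) = chebX E Q * v k - v (k - 1)) -> v 0 = 0 -> v 1 = 1 ->
  (1 - Q) * Gam p E Q = (v (p + 1) - v p) - Q * (v p - v (p - 1)).
Proof.
move=> vr v0 v1.
apply: (@int_rec_unique F (chebX E Q) 1 (fun k => (1 - Q) * Gam k E Q)
   (fun k => (v (k + 1) - v k) - Q * (v k - v (k - 1)))) => [|k|k||].
- exact: oner_neq0.
- by rewrite /Gam gam_rec; ring.
- have e1 : k + 1 - 1 = k by lia.
  have e2 : k - 1 + 1 = k by lia.
  have := vr (k - 1); rewrite e2 (vr (k + 1)) e1 (vr k).
  by move: (v k) (v (k - 1)) (v (k - 1 - 1)) => x y z ->; ring.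
- have := vr 0; rewrite add0r v0 v1 mulr0 sub0r => /esym/eqP; rewrite eqr_oppLR => /eqP ->.
  by rewrite /Gam /=; ring.
- have -> : v (1 + 1) = chebX E Q by rewrite vr subrr v0 v1 mulr1 subr0.
  by rewrite subrr v0 v1 /Gam /= /chebX; field.
Qed.

End ClassicalLimit.

Section ChebyshevPolynomials.

Variable k : fieldType.

Definition chebp (p : int) : {poly k} :=
  match p with
  | Posz n => lucas 'X 1 0 1 n
  | Negz n => - lucas 'X 1 0 1 n.+1
  end.

Lemma chebpN n : chebp (- Posz n) = - lucas 'X 1 0 1 n.
Proof. by case: n => [|n] //; rewrite oppr0 /= oppr0. Qed.

Lemma chebp_rec p : chebp (p + 1) = 'X * chebp p - chebp (p - 1).
Proof.
case: p => [[|n]|n].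
- by rewrite add0r sub0r (chebpN 1) /= mulr0 sub0r opprK.
- have -> : Posz n.+1 + 1 = Posz n.+2 by lia.
  have -> : Posz n.+1 - 1 = Posz n by lia.
  by rewrite /chebp lucasSS mul1r.
- have -> : Negz n - 1 = - Posz n.+2 by lia.
  have -> : Negz n + 1 = - Posz n by lia.
  rewrite NegzE !chebpN lucasSS mul1r.
  by rewrite opprK mulrN addKr.
Qed.

Lemma size_lucasX n : lucas ('X : {poly k}) 1 0 1 n.+1 \is monic /\
  size (lucas ('X : {poly k}) 1 0 1 n) = n.
Proof.
elim/ltn_ind: n => -[|[|n]] IH.
- by rewrite /= monic1 size_poly0.
- by rewrite /= size_poly1 mulr0 subr0 mulr1 monicX.
have [mn1 sn1] := IH n.+1 (ltnSn _); have [mn sn] := IH n (ltnW (ltnSn _)).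
have sz : size (lucas ('X : {poly k}) 1 0 1 n.+2) = n.+2.
  rewrite lucasSS mul1r mulrC size_polyDl size_mulX ?monic_neq0 //= ?sn1 //.
  by rewrite size_polyN sn ltnW.
split=> //; rewrite lucasSS mul1r monicE lead_coefDl.
  by rewrite lead_coefM lead_coefX mul1r (monicP mn1).
by rewrite size_polyN sn1 mulrC size_mulX ?monic_neq0 // sz.
Qed.

(** A Cassini identity; it provides the Bezout relation for [coprime_chebp_up_down]. *)
Lemma chebp_cassini p : chebp p ^+ 2 - chebp (p + 1) * chebp (p - 1) = 1.
Proof.
have natP (n : nat) : chebp n ^+ 2 - chebp (Posz n + 1) * chebp (Posz n - 1) = 1.
  elim: n => [|n IH]; first by rewrite add0r sub0r (chebpN 1) /=; ring.
  have e1 : Posz n.+1 - 1 = Posz n by lia.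
  have e2 : Posz n.+1 = Posz n + 1 by lia.
  rewrite (chebp_rec n.+1) e1 e2 -[RHS]IH.
  by have := chebp_rec n; move: (chebp _) (chebp _) (chebp _) => a b c ->; ring.
case: p => n; first exact: natP.
rewrite -[RHS](natP n.+1); have -> : Negz n - 1 = - Posz n.+2 by lia.
have -> : Negz n + 1 = - Posz n by lia.
have -> : Posz n.+1 - 1 = Posz n by lia.
have -> : Posz n.+1 + 1 = Posz n.+2 by lia.
by rewrite NegzE !chebpN /chebp; ring.
Qed.

Definition chebp_up p := chebp (p + 1) - chebp p.
Definition chebp_down p := chebp p - chebp (p - 1).

Lemma coprime_chebp_up_down p : coprimep (chebp_up p) (chebp_down p).
Proof.
apply/Bezout_eq1_coprimepP; exists (chebp_down p - chebp p, chebp p) => /=.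
by rewrite -[RHS](chebp_cassini p) /chebp_up /chebp_down; ring.
Qed.

Lemma size_diff_lucas n :
  size (lucas ('X : {poly k}) 1 0 1 n.+1 - lucas 'X 1 0 1 n) = n.+1.
Proof.
have [_ sn] := size_lucasX n; have [_ sn1] := size_lucasX n.+1.
by rewrite size_polyDl ?size_polyN sn1 ?sn.
Qed.

Lemma size_chebp_up_down p : p != 0 ->
  (size (chebp_up p) = `|p|.+1 /\ size (chebp_down p) = `|p|%N) \/
  (size (chebp_up p) = `|p|%N /\ size (chebp_down p) = `|p|.+1).
Proof.
case: p => [[//|n]|n] _.
  left; rewrite /chebp_up /chebp_down; have -> : Posz n.+1 - 1 = Posz n by lia.
  have -> : Posz n.+1 + 1 = Posz n.+2 by lia.
  by rewrite /chebp !size_diff_lucas.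
right; rewrite /chebp_up /chebp_down; have -> : Negz n - 1 = - Posz n.+2 by lia.
have -> : Negz n + 1 = - Posz n by lia.
rewrite NegzE !chebpN !opprK ![- _ + _]addrC !size_diff_lucas.
by split; rewrite //; lia.
Qed.

End ChebyshevPolynomials.

(** * A generic point of the curve at q = 1 *)

Section Irreducibility.

Variables (k Fx : fieldType) (fr : {rmorphism {poly k} -> Fx}) (p : int).
Hypotheses (fr_inj : injective fr) (p0 : p != 0).

Local Notation a := (chebp_up k p).
Local Notation b := (chebp_down k p).
Let m := `|p|%N.
Definition gen_Q : Fx := fr a / fr b.
(** The value of E for which [chebX] takes the free value x at Q = a/b. *)
Definition gen_e : Fx := (fr 'X - gen_Q - gen_Q^-1) / (1 - gen_Q).
Definition gen_morph : {rmorphism {poly k} -> Fx} :=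
  horner_eval gen_Q \o map_poly (fr \o polyC).

Let m0 : (0 < m)%N. Proof. by rewrite absz_gt0. Qed.

Let a0 : fr a != 0.
Proof.
rewrite (raddf_eq0 _ fr_inj) -size_poly_gt0.
by case: (size_chebp_up_down k p0) => -[-> _].
Qed.

Let b0 : fr b != 0.
Proof.
rewrite (raddf_eq0 _ fr_inj) -size_poly_gt0.
by case: (size_chebp_up_down k p0) => -[_ ->].
Qed.

Lemma gen_Q_neq0 : gen_Q != 0.
Proof. by rewrite /gen_Q mulf_neq0 ?invr_eq0. Qed.

Let Q1 : 1 - gen_Q != 0.
Proof.
rewrite subr_eq0 eq_sym /gen_Q -(inj_eq (mulIf b0)) mul1r mulfVK // (inj_eq fr_inj).
apply/eqP => /(congr1 (fun u : {poly k} => size u)).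
by case: (size_chebp_up_down k p0) => -[-> ->]; lia.
Qed.

Let x_e0 : fr 'X = chebX gen_e gen_Q.
Proof. by rewrite /chebX /gen_e; field; rewrite gen_Q_neq0 Q1. Qed.

Lemma Gam_generic_point : Gam p gen_e gen_Q = 0.
Proof.
apply: (mulfI Q1); rewrite mulr0 (@Gam_chebyshev _ _ gen_Q_neq0 (fun i => fr (chebp k i))).
- by rewrite -!rmorphB -/(chebp_up k p) -/(chebp_down k p) /gen_Q mulfVK // subrr.
- by move=> i; rewrite -x_e0 chebp_rec rmorphB rmorphM.
- by rewrite /chebp /= rmorph0.
- by rewrite /chebp /= rmorph1.
Qed.

Lemma gen_e_neq0 : gen_e != 0.
Proof.
apply/eqP => e00; have := Gam_generic_point; rewrite e00.
by apply/eqP; exact: Gam_E0 gen_Q_neq0.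
Qed.

(** The evaluation is at e^-1 because C_p, unlike C_p^op, vanishes at the inverse of E. *)
Definition gen_ev (P : {poly {poly k}}) : Fx := (map_poly gen_morph P).[gen_e^-1].

(** On the generic point E is affine in x over the field of Q, so a relation of E-degree below |p|
    becomes one of x-degree below |p|, against [generic_point_free]. *)
Lemma gen_ev_neq0 (P : {poly {poly k}}) : P != 0 -> (size P <= m)%N -> gen_ev P != 0.
Proof.
move=> P0 Pm; pose u : {poly k} := 'X * (1 - 'X).
have u0 : u != 0.
  by rewrite mulf_neq0 ?polyX_eq0 // -oppr_eq0 opprB -[1]polyC1 polyXsubC_eq0.
(* Here u e = Q x - (1 + Q^2), which is [g] at x. Reversing P and scaling by powers of u gives A(u
   e) = (u e)^(m-1) P(e^-1), with coefficients polynomial in Q. *)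
pose A := \poly_(i < m) (P`_(m.-1 - i) * u ^+ (m.-1 - i)).
pose g : {poly {poly k}} := 'X *: 'X - (1 + 'X^2)%:P.
have A0 : A != 0.
  apply: contraNneq P0 => A0; apply/eqP/polyP => j; rewrite coef0.
  have [jm|jm] := ltnP j m; last by rewrite nth_default // (leq_trans Pm).
  have := congr1 (fun v : {poly {poly k}} => v`_(m.-1 - j)) A0.
  rewrite coef_poly coef0 ifT; last by lia.
  have -> : (m.-1 - (m.-1 - j) = j)%N by lia.
  by move/eqP; rewrite mulf_eq0 expf_eq0 (negPf u0) andbF orbF => /eqP.
have sg : size g = 2.
  rewrite size_polyDl size_scale ?polyX_eq0 // size_polyX //.
  by rewrite size_polyN (leq_ltn_trans (size_polyC_leq1 _)).
have AP : A \Po g != 0 by rewrite comp_poly2_eq0.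
apply: contraNneq AP => evP; apply/eqP.
have ab_m : (m < size a)%N || (m < size b)%N.
  by apply/orP; case: (size_chebp_up_down k p0) => -[-> ->]; [left|right].
have sA : (size (A \Po g) <= m)%N.
  have := size_comp_poly A g; rewrite sg muln1.
  have : (size A <= m)%N by exact: size_poly.
  by move: (size A) (size (A \Po g)) m0 => x y; lia.
have a0' : a != 0 by rewrite -(raddf_eq0 _ fr_inj).
have b0' : b != 0 by rewrite -(raddf_eq0 _ fr_inj).
apply: (generic_point_free (coprime_chebp_up_down k p) a0' b0' fr_inj ab_m sA).
rewrite -/gen_Q; pose h := map_poly gen_morph (A \Po g).
transitivity h.[fr 'X].
  rewrite (@horner_coef_wide _ (size (A \Po g))) ?size_poly //.
  by apply: eq_bigr => j _; rewrite coef_map.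
have psiX : gen_morph 'X = gen_Q by rewrite /gen_morph /= map_polyX horner_evalE hornerX.
have gx : (map_poly gen_morph g).[fr 'X] = gen_morph u * gen_e.
  have -> : (map_poly gen_morph g).[fr 'X] = gen_morph 'X * fr 'X - gen_morph (1 + 'X^2).
    by rewrite /g rmorphB /= map_polyZ map_polyX map_polyC hornerD hornerN hornerZ hornerX hornerC.
  have -> : gen_morph (1 + 'X^2) = 1 + gen_Q ^+ 2 by rewrite rmorphD rmorph1 rmorphXn psiX.
  have -> : gen_morph u = gen_Q * (1 - gen_Q) by rewrite /u rmorphM rmorphB rmorph1 psiX.
  by rewrite psiX x_e0 /chebX; field; exact: gen_Q_neq0.
rewrite /h map_comp_poly horner_comp gx.
rewrite (@horner_coef_wide _ m) ?(leq_trans (size_poly _ _)) ?size_poly //.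
transitivity (gen_morph u ^+ m.-1 * gen_e ^+ m.-1 * gen_ev P); last by rewrite evP mulr0.
rewrite /gen_ev (@horner_coef_wide _ m) ?(leq_trans (size_poly _ _)) // mulr_sumr.
rewrite [RHS](reindex_inj rev_ord_inj); apply: eq_bigr => i _.
have -> : nat_of_ord (rev_ord i) = (m.-1 - i)%N by rewrite /=; have := ltn_ord i; lia.
have im : (i <= m.-1)%N by have := ltn_ord i; lia.
have -> : (map_poly gen_morph A)`_i = gen_morph P`_(m.-1 - i) * gen_morph u ^+ (m.-1 - i).
  rewrite coef_map coef_poly ltn_ord [LHS]rmorphM; congr (_ * _); exact: rmorphXn.
have -> : (map_poly gen_morph P)`_(m.-1 - i) = gen_morph P`_(m.-1 - i) by rewrite coef_map.
have split x : x ^+ m.-1 = x ^+ (m.-1 - i) * x ^+ i :> Fx by rewrite -exprD subnK.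
rewrite exprMn !split exprVn; have := expf_neq0 (m.-1 - i) gen_e_neq0.
move: (gen_e ^+ (m.-1 - i)) (gen_e ^+ i)
  (gen_morph u ^+ i) (gen_morph u ^+ (m.-1 - i)) (gen_morph _).
by move=> x y z t w x0; field.
Qed.

Lemma no_factorization (C : {poly {poly k}}) (t : {poly k}) (S P : {poly {poly k}}) :
    C != 0 -> gen_ev C = 0 -> t != 0 -> t *: C = S * P ->
  (size S <= m)%N -> (size P <= m)%N -> False.
Proof.
move=> C0 evC t0 tC Sm Pm; have S0 : S != 0.
  apply: contraNneq C0 => S0; move/eqP: tC; rewrite S0 mul0r -mul_polyC mulf_eq0.
  by rewrite polyC_eq0 (negPf t0).
have P0 : P != 0.
  apply: contraNneq C0 => P0; move/eqP: tC; rewrite P0 mulr0 -mul_polyC mulf_eq0.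
  by rewrite polyC_eq0 (negPf t0).
have : gen_ev (t *: C) = 0 by rewrite /gen_ev map_polyZ hornerZ -/(gen_ev C) evC mulr0.
rewrite tC /gen_ev rmorphM hornerM => /eqP; rewrite mulf_eq0.
by rewrite (negPf (gen_ev_neq0 S0 Sm)) (negPf (gen_ev_neq0 P0 Pm)).
Qed.

End Irreducibility.

(** A ring morphism out of Z[q][Q] is determined by the images of q and Q; this carries the
    identities for the numerators between the various coefficient rings. *)
Lemma int_poly2_morph (F : fieldType) (chi : {rmorphism {poly {poly int}} -> F}) N :
  chi N = eval2 N (chi 'X, chi 'X%:P).
Proof.
have chiC c : chi c%:P = (map_poly intr c).[chi 'X%:P].
  elim/poly_ind: c => [|c n IH]; first by rewrite !rmorph0 horner0.
  rewrite polyCD polyCM !(rmorphD, rmorphM) /= map_polyX map_polyC hornerMXaddC -IH.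
  by congr (_ + _); rewrite -[n in LHS]intz !rmorph_int.
elim/poly_ind: N => [|N c IH]; first by rewrite rmorph0 eval20.
by rewrite rmorphD rmorphM IH chiC eval2D eval2M eval2X eval2C.
Qed.

(** * The C-polynomial of a twist knot *)

Section FractionMorphism.

Variables (D : idomainType) (K : fieldType) (fr : {rmorphism D -> K}).
Variables (tau : {rmorphism D -> D}) (sc : K -> K).
Hypotheses (fr_inj : injective fr) (tau_inj : injective tau).
Hypothesis fr_surj : forall c, exists u v, v != 0 /\ c = fr u / fr v.
Hypothesis scE : forall u v, v != 0 -> sc (fr u / fr v) = fr (tau u) / fr (tau v).

Let fr0 v : v != 0 -> fr v != 0. Proof. by rewrite (raddf_eq0 _ fr_inj). Qed.
Let tau0 v : v != 0 -> tau v != 0. Proof. by rewrite (raddf_eq0 _ tau_inj). Qed.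

Lemma fraction_zmod_morphism : zmod_morphism sc.
Proof.
move=> x y; have [u [v [v0 ->]]] := fr_surj x; have [w [z [z0 ->]]] := fr_surj y.
have [v0' z0'] := (fr0 v0, fr0 z0).
have -> : fr u / fr v - fr w / fr z = fr (u * z - w * v) / fr (v * z).
  by rewrite rmorphB !rmorphM; field; rewrite v0' z0'.
rewrite !scE ?mulf_neq0 // !(rmorphB, rmorphM); field.
by rewrite !fr0 // tau0.
Qed.

Lemma fraction_monoid_morphism : monoid_morphism sc.
Proof.
split.
  have -> : 1 = fr 1 / fr 1 by rewrite rmorph1 divr1.
  by rewrite scE ?oner_neq0 // !rmorph1.
move=> x y; have [u [v [v0 ->]]] := fr_surj x; have [w [z [z0 ->]]] := fr_surj y.
have -> : fr u / fr v * (fr w / fr z) = fr (u * w) / fr (v * z).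
  by rewrite !rmorphM mulf_div.
by rewrite !scE ?mulf_neq0 // !rmorphM mulf_div.
Qed.

End FractionMorphism.

Lemma tofrac_inj (D : idomainType) : injective (@FracField.tofrac D).
Proof. by move=> x y /eqP; rewrite tofrac_eq => /eqP. Qed.

Section FracScale.

Variables (k : fieldType) (a : k).
Hypothesis a0 : a != 0.
Local Notation fr := (@FracField.tofrac {poly k}).
Local Notation scale := (frac_scale a).

Lemma frac_scale_tofrac u : scale (fr u) = fr (u \Po (a *: 'X)).
Proof.
have := frac_scale_div u a0 (oner_neq0 _); rewrite tofrac1 divr1 => ->.
by rewrite comp_polyC tofrac1 divr1.
Qed.

Lemma frac_scale_zmod_morphism : zmod_morphism scale.
Proof.
apply: (@fraction_zmod_morphism _ _ fr (comp_poly (a *: 'X))).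
- by move=> x y; exact: tofrac_inj.
- by move=> x y; exact: comp_scaleX_inj.
- move=> c; exists (frac (repr c)).1, (frac (repr c)).2.
  by split; [exact: denom_ratioP|exact: frac_repr].
- by move=> u v v0; exact: frac_scale_div.
Qed.

Lemma frac_scale_monoid_morphism : monoid_morphism scale.
Proof.
apply: (@fraction_monoid_morphism _ _ fr (comp_poly (a *: 'X))).
- move=> c; exists (frac (repr c)).1, (frac (repr c)).2.
  by split; [exact: denom_ratioP|exact: frac_repr].
- by move=> u v v0; exact: frac_scale_div.
Qed.

End FracScale.

Lemma q_neq0 : q_ != 0.
Proof. by rewrite tofrac_eq0 polyX_eq0. Qed.

Lemma q_pow_neq1 n : (0 < n)%N -> 1 - q_ ^+ n != 0.
Proof.
move=> n0; rewrite subr_eq0 -tofracXn -tofrac1 tofrac_eq.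
apply/eqP => /(congr1 (fun u : {poly rat} => size u)).
by rewrite size_poly1 size_polyXn => -[n0']; rewrite -n0' in n0.
Qed.

HB.instance Definition _ := GRing.isZmodMorphism.Build QqQ QqQ qshift
  (frac_scale_zmod_morphism q_neq0).
HB.instance Definition _ := GRing.isMonoidMorphism.Build QqQ QqQ qshift
  (frac_scale_monoid_morphism q_neq0).

Lemma qshift_inj : injective qshift.
Proof. exact: fmorph_inj. Qed.

Lemma skew_mulE P S : skew_mul P S = smul qshift P S.
Proof. by rewrite smulE. Qed.

Lemma left_ideal_set1 (C A : {poly QqQ}) :
  left_ideal [set C]%classic A <-> exists S, A = smul qshift S C.
Proof.
split=> [[s [sC ->]]|[S ->]].
  exists (\sum_(x <- s) x.1); rewrite smul_suml big_seq [RHS]big_seq.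
  by apply: eq_bigr => x xs; rewrite skew_mulE (sC x xs).
exists [:: (S, C)]; split; last by rewrite big_seq1 skew_mulE.
by move=> x; rewrite inE => /eqP ->.
Qed.

Lemma char_poly_unique f (C C' : {poly QqQ}) : C \is monic -> C' \is monic ->
  is_char_poly f C -> is_char_poly f C' -> C = C'.
Proof.
move=> mC mC' fC fC'.
have gen (P : {poly QqQ}) : left_ideal [set P]%classic P.
  by apply/left_ideal_set1; exists 1; rewrite -polyC1 smulCl scale1r.
have /left_ideal_set1[S CE] : left_ideal [set C']%classic C.
  by rewrite -fC' fC; exact: gen.
have /left_ideal_set1[S' C'E] : left_ideal [set C]%classic C'.
  by rewrite -fC fC'; exact: gen.
exact: (monic_associates (sigma := qshift) qshift_inj mC mC' CE C'E).
Qed.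

Lemma iter_opQ i g n : iter i opQ g n = (q_ ^+ n) ^+ i * g n.
Proof.
elim: i => [|i IH] /=; first by rewrite expr0 mul1r.
by rewrite /opQ IH mulrA -exprS.
Qed.

Lemma iter_opE j f n : iter j opE f n = f (n + j)%N.
Proof.
elim: j n => [|j IH] n /=; first by rewrite addn0.
by rewrite /opE IH addSnnS.
Qed.

Lemma actE P f n : act P f n = qact q_ P f n.
Proof.
apply: eq_bigr => j _; rewrite horner_coef mulr_suml; apply: eq_bigr => i _.
by rewrite iter_opQ iter_opE mulrA.
Qed.

Lemma to_loc_smul S P :
  to_loc (smul (comp_poly (q_ *: 'X)) S P) = smul qshift (to_loc S) (to_loc P).
Proof.
by apply: map_smul => c; apply/esym; exact: (frac_scale_tofrac q_neq0).
Qed.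

(** Pseudo-division of an annihilator by [Ct] leaves a shorter annihilator, hence 0; in the
    localization the multiplier t is invertible. *)
Lemma char_poly_criterion f (C : {poly QqQ}) (u : QqQ) (Ct : {poly {poly Qq}}) :
    u != 0 -> to_loc Ct = u *: C -> annihilator f Ct -> Ct != 0 ->
    (forall R, annihilator f R -> (size R < size Ct)%N -> R = 0) ->
  is_char_poly f C.
Proof.
move=> u0 CtE fCt Ct0 minCt; have CE : C = u^-1 *: to_loc Ct.
  by rewrite CtE scalerA mulVf // scale1r.
apply/funext => A; apply/propext; split; last first.
  case/left_ideal_set1 => S ->; exists [:: (smul qshift S (u^-1)%:P, to_loc Ct)].
  split; first by move=> x; rewrite inE => /eqP -> /=; exists Ct.
  by rewrite big_seq1 /= skew_mulE -smulA smulCl -CE.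
case=> s [sI ->]; apply/left_ideal_set1.
elim: s sI => [|[T A'] s IH] sI; first by exists 0; rewrite big_nil smul0l.
have [|S sE] := IH; first by move=> x xs; apply: sI; rewrite inE xs orbT.
have [P fP /= PA] := sI (T, A') (mem_head _ _).
have inj1 : injective (comp_poly (q_ *: 'X)) := comp_scaleX_inj q_neq0.
have [t [S' [U [t0 tP UC]]]] := skew_pseudo_division inj1 P Ct0.
have U0 : U = 0.
  apply: minCt UC => n; have := fP n; rewrite !actE => Pn.
  have : qact q_ (t *: P) f n = 0 by rewrite qactZ Pn mulr0.
  rewrite tP qactD qact_smul big1 ?add0r // => i _.
  by have := fCt (n + i)%N; rewrite actE => ->; rewrite mulr0.
have t0' : FracField.tofrac t != 0 by rewrite tofrac_eq0.
have tP' : t *: P = smul (comp_poly (q_ *: 'X)) S' Ct by rewrite tP U0 addr0.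
have A'E : A' = smul qshift ((FracField.tofrac t)^-1 *: smul qshift (to_loc S') u%:P) C.
  rewrite smulZl -smulA smulCl -CtE -to_loc_smul -tP'.
  by rewrite /to_loc map_polyZ scalerA mulVf // scale1r -PA.
exists (smul qshift T ((FracField.tofrac t)^-1 *: smul qshift (to_loc S') u%:P) + S).
by rewrite big_cons sE skew_mulE /= smulDl -smulA -A'E.
Qed.

Lemma annihilator_size_lower (f : nat -> Qq) (m : nat) :
    (forall R : {poly {poly {poly rat}}}, R != 0 -> (size R <= m)%N ->
      (forall n, qact q_ (map_poly (map_poly (@FracField.tofrac {poly rat})) R) f n = 0) ->
      False) ->
  forall R, annihilator f R -> (size R < m.+1)%N -> R = 0.
Proof.
move=> H R fR Rm; apply/eqP; apply: contraT => R0; exfalso.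
have [d [R' [d0 R'E]]] := clear_denominators_poly R.
have d0' : (FracField.tofrac d)%:P != 0 :> {poly Qq} by rewrite polyC_eq0 tofrac_eq0.
have szR' : size R' = size R.
  rewrite -(size_map_inj_poly (f := map_poly (@FracField.tofrac {poly rat}))) ?rmorph0 //.
    by rewrite R'E mul_polyC size_scale.
  by apply: map_inj_poly; [exact: tofrac_inj|exact: tofrac0].
have R'0 : (0 < size R')%N by rewrite szR' size_poly_gt0.
have R'm : (size R' <= m)%N by rewrite szR'.
apply: (H R') => [||n]; [by rewrite -size_poly_gt0; exact: R'0|exact: R'm|].
by rewrite R'E mul_polyC qactZ -actE fR mulr0.
Qed.

Section Torsion.

Variables (F : fieldType) (q : F).
Hypotheses (q_neq0 : q != 0) (q_pow_neq1 : forall n, (0 < n)%N -> 1 - q ^+ n != 0).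

Lemma eventually_not_root (R : {poly F}) : R != 0 ->
  exists n0, forall n, (n0 <= n)%N -> R.[q ^+ n] != 0.
Proof.
have [d] := ubnP (size R); elim: d R => // d IH R; rewrite ltnS => Rd R0.
have [[n1 /factor_theorem[S RS]]|noroot] := pselect (exists n, root R (q ^+ n)); last first.
  by exists 0%N => n _; apply/negP => Rn; apply: noroot; exists n.
have S0 : S != 0 by apply: contraNneq R0 => S0; rewrite RS S0 mul0r.
have [||n0 Sn0] := IH S => //.
  by rewrite (leq_trans _ Rd) // RS size_Mmonic ?monicXsubC // size_XsubC addn2.
exists (maxn n0 n1.+1) => n; rewrite geq_max => /andP[nn0 nn1].
rewrite RS hornerM mulf_neq0 ?Sn0 // hornerXsubC -(subnK (ltnW nn1)) exprD.
have -> : q ^+ (n - n1) * q ^+ n1 - q ^+ n1 = - (1 - q ^+ (n - n1)) * q ^+ n1 by ring.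
by rewrite mulf_neq0 ?expf_neq0 // oppr_eq0 q_pow_neq1 // subn_gt0.
Qed.

(** A nonzero R has no root q^n for large n, so the sequence would vanish eventually. The lowest
    coefficient of the recursion is nonzero, so the vanishing propagates back to n = 0, where the
    value is 1. *)
Lemma cyclotomic_not_torsion p (R : {poly F}) : p != 0 -> R != 0 ->
  (forall n, R.[q ^+ n] * cyclotomic q p n = 0) -> False.
Proof.
move=> p0 R0 Rf; have [n0 Rn0] := eventually_not_root R0.
have f_late n : (n0 <= n)%N -> cyclotomic q p n = 0.
  by move=> /Rn0 Rn; have /eqP := Rf n; rewrite mulf_eq0 (negPf Rn) => /eqP.
suff : cyclotomic q p 0 = 0 by rewrite cyclotomic0 // => /eqP; rewrite oner_eq0.
elim: n0 f_late {Rn0} => [|n0 IH] f_late; first exact: f_late.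
apply: IH => n; rewrite leq_eqVlt => /predU1P[<-|]; last exact: f_late.
have := @cyclotomic_rec _ q q_neq0 q_pow_neq1 p n0; rewrite big_ord_recl big1 => [|i _]; last first.
  by rewrite f_late ?mulr0 //= /bump add1n addnS ltnS leq_addr.
have m0 : (0 < `|p|)%N by rewrite absz_gt0.
have qn0 : q ^+ n0 != 0 by rewrite expf_neq0.
have cJ0 : cJ p q (q ^+ n0) 0 != 0.
  rewrite /cJ m0 subn0 !mulf_neq0 //.
  - by rewrite expfz_neq0 // mulf_neq0 ?expf_neq0.
  - by rewrite newton_co_lead_neq0 // mulf_neq0 ?expf_neq0.
  - rewrite big_seq; apply: (big_ind (fun x : F => x != 0)); [exact: oner_neq0|exact: mulf_neq0|].
    move=> s; rewrite mem_index_iota => /andP[s0 _].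
    by rewrite -exprD q_pow_neq1 // addn_gt0 s0.
  - apply: (big_ind (fun x : F => x != 0)); [exact: oner_neq0|exact: mulf_neq0|].
    by move=> s _; rewrite oppr_eq0 mulf_neq0 ?expf_neq0.
rewrite addr0 addn0 => /eqP; rewrite !mulf_eq0 (negPf (q_pow_neq1 _)) ?addn_gt0 ?m0 ?orbT //.
by rewrite (negPf cJ0) => /eqP.
Qed.

End Torsion.

Section Numerators.

Variables (p : int) (a b : nat) (N : nat -> {poly {poly int}}).
Hypothesis numE : forall i (F : fieldType) (q Q : F), q != 0 -> Q != 0 ->
  q ^+ a * Q ^+ b * cJ p q Q i = eval2 (N i) (Q, q).

Local Notation m := `|p|%N.
Local Notation B := {poly {poly rat}}.
Local Notation at1 := (map_poly (horner_eval (1 : rat))).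

Let ratN (i : nat) : B := map_poly (map_poly intr) (N i).

(** The monic recursion times its monomial denominator and 1 - q^|p| Q, the operator form of the
    factor in [cyclotomic_rec]. *)
Definition ncC_num : {poly B} :=
  (1 - ('X^m)%:P * 'X) *: \poly_(i < m.+1) ratN i.

Lemma cJ_lead (F : fieldType) (q Q : F) : cJ p q Q m = 1.
Proof. by rewrite /cJ ltnn eqxx. Qed.

Definition cJ_poly (F : fieldType) (q Q : F) : {poly F} := \poly_(i < m.+1) cJ p q Q i.

Lemma size_cJ_poly (F : fieldType) (q Q : F) : size (cJ_poly q Q) = m.+1.
Proof. by rewrite size_poly_eq // cJ_lead oner_neq0. Qed.

Lemma coef_cJ_poly (F : fieldType) (q Q : F) i : (cJ_poly q Q)`_i = cJ p q Q i.
Proof.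
rewrite coef_poly; case: ifPn => //; rewrite -leqNgt => mi.
by rewrite /cJ ltnNge ltnW //= eqn_leq (leqNgt i) mi.
Qed.

Lemma cJ_poly_monic (F : fieldType) (q Q : F) : cJ_poly q Q \is monic.
Proof. by rewrite monicE lead_coefE size_cJ_poly coef_poly ltnSn cJ_lead. Qed.

Lemma at1_ratN_lead : at1 (ratN m) != 0.
Proof.
pose chi : {rmorphism {poly {poly int}} -> rat} :=
  horner_eval (1 : rat) \o at1 \o map_poly (map_poly intr).
apply/eqP => N0; have : chi (N m) = 0 by rewrite /chi /= N0 horner_evalE horner0.
have -> : chi (N m) = 1.
  rewrite int_poly2_morph.
  have -> : chi 'X = 1 by rewrite /chi /= !map_polyX horner_evalE hornerX.
  have -> : chi 'X%:P = 1.
    by rewrite /chi /= !map_polyC /= map_polyX !horner_evalE !hornerE.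
  by rewrite -numE ?oner_neq0 // cJ_lead !expr1n !mulr1.
by move/eqP; rewrite oner_eq0.
Qed.

Lemma ratN_lead : ratN m != 0.
Proof. by apply: contraNneq at1_ratN_lead => ->; rewrite rmorph0. Qed.

Let factor_neq0 : 1 - ('X^m)%:P * 'X != 0 :> B.
Proof.
apply/eqP => /(congr1 (fun u : B => u`_0)).
rewrite coefB coefMX coef1 coef0 subr0 => /eqP; exact/negP/oner_neq0.
Qed.

Lemma size_ncC_num : size ncC_num = m.+1.
Proof. by rewrite size_scale // size_poly_eq // ratN_lead. Qed.

Lemma numerator_eval (F : fieldType) (chi : {rmorphism {poly {poly int}} -> F}) (q Q : F) i :
  chi 'X = Q -> chi 'X%:P = q -> q != 0 -> Q != 0 ->
  chi (N i) = q ^+ a * Q ^+ b * cJ p q Q i.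
Proof. by move=> XQ Yq q0 Q0; rewrite numE // -XQ -Yq -int_poly2_morph. Qed.

Lemma ncC_num_act (F : fieldType) (fr : {rmorphism {poly rat} -> F}) (f : nat -> F) :
    fr 'X != 0 ->
    (forall n, (1 - fr 'X ^+ (n + m)) *
       \sum_(i < m.+1) cJ p (fr 'X) (fr 'X ^+ n) i * f (n + i)%N = 0) ->
  forall n, qact (fr 'X) (map_poly (map_poly fr) ncC_num) f n = 0.
Proof.
move=> q0 frec n; set q := fr 'X in q0 frec *.
have facE : (map_poly fr (1 - ('X^m)%:P * 'X)).[q ^+ n] = 1 - q ^+ (n + m).
  rewrite rmorphB rmorph1 rmorphM /= map_polyC map_polyX hornerD hornerN hornerM.
  by rewrite hornerX !hornerC /= rmorphXn -exprD [(m + n)%N]addnC.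
rewrite map_polyZ qactZ facE.
rewrite (@qact_widen _ _ m.+1); last by rewrite (leq_trans (size_poly _ _)) ?size_poly.
have -> : \sum_(i < m.+1) ((map_poly (map_poly fr) (\poly_(i < m.+1) ratN i))`_i).[q ^+ n]
      * f (n + i)%N
   = q ^+ a * (q ^+ n) ^+ b * \sum_(i < m.+1) cJ p q (q ^+ n) i * f (n + i)%N.
  rewrite mulr_sumr; apply: eq_bigr => i _; rewrite mulrA; congr (_ * _).
  rewrite coef_map coef_poly ltn_ord /=.
  pose chi : {rmorphism {poly {poly int}} -> F} :=
    horner_eval (q ^+ n) \o map_poly fr \o map_poly (map_poly intr).
  apply: (numerator_eval (chi := chi)) => //; last by rewrite expf_neq0.
    by rewrite /chi /= !map_polyX horner_evalE hornerX.
  by rewrite /chi /= !map_polyC /= map_polyX horner_evalE hornerC.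
by rewrite mulrCA frec mulr0.
Qed.

Lemma map_ncC_num (F : fieldType) (chi : {rmorphism B -> F}) (q Q : F) :
  chi 'X = Q -> chi 'X%:P = q -> q != 0 -> Q != 0 ->
  map_poly chi ncC_num = ((1 - q ^+ m * Q) * (q ^+ a * Q ^+ b)) *: cJ_poly q Q.
Proof.
move=> XQ Yq q0 Q0.
have facE : chi (1 - ('X^m)%:P * 'X) = 1 - q ^+ m * Q.
  by rewrite rmorphB rmorph1 rmorphM XQ polyC_exp rmorphXn Yq.
rewrite map_polyZ facE -scalerA; congr (_ *: _); apply/polyP => i.
rewrite coef_map coefZ !coef_poly; case: ifP => _; last by rewrite raddf0 mulr0.
pose chi' : {rmorphism {poly {poly int}} -> F} := chi \o map_poly (map_poly intr).
apply: (numerator_eval (chi := chi')) => //; rewrite -?XQ -?Yq /chi' /=.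
  by rewrite !map_polyX.
by rewrite !map_polyC /= map_polyX.
Qed.

Section GenericEvaluation.

Variables (Fx : fieldType) (fr : {rmorphism {poly rat} -> Fx}).
Hypotheses (fr_inj : injective fr) (p0 : p != 0).

Lemma at1_ncC_num_neq0 : map_poly at1 ncC_num != 0.
Proof.
rewrite map_polyZ /= -size_poly_eq0 size_scale.
  rewrite size_poly_eq0; apply: contraNneq at1_ratN_lead => /(congr1 (fun u : B => u`_m)).
  by rewrite coef_map coef_poly ltnSn coef0 => /eqP.
rewrite rmorphB rmorph1 rmorphM /= map_polyC map_polyX /= horner_evalE hornerXn expr1n.
by rewrite mul1r -oppr_eq0 opprB -[1]polyC1 polyXsubC_eq0.
Qed.

Lemma gen_ev_ncC_num : gen_ev fr p (map_poly at1 ncC_num) = 0.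
Proof.
have Q0 := gen_Q_neq0 fr_inj p0; have e0 := gen_e_neq0 fr_inj p0.
set Q := gen_Q fr p in Q0 *; set e := gen_e fr p in e0 *.
have PE : map_poly (gen_morph fr p) (map_poly at1 (\poly_(i < m.+1) ratN i))
    = \poly_(i < m.+1) (Q ^+ b * cJ p 1 Q i).
  apply/polyP => i; rewrite coef_poly coef_map coef_map coef_poly.
  case: ifP => _; last by rewrite !raddf0.
  pose chi : {rmorphism {poly {poly int}} -> Fx} :=
    gen_morph fr p \o at1 \o map_poly (map_poly intr).
  rewrite -[LHS]/(chi (N i)) (numerator_eval (q := 1) (Q := Q)) ?oner_neq0 //.
  - by rewrite expr1n mul1r.
  - by rewrite /chi /= !map_polyX horner_evalE hornerX.
  - transitivity (gen_morph fr p 1); last exact: rmorph1.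
    congr (gen_morph fr p _).
    by rewrite /= !map_polyC /= map_polyX horner_evalE hornerX.
rewrite /gen_ev map_polyZ map_polyZ hornerZ PE.
rewrite horner_poly (reindex_inj rev_ord_inj) /=.
rewrite (eq_bigr (fun j : 'I_m.+1 => Q ^+ b * e^-1 ^+ m * (cJ p 1 Q (m - j) * e ^+ j))).
  by rewrite -mulr_sumr cJ_Gam // Gam_generic_point // !mulr0.
move=> j _; have jm : (j <= m)%N by rewrite -ltnS.
have eD : e^-1 ^+ m = e^-1 ^+ (m - j) * e^-1 ^+ j by rewrite -exprD subnK.
rewrite subSS -/e eD !exprVn.
have := expf_neq0 j e0; move: (e ^+ j) (e ^+ (m - j))^-1 (cJ _ _ _ _) => x y z x0.
by field.
Qed.

Lemma annihilator_order_cJ (f : nat -> Fx) (R : {poly B}) :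
    (forall n, (1 - fr 'X ^+ (n + m)) *
       \sum_(i < m.+1) cJ p (fr 'X) (fr 'X ^+ n) i * f (n + i)%N = 0) ->
    (forall r : {poly Fx}, r != 0 -> (forall n, r.[fr 'X ^+ n] * f n = 0) -> False) ->
  R != 0 -> (size R <= m)%N ->
  (forall n, qact (fr 'X) (map_poly (map_poly fr) R) f n = 0) -> False.
Proof.
move=> frec ftors.
have q0 : fr 'X != 0 by rewrite (raddf_eq0 _ fr_inj) polyX_eq0.
apply: (annihilator_order fr_inj size_ncC_num).
- exact: ncC_num_act.
- move=> t S P t0; apply: (no_factorization fr_inj p0) => //.
    exact: at1_ncC_num_neq0.
  exact: gen_ev_ncC_num.
- move=> r r0; apply: ftors; rewrite -size_poly_eq0 size_map_inj_poly ?rmorph0 //.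
  by rewrite size_poly_eq0.
Qed.

End GenericEvaluation.

End Numerators.


Definition Zq_Q_morph : {rmorphism {poly {poly int}} -> QqQ} :=
  @FracField.tofrac {poly Qq} \o map_poly (@FracField.tofrac {poly rat} \o map_poly intr).

Lemma Zq_Q_morphX : Zq_Q_morph 'X = FracField.tofrac 'X.
Proof. by rewrite /Zq_Q_morph /= map_polyX. Qed.

Lemma Zq_Q_morphY : Zq_Q_morph 'X%:P = FracField.tofrac q_%:P.
Proof. by rewrite /Zq_Q_morph /= map_polyC /= map_polyX. Qed.

Lemma Zq_Q_morph_inj : injective Zq_Q_morph.
Proof.
apply: inj_comp; first exact: tofrac_inj.
apply: map_inj_poly; last by rewrite /= rmorph0 tofrac0.
apply: inj_comp; first exact: tofrac_inj.
by apply: map_inj_poly; [exact: intr_inj|exact: mulr0z].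
Qed.

Definition q1_morph : {rmorphism {poly {poly int}} -> QQ} :=
  @FracField.tofrac {poly int} \o map_poly (horner_eval (1 : int)).

Lemma q1_morphX : q1_morph 'X = FracField.tofrac 'X.
Proof. by rewrite /q1_morph /= map_polyX. Qed.

Lemma q1_morphY : q1_morph 'X%:P = 1.
Proof. by rewrite /q1_morph /= map_polyC /= horner_evalE hornerX tofrac1. Qed.

Lemma rmorph_monomial (S S' : pzSemiRingType) (chi : {rmorphism S -> S'}) x y a b :
  chi (x ^+ a * y ^+ b) = chi x ^+ a * chi y ^+ b.
Proof. by rewrite rmorphM !rmorphXn. Qed.

Lemma monomial_frac a b : FracField.tofrac ((q_ ^+ a)%:P * 'X^b : {poly Qq})
  = Zq_Q_morph ('X%:P ^+ a * 'X ^+ b).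
Proof. by rewrite rmorph_monomial Zq_Q_morphX Zq_Q_morphY tofracM polyC_exp !tofracXn. Qed.

(** Two representations of c as a fraction agree after cross-multiplication in S, and this identity
    survives the specialization. *)
Lemma specialization_unique (K K' : fieldType) (S : comNzRingType)
    (chi : {rmorphism S -> K}) (chi' : {rmorphism S -> K'}) (u v x y : S) c r r' :
    injective chi -> chi' u != 0 -> chi' v != 0 ->
    chi u * c = chi x -> chi v * c = chi y ->
    chi' u * r = chi' x -> chi' v * r' = chi' y -> r = r'.
Proof.
move=> chi_inj u0 v0 cx cy rx r'y.
have vx : v * x = u * y by apply: chi_inj; rewrite !rmorphM -cx -cy; ring.
apply: (mulfI u0); apply: (mulfI v0); rewrite rx -rmorphM vx rmorphM -r'y.
by ring.
Qed.

Lemma specialize_q1_unique c r r' :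
  specialize_q1 c r -> specialize_q1 c r' -> r = r'.
Proof.
case=> a [b [N [cN rN]]] [a' [b' [N' [cN' rN']]]].
have mono k l : q1_morph ('X%:P ^+ k * 'X ^+ l) = FracField.tofrac 'X^l.
  by rewrite rmorph_monomial q1_morphX q1_morphY expr1n mul1r tofracXn.
have mono0 k l : q1_morph ('X%:P ^+ k * 'X ^+ l) != 0.
  by rewrite mono tofracXn expf_neq0 // tofrac_eq0 polyX_eq0.
rewrite !monomial_frac in cN cN'.
apply: (specialization_unique Zq_Q_morph_inj (mono0 a b) (mono0 a' b') cN cN').
  by rewrite mono.
by rewrite mono.
Qed.

Section TwistKnot.

Variables (p : int) (a b : nat) (N : nat -> {poly {poly int}}).
Hypothesis numE : forall i (F : fieldType) (q Q : F), q != 0 -> Q != 0 ->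
  q ^+ a * Q ^+ b * cJ p q Q i = eval2 (N i) (Q, q).

Local Notation m := `|p|%N.
Local Notation fr := (@FracField.tofrac {poly rat}).

Let qq : QqQ := FracField.tofrac q_%:P.
Let QQ0 : QqQ := FracField.tofrac 'X.

Let qq0 : qq != 0. Proof. by rewrite tofrac_eq0 polyC_eq0 q_neq0. Qed.
Let QQ00 : QQ0 != 0. Proof. by rewrite tofrac_eq0 polyX_eq0. Qed.

Lemma Jhat_act_rec n : (1 - fr 'X ^+ (n + m)) *
  \sum_(i < m.+1) cJ p (fr 'X) (fr 'X ^+ n) i * Jhat p (n + i)%N = 0.
Proof. exact: (cyclotomic_rec q_neq0 q_pow_neq1). Qed.

Lemma ncC_num_annihilates : annihilator (Jhat p) (map_poly (map_poly fr) (ncC_num p N)).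
Proof.
move=> n; rewrite actE; apply: (ncC_num_act numE) => //; last exact: Jhat_act_rec.
exact: q_neq0.
Qed.

Lemma Jhat_minimal R : annihilator (Jhat p) R -> (size R < m.+1)%N -> R = 0.
Proof.
apply: annihilator_size_lower => S S0 Sm.
have [p0|p0] := eqVneq p 0.
  by move: Sm; rewrite p0 leqn0 size_poly_eq0 (negPf S0).
apply: (annihilator_order_cJ numE (fr := fr)) => //; first exact: tofrac_inj.
  exact: Jhat_act_rec.
move=> r r0 rf; apply: (cyclotomic_not_torsion q_neq0 q_pow_neq1 p0 r0) => n.
exact: rf.
Qed.

Lemma to_loc_ncC_num : to_loc (map_poly (map_poly fr) (ncC_num p N)) =
  ((1 - qq ^+ m * QQ0) * (qq ^+ a * QQ0 ^+ b)) *: cJ_poly p qq QQ0.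
Proof.
rewrite /to_loc -map_poly_comp.
pose chi : {rmorphism {poly {poly rat}} -> QqQ} := @FracField.tofrac {poly Qq} \o map_poly fr.
apply: (map_ncC_num numE (chi := chi)) => //; rewrite /chi /=.
  by rewrite map_polyX.
by rewrite map_polyC.
Qed.

Lemma size_ncC_num_Qq : size (map_poly (map_poly fr) (ncC_num p N)) = m.+1.
Proof.
rewrite size_map_inj_poly ?rmorph0 ?(size_ncC_num numE) //.
by apply: map_inj_poly; [exact: tofrac_inj|exact: tofrac0].
Qed.

Lemma Jhat_char_poly : is_char_poly (Jhat p) (cJ_poly p qq QQ0).
Proof.
have Ct0 : map_poly (map_poly fr) (ncC_num p N) != 0.
  by rewrite -size_poly_eq0 size_ncC_num_Qq.
apply: (char_poly_criterion _ to_loc_ncC_num ncC_num_annihilates Ct0).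
  apply: contraNneq Ct0 => u0; rewrite -size_poly_eq0.
  rewrite -(size_map_inj_poly (f := @FracField.tofrac {poly Qq})) ?tofrac0 //;
    last exact: tofrac_inj.
  by rewrite -/(to_loc _) to_loc_ncC_num u0 scale0r size_poly0.
by move=> R; rewrite size_ncC_num_Qq; exact: Jhat_minimal.
Qed.

Lemma ncCpolyE : ncCpoly p = cJ_poly p qq QQ0.
Proof.
apply: xget_unique; first by split; [exact: Jhat_char_poly|exact: cJ_poly_monic].
move=> P [Pchar Pmonic].
exact: (char_poly_unique Pmonic (cJ_poly_monic p qq QQ0) Pchar Jhat_char_poly).
Qed.

Lemma CpolyE : Cpoly p = cJ_poly p 1 (FracField.tofrac 'X).
Proof.
have spec j : specialize_q1 (ncCpoly p)`_j (cJ_poly p 1 (FracField.tofrac 'X : QQ))`_j.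
  exists a, b, (N j); rewrite ncCpolyE !coef_cJ_poly; split.
    rewrite monomial_frac rmorph_monomial Zq_Q_morphX Zq_Q_morphY.
    exact: esym (numerator_eval numE (chi := Zq_Q_morph) j Zq_Q_morphX Zq_Q_morphY qq0 QQ00).
  have X0 : FracField.tofrac 'X != 0 :> QQ by rewrite tofrac_eq0 polyX_eq0.
  have := numerator_eval numE (chi := q1_morph) j q1_morphX q1_morphY (oner_neq0 _) X0.
  by rewrite expr1n mul1r tofracXn => <-.
apply: xget_unique => // P Pspec; apply/polyP => j.
exact: specialize_q1_unique (Pspec j) (spec j).
Qed.

End TwistKnot.

Lemma eval2_wide (F : fieldType) (N : {poly {poly int}}) (z : F * F) n : (size N <= n)%N ->
  eval2 N z = \sum_(j < n) (map_poly intr N`_j).[z.2] * z.1 ^+ j.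
Proof.
move=> Nn; rewrite -{1}[N]coefK poly_def eval2_sum.
rewrite (big_ord_widen n (fun j => eval2 (N`_j *: 'X^j) z)) // big_mkcond.
apply: eq_bigr => j _; case: ifPn => [_|]; last first.
  by rewrite -leqNgt => /(nth_default 0) ->; rewrite rmorph0 horner0 mul0r.
by rewrite -mul_polyC eval2M eval2Xn eval2X eval2C.
Qed.

(** * The zero set of the reversed C-polynomial *)

Section CopCurve.

Variables (p : int) (a b : nat) (N : nat -> {poly {poly int}}).
Hypothesis numE : forall i (F : fieldType) (q Q : F), q != 0 -> Q != 0 ->
  q ^+ a * Q ^+ b * cJ p q Q i = eval2 (N i) (Q, q).

Local Notation m := `|p|%N.
Local Notation fr := (@FracField.tofrac {poly int}).
Local Notation at1 := (map_poly (horner_eval (1 : int))).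

Let X : QQ := fr 'X.

Let X0 : X != 0. Proof. by rewrite tofrac_eq0 polyX_eq0. Qed.

Lemma coef_Cop j : (poly_op (Cpoly p))`_j = if (j < m.+1)%N then cJ p 1 X (m - j) else 0.
Proof.
rewrite /poly_op (CpolyE numE) size_cJ_poly coef_poly; case: ifP => // _.
exact: coef_cJ_poly.
Qed.

Lemma tofrac_numerator i : fr (at1 (N i)) = fr 'X^b * cJ p 1 X i.
Proof.
have := numerator_eval numE (chi := q1_morph) i q1_morphX q1_morphY (oner_neq0 _) X0.
by rewrite expr1n mul1r tofracXn.
Qed.

Variables (l : nat) (N0 : {poly {poly int}}).
Hypothesis N0E : map_poly fr N0 = fr 'X^l *: poly_op (Cpoly p).

Lemma coef_Cop_num j : fr N0`_j = fr 'X^l * (if (j < m.+1)%N then cJ p 1 X (m - j) else 0).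
Proof. by rewrite -coef_Cop -coefZ -N0E coef_map. Qed.

Lemma size_Cop_num : (size N0 <= m.+1)%N.
Proof.
apply/leq_sizeP => j mj; apply/eqP; rewrite -tofrac_eq0 coef_Cop_num.
by rewrite ltnNge mj mulr0.
Qed.

Lemma eval_Cop_num (F : fieldType) (Q : F) j : (j < m.+1)%N -> Q != 0 ->
  (map_poly intr N0`_j).[Q] = Q ^+ l * cJ p 1 Q (m - j).
Proof.
(* Clearing denominators gives an identity in Z[Q], which can be evaluated in any field. *)
move=> jm Q0; have e : 'X^b * N0`_j = 'X^l * at1 (N (m - j)).
  apply/tofrac_inj; rewrite !tofracM tofrac_numerator coef_Cop_num jm.
  exact: mulrCA.
pose chi : {rmorphism {poly {poly int}} -> F} := horner_eval Q \o map_poly intr \o at1.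
have chiX : chi 'X = Q by rewrite /chi /= !map_polyX horner_evalE hornerX.
have chiY : chi 'X%:P = 1.
  have at1Y : at1 'X%:P = 1 by rewrite map_polyC /= horner_evalE hornerX.
  by rewrite -[LHS]/((map_poly intr (at1 'X%:P) : {poly F}).[Q]) at1Y rmorph1 hornerC.
have := numerator_eval numE (m - j) chiX chiY (oner_neq0 _) Q0.
rewrite expr1n mul1r => chiE.
apply: (mulfI (expf_neq0 b Q0)); rewrite mulrCA -chiE.
have := congr1 (fun u : {poly int} => (map_poly intr u : {poly F}).[Q]) e.
by rewrite !rmorphM /= !map_polyXn !hornerM !hornerXn.
Qed.

Lemma eval2_Cop_num (F : fieldType) (z : F * F) : z.2 != 0 ->
  eval2 N0 z = z.2 ^+ l * (z.2 ^ p * Gam p z.1 z.2).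
Proof.
move=> z0; rewrite (eval2_wide _ size_Cop_num) -cJ_Gam // mulr_sumr.
by apply: eq_bigr => j _; rewrite eval_Cop_num // mulrA.
Qed.

(** C_p is monic, so the constant term of C_p^op in E is 1. Hence the cleared equation is not
    identically zero in E at any admissible Q, including Q = 0 when l = 0. *)
Lemma Cop_num0 : N0`_0 = 'X^l.
Proof.
by apply/tofrac_inj; rewrite coef_Cop_num /= subn0 cJ_lead mulr1.
Qed.

End CopCurve.

Section Curves.

Variables (C : numClosedFieldType) (p : int).

Lemma Cop_curve_Gam (z : C * C) : z.2 != 0 -> Cop_curve C p z <-> Gam p z.1 z.2 = 0.
Proof.
have [a [b [N numE]]] := cJ_numerators p.
move=> z0; split=> [[l [N0 [N0E _]]]|G0].
  rewrite (eval2_Cop_num numE N0E z0) => /eqP.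
  by rewrite !mulf_eq0 expf_eq0 expfz_eq0 (negPf z0) !andbF => /eqP.
pose N0 := \poly_(j < `|p|.+1) map_poly (horner_eval (1 : int)) (N (`|p| - j)%N).
have N0E : map_poly (@FracField.tofrac {poly int}) N0
    = FracField.tofrac 'X^b *: poly_op (Cpoly p).
  apply/polyP => j; rewrite coef_map coefZ (coef_Cop numE) coef_poly.
  case: ifP => _; last by rewrite mulr0 raddf0.
  exact: tofrac_numerator numE _.
exists b, N0; split=> //.
by rewrite (eval2_Cop_num numE N0E z0) G0 !mulr0.
Qed.

Lemma Cop_curve_equation (w : C * C) : Cop_curve C p w ->
  exists f : {poly {poly C}}, [/\ map_poly (horner_eval w.2) f != 0, f.[w.1, w.2] = 0
    & forall x y, f.[x, y] = 0 -> y != 0 -> Cop_curve C p (x, y)].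
Proof.
have [a [b [N numE]]] := cJ_numerators p.
case=> l [N0 [N0E w0 N0w]]; exists (map_poly (map_poly intr) N0); split => //.
- apply/eqP => /(congr1 (fun u : {poly C} => u`_0)).
  rewrite coef0 !coef_map (Cop_num0 numE N0E) /= map_polyXn horner_evalE hornerXn.
  by case: l w0 {N0E} => [_|l w0] /eqP; rewrite ?expr0 ?oner_eq0 // expf_eq0 (negPf (w0 _)).
- by move=> x y xy y0; exists l, N0; split.
Qed.

End Curves.

Theorem corollary1p5 (R : realType) (p : int) :
  dense_map_of_degree 2 (@phi R[i]) (phi_dom R[i])
    (A_curve R[i] p) (Cop_curve R[i] p).
Proof.
apply: dense_map_of_Gam_curve => [z|w].
  exact: Cop_curve_Gam.
exact: Cop_curve_equation.
Qed.
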